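(* Let $r\geq 2$ be an integer and let $\mathbf{H}=(H_1,\ldots,H_r)$ be an $r$-tuple of (finite, simple) graphs, each with at least one vertex. Let $d\in(0,1)$ be fixed and let $k\geq 2$ be the unique integer with $\frac{k-2}{k-1}<d\leq\frac{k-1}{k}$. Then $$p(n;\mathbf{H},d)=n^{-1/\beta(\mathbf{H};k)}.$$ That is: if $\beta(\mathbf{H};k)>0$, then the function $n\mapsto n^{-1/\beta(\mathbf{H};k)}$ is a perturbed vertex-Ramsey threshold function for $H_1,\ldots,H_r$ at density $d$; and if $\beta(\mathbf{H};k)=0$ (where by convention $n^{-1/0}:=0$), then every graph on sufficiently many vertices of density at least $d$ is $(H_1,\ldots,H_r)_v$-Ramsey.
   Context: Graphs are finite and simple; $v(G)$, $e(G)$ denote the numbers of vertices and edges of $G$; the density of $G$ is $d(G):=e(G)/\binom{v(G)}{2}$. A graph is called non-empty if it has at least one vertex (the empty graph $\emptyset$ has no vertices). $G(n,p)$ is the binomial random graph on $n$ vertices in which each edge is present independently with probability $p$; $G_n\cup G(n,p)$ is the union of edge sets on the same vertex set. **Vertex-Ramsey.** $G$ is $(H_1,\ldots,H_r)_v$-Ramsey, written $G\to(H_1,\ldots,H_r)_v$, if for every colouring of $V(G)$ with colours $[r]=\{1,\ldots,r\}$ there is $j\in[r]$ such that $G$ contains a (not necessarily induced) copy of $H_j$ all of whose vertices have colour $j$. **Threshold.** For $d\in[0,1]$, a function $p:\mathbb{N}\to[0,1]$ is a perturbed vertex-Ramsey threshold function for $H_1,\ldots,H_r$ at density $d$ if: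 (i) there exist an infinite increasing sequence of positive integers $(n_m)_{m\in\mathbb{N}}$ and $n_m$-vertex graphs $G_{n_m}$, each of density at least $d$, such that whenever $q(n)=o(p(n))$ (with $q:\mathbb{N}\to[0,1]$), $\lim_{m\to\infty}\mathbb{P}[G_{n_m}\cup G(n_m,q(n_m))\to(H_1,\ldots,H_r)_v]=0$; and (ii) for every $q:\mathbb{N}\to[0,1]$ with $q(n)=\omega(p(n))$ and every sequence $(G_n)_{n\in\mathbb{N}}$ of $n$-vertex graphs each of density at least $d$, $\lim_{n\to\infty}\mathbb{P}[G_n\cup G(n,q(n))\to(H_1,\ldots,H_r)_v]=1$. The notation $p(n;H_1,\ldots,H_r,d)$ (or $p(n;\mathbf{H},d)$) stands for any such threshold function; if every graph on sufficiently many vertices of density at least $d$ is $(H_1,\ldots,H_r)_v$-Ramsey, one sets $p(n;\mathbf{H},d):=0$. **Densities.** For a graph $H$, $m_1(H):=\max\{e(J)/(v(J)-1): J\subseteq H,\ v(J)\geq 2\}$, with $m_1(H)=0$ if $v(H)\leq 1$. For graphs $A,B$ with $m_1(A)\geq m_1(B)$, $m_1(B,A):=\max\{(m_1(B)+e(J))/v(J): J\subseteq A,\ v(J)\geq 1\}$, with $m_1(B,A)=0$ if $v(A)=0$. For an $r$-tuple of graphs $(A_1,\ldots,A_r)$, let $\sigma$ be any permutation of $[r]$ with $m_1(A_{\sigma(1)})\geq m_1(A_{\sigma(2)})\geq\cdots\geq m_1(A_{\sigma(r)})$ and put $\beta(A_1,\ldots,A_r):=m_1(A_{\sigma(2)},A_{\sigma(1)})$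 (independent of the choice of $\sigma$). For an $r$-tuple of families of graphs, $\beta(\mathcal{A}_1,\ldots,\mathcal{A}_r):=\min\{\beta(A_1,\ldots,A_r): A_1\in\mathcal{A}_1,\ldots,A_r\in\mathcal{A}_r\}$. **Certificates.** For a graph $H$ and $k\geq 2$, $\mathrm{Part}(H,k)$ is the set of ordered $k$-tuples $(H_1',\ldots,H_k')$ of (possibly empty) graphs for which there is a partition $V(H)=V_1\sqcup\cdots\sqcup V_k$ (parts may be empty) with $H[V_i]=H_i'$ for all $i\in[k]$. A $k$-partite certificate of $H$-freeness is an ordered $k$-tuple $\mathcal{F}(H;k)=(\mathcal{F}_1,\ldots,\mathcal{F}_k)$ of collections of non-empty subgraphs of $H$ such that for every $(H_1',\ldots,H_k')\in\mathrm{Part}(H,k)$ there is some $i\in[k]$ with $H_i'\in\mathcal{F}_i$. Write $\mathcal{F}(H;k)_i:=\mathcal{F}_i$. (Each $\mathcal{F}_i$ then necessarily contains $H$ itself.) **Critical parameter.** For $\mathbf{H}=(H_1,\ldots,H_r)$ and $k\geq 2$, $$\beta(\mathbf{H};k):=\max_{\mathcal{F}(H_1;k),\ldots,\mathcal{F}(H_r;k)}\ \min_{i\in[k]}\ \beta\big(\mathcal{F}(H_1;k)_i,\ldots,\mathcal{F}(H_r;k)_i\big),$$ the maximum being over all $r$-tuples of $k$-partite certificates of $H_1$-, $\ldots$, $H_r$-freeness. *)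

(* Defs.v *)
From HB Require Import structures.
From mathcomp Require Import all_boot all_order all_algebra.
From mathcomp Require Import all_classical all_reals all_analysis.

Set Implicit Arguments.
Unset Strict Implicit.
Unset Printing Implicit Defensive.

Import Order.TTheory GRing.Theory Num.Theory.
Import numFieldNormedType.Exports.

Local Open Scope classical_set_scope.
Local Open Scope ring_scope.

Definition pairs (T : finType) (V : {set T}) : {set {set T}} :=
  [set e : {set T} | (e \subset V) && (#|e| == 2)]%SET.

(* A simple graph whose vertex set may be any subset of the finite type T, so
   that a graph and all of its subgraphs have the same Rocq type. *)
Record sgraph (T : finType) := SGraph {
  sgraph_val : {set T} * {set {set T}};
  _ : sgraph_val.2 \subset pairs sgraph_val.1 }.

HB.instance Definition _ (T : finType) := [isSub for @sgraph_val T].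
HB.instance Definition _ (T : finType) := [Finite of sgraph T by <:].

Definition vset (T : finType) (G : sgraph T) : {set T} := (sgraph_val G).1.
Definition eset (T : finType) (G : sgraph T) : {set {set T}} :=
  (sgraph_val G).2.

Definition v (T : finType) (G : sgraph T) : nat := #|vset G|.
Definition e (T : finType) (G : sgraph T) : nat := #|eset G|.

(* Meaningful for v G >= 2 only: it is 0 for v G <= 1, as x / 0 = 0. *)
Definition density (R : realType) (T : finType) (G : sgraph T) : R :=
  (e G)%:R / 'C(v G, 2)%:R.

Definition subgraph (T : finType) (J G : sgraph T) : bool :=
  (vset J \subset vset G) && (eset J \subset eset G).

Lemma pairsS (T : finType) (V W : {set T}) :
  V \subset W -> pairs V \subset pairs W.
Proof.
move=> sVW; apply/fintype.subsetP => x; rewrite !inE => /andP[sxV ->].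
by rewrite (fintype.subset_trans sxV sVW).
Qed.

Lemma eset_pairs (T : finType) (G : sgraph T) : eset G \subset pairs (vset G).
Proof. by case: G. Qed.

Lemma induced_sub_subproof (T : finType) (G : sgraph T) (W : {set T}) :
  eset G :&: pairs (vset G :&: W) \subset pairs (vset G :&: W).
Proof. exact: finset.subsetIr. Qed.

Definition induced_sub (T : finType) (G : sgraph T) (W : {set T}) : sgraph T :=
  @SGraph T (vset G :&: W, eset G :&: pairs (vset G :&: W))
    (induced_sub_subproof G W).

Lemma gunion_subproof (T : finType) (G K : sgraph T) :
  eset G :|: eset K \subset pairs (vset G :|: vset K).
Proof.
rewrite finset.subUset !(fintype.subset_trans (eset_pairs _)) //.
- exact/pairsS/finset.subsetUr.
- exact/pairsS/finset.subsetUl.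
Qed.

Definition gunion (T : finType) (G K : sgraph T) : sgraph T :=
  @SGraph T (vset G :|: vset K, eset G :|: eset K) (gunion_subproof G K).

(* f need only be meaningful on the vertices of H. *)
Definition is_copy (S T : finType) (H : sgraph S) (G : sgraph T)
    (f : S -> T) : bool :=
  [&& dinjectiveb f (mem (vset H)),
      (f @: vset H)%SET \subset vset G &
      [forall x in eset H, (f @: (x : {set S}))%SET \in eset G]].

Definition ramsey (r : nat) (S : 'I_r -> finType) (H : forall j, sgraph (S j))
    (T : finType) (G : sgraph T) : bool :=
  [forall c : {ffun T -> 'I_r}, [exists j : 'I_r,
    [exists f : {ffun S j -> T},
      is_copy (H j) G f && [forall x in vset (H j), c (f x) == j]]]].

(* P[G(n,q) satisfies A]. *)
Definition gnp_prob (R : realType) (n : nat) (q : R)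
    (A : sgraph 'I_n -> bool) : R :=
  \sum_(K : sgraph 'I_n | (vset K == [set: 'I_n]%SET) && A K)
    \prod_(x in pairs [set: 'I_n]%SET) (if x \in eset K then q else 1 - q).

Definition perturbed_prob (R : realType) (r : nat) (S : 'I_r -> finType)
    (H : forall j, sgraph (S j)) (n : nat) (G : sgraph 'I_n) (q : R) : R :=
  gnp_prob q (fun K => ramsey H (gunion G K)).

Definition prob_fun (R : realType) (p : nat -> R) : Prop :=
  forall n, 0 <= p n <= 1.

(* q = omega(p) is rendered as p = o(q).  In (ii) the density condition is
   imposed from n = 2 on, since the density of a graph on fewer than two
   vertices is undefined. *)
Definition is_threshold (R : realType) (r : nat) (S : 'I_r -> finType)
    (H : forall j, sgraph (S j)) (d : R) (p : nat -> R) : Prop :=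
  [/\ prob_fun p,
      exists (ns : nat -> nat) (G : forall m, sgraph 'I_(ns m)),
        [/\ forall m, (0 < ns m)%N,
            {homo ns : l m / (l < m)%N},
            forall m, vset (G m) = [set: 'I_(ns m)]%SET,
            forall m, d <= density R (G m) &
            forall q : nat -> R, prob_fun q -> q =o_\oo p ->
              perturbed_prob H (G m) (q (ns m)) @[m --> \oo] --> (0 : R)] &
      forall q : nat -> R, prob_fun q -> p =o_\oo q ->
        forall G : forall n, sgraph 'I_n,
          (forall n, vset (G n) = [set: 'I_n]%SET) ->
          (forall n, (2 <= n)%N -> d <= density R (G n)) ->
          perturbed_prob H (G n) (q n) @[n --> \oo] --> (1 : R)].

Definition m1 (R : realType) (T : finType) (G : sgraph T) : R :=
  \big[Num.max/0]_(J : sgraph T | subgraph J G && (2 <= v J)%N)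
    ((e J)%:R / ((v J)%:R - 1)).

(* The asymmetric density m_1(B, A). *)
Definition m1a (R : realType) (S T : finType) (B : sgraph S) (A : sgraph T) :
    R :=
  \big[Num.max/0]_(J : sgraph T | subgraph J A && (1 <= v J)%N)
    ((m1 R B + (e J)%:R) / (v J)%:R).

(* The indices are sorted so that m1 is non-increasing; the last branch is not
   reached when r >= 2. *)
Definition beta (R : realType) (r : nat) (S : 'I_r -> finType)
    (A : forall j, sgraph (S j)) : R :=
  match sort (fun i j => m1 R (A j) <= m1 R (A i)) (enum 'I_r) with
  | i1 :: i2 :: _ => m1a R (A i2) (A i1)
  | _ => 0
  end.

(* Below, inf and sup are minima and maxima: they range over finite sets, which
   are non-empty for r-tuples of certificates of non-empty graphs. *)
Definition beta_families (R : realType) (r : nat) (S : 'I_r -> finType)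
    (F : forall j, {set sgraph (S j)}) : R :=
  inf [set b | exists A : forall j, sgraph (S j),
    (forall j, A j \in F j) /\ b = beta R A]%classic.

Definition Part (T : finType) (H : sgraph T) (k : nat) :
    {set {ffun 'I_k -> sgraph T}} :=
  [set [ffun i => induced_sub H (V i)] |
    V : {ffun 'I_k -> {set T}} &
      (\bigcup_i V i == vset H) &&
      [forall i, forall j, (i != j) ==> [disjoint V i & V j]]]%SET.

Definition certificate (T : finType) (H : sgraph T) (k : nat)
    (F : 'I_k -> {set sgraph T}) : Prop :=
  (forall i A, A \in F i -> subgraph A H /\ (0 < v A)%N) /\
  (forall P, P \in Part H k -> exists i, P i \in F i).

Definition beta_crit (R : realType) (r : nat) (S : 'I_r -> finType)
    (H : forall j, sgraph (S j)) (k : nat) : R :=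
  sup [set b | exists F : forall j, 'I_k -> {set sgraph (S j)},
    (forall j, certificate (H j) (F j)) /\
    b = inf (range (fun i : 'I_k => beta_families R (fun j => F j i)))]%classic.

(* Main.v *)
(* The problem splits over [k] classes. If [Y_1, .., Y_k] are pairwise completely
   joined and a colouring has no monochromatic [H_j], then the subgraphs of the
   [H_j] without a copy of colour [j] in [Y_i] form certificates; hence in some
   [Y_i] a tuple [A] with [beta A <= beta_crit] is avoided.

   1-statement: a graph of density [d] has a positive proportion of the
   homomorphisms from any fixed complete [k]-partite graph (Moon-Moser). A first
   round of random edges puts on them copies of the densest member [A_{i1}] of
   every sparse tuple; by Chebyshev the joined systems of copies stay dense, and
   dependent random choice selects, one coordinate after the other, large
   families of disjoint copies almost all of whose tuples extend to such a
   system. A colouring avoiding [A] marks a vertex of a fixed colour [j <> i1] in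
   a positive proportion of the copies, and Janson's inequality in the second
   round makes a copy of [A_j] on the marked vertices so likely that a union
   bound over the markings applies.

   0-statement: take a balanced complete [k]-partite graph and colour class [i]
   with two colours only, dictated by an optimal certificate. Copies of sparse
   patterns need a vertex of the second colour, copies of dense patterns one of
   the first. If this fails, then there is a critical system of copies, in which
   every copy meets another one, of the other type, in each of its vertices
   alone; exploring the system copy by copy bounds its probability. *)

Require Import Defs.
From mathcomp Require Import all_boot all_order all_algebra.
From mathcomp Require Import all_classical all_reals all_analysis.
From mathcomp Require Import fintype finset ring lra zify.

Set Implicit Arguments.
Unset Strict Implicit.
Unset Printing Implicit Defensive.

Import Order.TTheory GRing.Theory Num.Theory.
Import numFieldNormedType.Exports.

Local Open Scope set_scope.
Local Open Scope ring_scope.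

(** * Random subsets *)

(** The exponent comes from one balance. Put [x = m1 R (A i2)]. The inequality e(J) + x <= b0 |J|,
    for the non-empty subgraphs J of [A i1], says that each J has at least q^(-x) expected copies
    when q is |V|^(-1/b0); the least such b0 is [m1a R (A i2) (A i1)]. So about q^(-x) disjoint
    copies are available. For the other members, e(J) <= x (|J| - 1) says that N marked vertices, N
    at least q^(-x), are expected to carry at least N copies of every J with an edge. Above the
    threshold the obstacle is that the Janson exponent is only proportional to the number |S| of
    disjoint copies, too little for all colourings of V but enough for (|U| + 1)^|S| markings. A
    copy found on marked vertices uses up to |U| members of [S] at once, and all of them must stay
    joined to the choices in the other coordinates: hence tuples of |U| copies. Below the threshold
    all powers of |V| cancel along regular extensions. Only a constant factor is gained, so the
    exploration must go on until these factors outweigh the number of starting copies. *)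

Lemma ler_bool (R : numDomainType) (b c : bool) : (b -> c) -> b%:R <= c%:R :> R.
Proof. by move=> bc; rewrite ler_nat; case: b bc => // ->. Qed.

Section RandomSubset.
Variables (R : realFieldType) (X : finType).
Implicit Types (q : R) (s : seq X) (f g : {set X} -> R).

Lemma sub0s s : set0 \subset s.
Proof. by apply/subsetP => z; rewrite inE. Qed.

Lemma sub_consU x s (E : {set X}) : E \subset s -> x |: E \subset x :: s.
Proof.
move=> Es; apply/subsetP => z; rewrite !inE.
by case/predU1P=> [->|/(subsetP Es)->]; rewrite ?eqxx ?orbT.
Qed.

Lemma sub_cons x s (E : {set X}) : E \subset s -> E \subset x :: s.
Proof. by move=> Es; apply/subsetP => z /(subsetP Es) zs; rewrite inE zs orbT. Qed.

Lemma subUs s (A B : {set X}) : A \subset s -> B \subset s -> A :|: B \subset s.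
Proof.
by move=> sA sB; apply/subsetP => z /setUP[/(subsetP sA)|/(subsetP sB)].
Qed.

Lemma sub1s s x : x \in s -> [set x] \subset s.
Proof. by move=> xs; apply/subsetP => z /set1P->. Qed.

(** The expectation of [f E] when each element of [s] enters [E] independently with probability [q].
    As a recursion on the coordinates it turns conditioning on one element into a computation step,
    and most facts into inductions on [s]. *)
Fixpoint Ex q s f : R :=
  if s is x :: s' then q * Ex q s' (fun E => f (x |: E)) + (1 - q) * Ex q s' f
  else f set0.

Lemma eq_ExS q s f g :
  (forall E : {set X}, E \subset s -> f E = g E) -> Ex q s f = Ex q s g.
Proof.
elim: s f g => [|x s IH] f g fg /=; first by rewrite fg ?sub0s.
congr (_ * _ + _ * _); apply: IH => E Es; apply: fg.
  exact: sub_consU.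
exact: sub_cons.
Qed.

Lemma eq_Ex q s f g : f =1 g -> Ex q s f = Ex q s g.
Proof. by move=> fg; apply: eq_ExS. Qed.

Lemma ler_ExS q s f g : 0 <= q <= 1 ->
  (forall E : {set X}, E \subset s -> f E <= g E) -> Ex q s f <= Ex q s g.
Proof.
move=> /andP[q0 q1]; elim: s f g => [|x s IH] f g fg /=; first by rewrite fg ?sub0s.
apply: lerD; apply: ler_wpM2l; rewrite ?subr_ge0 //; apply: IH => E Es; apply: fg.
  exact: sub_consU.
exact: sub_cons.
Qed.

Lemma ler_Ex q s f g : 0 <= q <= 1 -> (forall E, f E <= g E) ->
  Ex q s f <= Ex q s g.
Proof. by move=> q01 fg; apply: ler_ExS. Qed.

Lemma ExD q s f g : Ex q s (fun E => f E + g E) = Ex q s f + Ex q s g.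
Proof. by elim: s f g => //= x s IH f g; rewrite !IH; ring. Qed.

Lemma ExZ q s a f : Ex q s (fun E => a * f E) = a * Ex q s f.
Proof. by elim: s f => //= x s IH f; rewrite !IH; ring. Qed.

Lemma Ex_cst q s a : Ex q s (fun=> a) = a.
Proof. by elim: s => //= x s ->; ring. Qed.

Lemma ExB q s f g : Ex q s (fun E => f E - g E) = Ex q s f - Ex q s g.
Proof. by elim: s f g => //= x s IH f g; rewrite !IH; ring. Qed.

Lemma Ex_sum q s (I : Type) (r : seq I) (P : pred I) (F : I -> {set X} -> R) :
  Ex q s (fun E => \sum_(i <- r | P i) F i E) = \sum_(i <- r | P i) Ex q s (F i).
Proof.
elim: r => [|i r IH].
  rewrite big_nil -[RHS](Ex_cst q s 0); apply: eq_Ex => E; exact: big_nil.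
rewrite big_cons; case: ifP => Pi; rewrite -IH -?ExD; apply: eq_Ex => E;
  by rewrite big_cons Pi.
Qed.

Lemma Ex_ge0 q s f : 0 <= q <= 1 -> (forall E, 0 <= f E) -> 0 <= Ex q s f.
Proof. by move=> q01 f0; rewrite -(Ex_cst q s 0); apply: ler_Ex. Qed.

(** First-moment method, by conditional expectations: at each coordinate the better of the two
    branches is kept. *)
Lemma Ex_exists q s f : 0 <= q <= 1 ->
  exists2 E : {set X}, E \subset s & Ex q s f <= f E.
Proof.
move=> /andP[q0 q1]; elim: s f => [|x s IH] f /=; first by exists set0; rewrite ?sub0s.
have [E1 E1s H1] := IH (fun E => f (x |: E)); have [E2 E2s H2] := IH f.
case: (lerP (f E2) (f (x |: E1))) => H.
  exists (x |: E1).
    exact: sub_consU.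
  by move: H1 H2 H q0 q1; nra.
exists E2; first exact: sub_cons.
by move: H1 H2 H q0 q1; nra.
Qed.

(** The coordinates outside [E0] stay independent, so the law conditioned on [E0 \subset E] is that
    of [E0 :|: E]. The factor [g] is what the proof of Janson's inequality conditions. *)
Lemma Ex_sub q s (E0 : {set X}) g : uniq s -> E0 \subset s ->
  Ex q s (fun E => (E0 \subset E)%:R * g E) =
  q ^+ #|E0| * Ex q s (fun E => g (E0 :|: E)).
Proof.
elim: s E0 g => [|x s IH] E0 g /=.
  move=> _ E0s; have -> : E0 = set0.
    by apply/eqP; rewrite -subset0; apply/subsetP => z /(subsetP E0s).
  by rewrite sub0set cards0 mul1r setU0 mul1r.
case/andP=> xs us E0s.
case xE0: (x \in E0); last first.
  have sE0 : E0 \subset s.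
    apply/subsetP => z zE0; move: (subsetP E0s z zE0); rewrite inE.
    by case/predU1P=> // zx; rewrite -zx zE0 in xE0.
  rewrite IH //.
  have -> : Ex q s (fun E => (E0 \subset x |: E)%:R * g (x |: E)) =
            q ^+ #|E0| * Ex q s (fun E => g (E0 :|: (x |: E))).
    transitivity (q ^+ #|E0| * Ex q s (fun E => (fun E => g (x |: E)) (E0 :|: E))).
      rewrite -(IH _ (fun E => g (x |: E))) //.
      apply: eq_Ex => E; congr ((nat_of_bool _)%:R * _).
      apply/idP/idP => [H|H]; last exact: (subset_trans H (subsetUr _ _)).
      apply/subsetP => z zE0; move: (subsetP H z zE0); rewrite !inE.
      by case/predU1P=> // zx; rewrite -zx zE0 in xE0.
    by congr (_ * _); apply: eq_Ex => E; rewrite setUCA.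
  by ring.
have sE0 : E0 :\ x \subset s.
  apply/subsetP => z; rewrite !inE => /andP[zx zE0].
  by move: (subsetP E0s z zE0); rewrite inE (negPf zx).
have -> : Ex q s (fun E => (E0 \subset E)%:R * g E) = 0.
  rewrite -(Ex_cst q s 0); apply: eq_ExS => E Es.
  case: (boolP (E0 \subset E)) => [H|]; last by rewrite mul0r.
  by move: xs; rewrite (subsetP Es) // (subsetP H).
have -> : Ex q s (fun E => (E0 \subset x |: E)%:R * g (x |: E)) =
   q ^+ #|E0 :\ x| * Ex q s (fun E => g (E0 :|: E)).
  have -> : Ex q s (fun E => g (E0 :|: E)) =
            Ex q s (fun E => (fun E => g (x |: E)) (E0 :\ x :|: E)).
    by apply: eq_Ex => E /=; rewrite setUA setD1K.
  rewrite -(IH _ (fun E => g (x |: E))) //; apply: eq_Ex => E; congr ((nat_of_bool _)%:R * _).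
  by rewrite subDset.
have -> : Ex q s (fun E => g (E0 :|: (x |: E))) = Ex q s (fun E => g (E0 :|: E)).
  have xE0' : x |: E0 = E0 by apply/setUidPr; rewrite sub1set.
  by apply: eq_Ex => E; rewrite setUA (setUC E0) xE0'.
by rewrite (cardsD1 x E0) xE0 add1n exprS; ring.
Qed.

Lemma Ex_subE q s (E0 : {set X}) : uniq s -> E0 \subset s ->
  Ex q s (fun E => (E0 \subset E)%:R) = q ^+ #|E0|.
Proof.
move=> us sE0; rewrite -[RHS]mulr1 -[X in _ * X](Ex_cst q s 1).
rewrite -(@Ex_sub _ _ _ (fun=> 1)) //.
by apply: eq_Ex => E; rewrite mulr1.
Qed.

(** An element is missed by two independent samples with probability [(1 - q1) * (1 - q2)]. *)
Lemma Ex_union q1 q2 s f :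
  Ex q1 s (fun E1 => Ex q2 s (fun E2 => f (E1 :|: E2))) =
  Ex (q1 + q2 - q1 * q2) s f.
Proof.
elim: s f => [|x s IH] f /=; first by rewrite setUid.
rewrite !ExD !ExZ -!IH.
have e1 : Ex q1 s (fun E1 => Ex q2 s (fun E2 => f (x |: E1 :|: (x |: E2)))) =
          Ex q1 s (fun E1 => Ex q2 s (fun E2 => f (x |: (E1 :|: E2)))).
  by apply: eq_Ex => E1; apply: eq_Ex => E2; rewrite [in RHS]setUUr.
have e2 : Ex q1 s (fun E1 => Ex q2 s (fun E2 => f (x |: E1 :|: E2))) =
          Ex q1 s (fun E1 => Ex q2 s (fun E2 => f (x |: (E1 :|: E2)))).
  by apply: eq_Ex => E1; apply: eq_Ex => E2; rewrite setUA.
have e3 : Ex q1 s (fun E1 => Ex q2 s (fun E2 => f (E1 :|: (x |: E2)))) =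
          Ex q1 s (fun E1 => Ex q2 s (fun E2 => f (x |: (E1 :|: E2)))).
  by apply: eq_Ex => E1; apply: eq_Ex => E2; rewrite setUCA.
by rewrite e1 e2 e3; ring.
Qed.

Definition incr f := forall E E' : {set X}, E \subset E' -> f E <= f E'.

Lemma Ex_monoq q q' s f : 0 <= q' -> q' <= q -> q <= 1 -> incr f ->
  Ex q' s f <= Ex q s f.
Proof.
move=> q0 qq q1; elim: s f => [|x s IH] f inf //=.
have H1 := IH _ inf.
have {}IH := IH (fun E => f (x |: E)) (fun E E' h => inf _ _ (setUS _ h)).
have H2 : Ex q' s f <= Ex q' s (fun E => f (x |: E)).
  by apply: ler_Ex => [|E]; [rewrite q0 (le_trans qq)|apply: inf (subsetUr _ _)].
have H3 : Ex q s f <= Ex q s (fun E => f (x |: E)).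
  by apply: ler_Ex => [|E]; [rewrite q1 (le_trans q0)|apply: inf (subsetUr _ _)].
move: H1 IH H2 H3; move: (Ex _ _ _) (Ex _ _ _) (Ex _ _ _) (Ex _ _ _) => a b c d.
by move=> h1 h2 h3 h4; nra.
Qed.

Lemma Ex_two_rounds q1 q2 q s f : 0 <= q1 -> 0 <= q2 -> q1 + q2 <= q -> q <= 1 ->
  incr f ->
  Ex q1 s (fun E1 => Ex q2 s (fun E2 => f (E1 :|: E2))) <= Ex q s f.
Proof.
by move=> ? ? ? ? inf; rewrite Ex_union; apply: Ex_monoq => //; nra.
Qed.

(** The bridge to the explicit product weights in [gnp_prob]. *)
Lemma Ex_sumE q s f : uniq s ->
  Ex q s f = \sum_(E : {set X} | E \subset s)
    (\prod_(x <- s) (if x \in E then q else 1 - q)) * f E.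
Proof.
elim: s f => [|x s IH] f /=.
  move=> _; rewrite (big_pred1 set0) ?big_nil ?mul1r // => E /=.
  apply/idP/eqP => [h|->]; last exact: sub0s.
  by apply/eqP; rewrite -subset0; apply/subsetP => z /(subsetP h).
case/andP=> xs us; rewrite (bigID (fun E : {set X} => x \in E)) /=; congr (_ + _).
  rewrite (IH _ us) big_distrr /=.
  rewrite [RHS](reindex_onto (fun E => x |: E) (fun E => E :\ x)) /=; last first.
    by move=> E /andP[_ xE]; rewrite setD1K.
  apply: eq_big => [E|E Es].
    apply/idP/andP => [Es|[/andP[h _] /eqP <-]].
      rewrite sub_consU // setU11; split=> //; apply/eqP/setP => z.
      rewrite !inE; case: eqVneq => //= ->.
      by apply/esym/negbTE; apply: contra xs => /(subsetP Es).
    apply/subsetP => z; rewrite in_setD1 => /andP[zx zE].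
    by move: (subsetP h z zE); rewrite inE (negPf zx).
  rewrite big_cons setU11 -!mulrA; congr (_ * (_ * _)).
  rewrite !big_seq; apply: eq_bigr => z zs; rewrite !inE.
  by case: eqVneq => // zx; rewrite -zx zs in xs.
rewrite (IH _ us) big_distrr /=; apply: eq_big => [E|E Es].
  apply/idP/andP => [Es|[h xE]].
    by split; [apply: sub_cons|apply: contra xs => /(subsetP Es)].
  apply/subsetP => z zE; move: (subsetP h z zE); rewrite inE.
  by case/predU1P => // zx; rewrite -zx zE in xE.
rewrite big_cons ifN ?mulrA //.
by apply: contra xs => /(subsetP Es).
Qed.

Lemma Ex_markov q s f (a : R) : 0 <= q <= 1 -> 0 < a -> (forall E, 0 <= f E) ->
  Ex q s (fun E => (a <= f E)%R%:R) <= Ex q s f / a.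
Proof.
move=> q01 a0 f0; rewrite mulrC -ExZ; apply: ler_Ex => // E.
case: (lerP a (f E)) => h; last by rewrite mulr_ge0 ?invr_ge0 // ltW.
by rewrite mulrC ler_pdivlMr // mul1r.
Qed.

(** * The second moment method *)

Section SecondMoment.
Variables (I : finType) (A : {set I}) (e : I -> {set X}) (s : seq X).

Definition cnt (E : {set X}) : R := \sum_(i in A) (e i \subset E)%:R.
Definition mean q : R := \sum_(i in A) q ^+ #|e i|.
(** Janson's Delta with the diagonal pairs included. It bounds both the variance of [cnt] and the
    exponent in Janson's inequality. *)
Definition overlap q : R :=
  \sum_(i in A) \sum_(j in A | ~~ [disjoint e i & e j]) q ^+ #|e i :|: e j|.

Hypothesis us : uniq s.
Hypothesis es : forall i, i \in A -> e i \subset s.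

Lemma Ex_pair q i j : i \in A -> j \in A ->
  Ex q s (fun E => (e i \subset E)%:R * (e j \subset E)%:R) = q ^+ #|e i :|: e j|.
Proof.
move=> iA jA; rewrite -(@Ex_subE _ s) //; last by apply: subUs; exact: es.
by apply: eq_Ex => E; rewrite subUset -natrM mulnb.
Qed.

Lemma Ex_cnt q : Ex q s cnt = mean q.
Proof. by rewrite Ex_sum; apply: eq_bigr => i iA; rewrite Ex_subE ?es. Qed.

(** Disjoint sets are independent, so their pairs cancel in the variance; what is left is at most
    [overlap q]. *)
Lemma chebyshev_half q : 0 <= q <= 1 -> 0 < mean q ->
  Ex q s (fun E => (cnt E < mean q / 2)%R%:R) <= 4 * overlap q / mean q ^+ 2.
Proof.
move=> q01 m0; set m := mean q in m0 *.
have H : Ex q s (fun E => (cnt E - m) ^+ 2) <= overlap q.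
  have -> : Ex q s (fun E => (cnt E - m) ^+ 2) =
      Ex q s (fun E => cnt E ^+ 2) - m ^+ 2.
    rewrite (@eq_Ex _ _ _ (fun E => (cnt E ^+ 2 - (2 * m) * cnt E) + m ^+ 2)); last first.
      by move=> E; ring.
    by rewrite ExD ExB ExZ Ex_cst Ex_cnt -/m; ring.
  have -> : Ex q s (fun E => cnt E ^+ 2) =
      \sum_(i in A) \sum_(j in A) q ^+ #|e i :|: e j|.
    rewrite (@eq_Ex _ _ _ (fun E => \sum_(i in A) \sum_(j in A)
       (e i \subset E)%:R * (e j \subset E)%:R)); last first.
      move=> E; rewrite expr2 /cnt big_distrl /=; apply: eq_bigr => i _.
      by rewrite big_distrr.
    rewrite Ex_sum; apply: eq_bigr => i iA; rewrite Ex_sum.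
    by apply: eq_bigr => j jA; rewrite Ex_pair.
  rewrite expr2 {1}/m /mean big_distrl -sumrB; apply: ler_sum => i iA /=.
  rewrite /m /mean big_distrr -sumrB /= [X in _ <= X]big_mkcondr /=.
  apply: ler_sum => j jA; case: ifPn => [_|].
    by rewrite gerBl mulr_ge0 // exprn_ge0 //; case/andP: q01.
  rewrite negbK => dij; rewrite cardsU disjoint_setI0 // cards0 subn0 exprD.
  by rewrite subrr.
have -> : 4 * overlap q / m ^+ 2 = 4 / m ^+ 2 * overlap q by ring.
apply: (@le_trans _ _ (4 / m ^+ 2 * Ex q s (fun E => (cnt E - m) ^+ 2))); last first.
  by apply: ler_wpM2l => //; rewrite divr_ge0 ?sqr_ge0.
rewrite -ExZ; apply: ler_Ex => // E; case: ltP => h; last first.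
  by rewrite mulr_ge0 ?sqr_ge0 // divr_ge0 ?sqr_ge0.
rewrite mulrAC ler_pdivlMr ?exprn_gt0 // mul1r; move: h; rewrite ltr_pdivlMr //.
by move: (cnt E) => z; nra.
Qed.

End SecondMoment.

End RandomSubset.

(** * Random subfamilies *)

Section Sampling.
Variables (R : realFieldType) (I : finType).

(** In a random subset of density [t] the linear sum shrinks by [t], the sum over pairs by [t ^+ 2].
    This trade is used in Janson's inequality and again to thin families of copies. *)
Lemma sample_subset (A : {set I}) (a : I -> R) (b : I -> I -> R) (t : R) :
  0 <= t <= 1 ->
  exists2 T : {set I}, T \subset A &
  t * (\sum_(i in A) a i) - t ^+ 2 * (\sum_(i in A) \sum_(j in A | j != i) b i j)
  <= \sum_(i in T) a i - \sum_(i in T) \sum_(j in T | j != i) b i j.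
Proof.
move=> t01; pose f := fun T : {set I} =>
  \sum_(i in A) a i * ([set i] \subset T)%:R -
  \sum_(i in A) \sum_(j in A | j != i) b i j * ([set i; j] \subset T)%:R.
have [T TA HT] := @Ex_exists R I t (enum A) f t01.
have uA := enum_uniq A.
have sA (i : I) : i \in A -> [set i] \subset enum A.
  by move=> iA; apply: sub1s; rewrite mem_enum.
exists T; first by apply/subsetP => i /(subsetP TA); rewrite mem_enum.
have <- : f T = \sum_(i in T) a i - \sum_(i in T) \sum_(j in T | j != i) b i j.
  have TA' i : i \in T -> i \in A by move/(subsetP TA); rewrite mem_enum.
  rewrite /f; congr (_ - _).
    rewrite [RHS]big_mkcond [LHS]big_mkcond; apply: eq_bigr => i _.
    rewrite sub1set; case: ifP => iA; case: ifP => iT; rewrite ?mulr1 ?mulr0 //.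
    by rewrite TA' in iA.
  rewrite [RHS]big_mkcond [LHS]big_mkcond; apply: eq_bigr => i _.
  case: ifP => iA; case: ifP => iT //; last 2 first.
  - by apply: big1 => j _; rewrite subUset sub1set iT mulr0.
  - by rewrite TA' in iA.
  rewrite [RHS]big_mkcond [LHS]big_mkcond; apply: eq_bigr => j _.
  rewrite subUset !sub1set iT /=.
  case: (j != i); rewrite ?andbF // ?andbT.
  case: ifP => jA; case: ifP => jT; rewrite ?mulr1 ?mulr0 //.
  by rewrite TA' in jA.
apply: le_trans HT; rewrite /f ExB !Ex_sum.
have -> : \sum_(i in A) Ex t (enum A) (fun E => a i * ([set i] \subset E)%:R) =
          t * \sum_(i in A) a i.
  rewrite big_distrr /=; apply: eq_bigr => i iA.
  by rewrite ExZ Ex_subE ?sA // cards1 expr1 mulrC.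
rewrite lerB // big_distrr /=; apply: ler_sum => i iA.
rewrite Ex_sum big_distrr /=; apply: ler_sum => j /andP[jA ji].
have sij : [set i; j] \subset enum A by apply: subUs; exact: sA.
have -> : Ex t (enum A) (fun T => b i j * ([set i; j] \subset T)%:R) =
          b i j * Ex t (enum A) (fun T => ([set i; j] \subset T)%:R) by exact: ExZ.
by rewrite Ex_subE // cards2 eq_sym ji mulrC.
Qed.

End Sampling.

(** * The binomial random graph and the Janson inequality *)

Lemma graph_of_subproof (V : finType) (E : {set {set V}}) :
  E :&: pairs [set: V] \subset pairs [set: V].
Proof. exact: subsetIr. Qed.

Definition graph_of (V : finType) (E : {set {set V}}) : sgraph V :=
  @SGraph V ([set: V], E :&: pairs [set: V]) (graph_of_subproof E).

Lemma gnp_probE (R : realType) n (q : R) (A : sgraph 'I_n -> bool) :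
  gnp_prob q A =
  Ex q (enum (pairs [set: 'I_n])) (fun E => (A (graph_of E))%:R).
Proof.
rewrite Ex_sumE ?enum_uniq // /gnp_prob.
rewrite (eq_bigr (fun E : {set {set 'I_n}} => (if A (graph_of E) then
  \prod_(x in pairs [set: 'I_n]) (if x \in E then q else 1 - q) else 0))); last first.
  move=> E Es; rewrite big_enum /=.
  by case: ifP; rewrite ?mulr1 ?mulr0.
rewrite -big_mkcondr /=.
rewrite (reindex_onto (fun E => graph_of E) (fun K => eset K)) /=; last first.
  move=> K /andP[/eqP vK _]; apply: val_inj => /=; rewrite -vK (setIidPl (eset_pairs K)).
  by rewrite /vset /eset; case: (sgraph_val K).
apply: eq_big => [E|E /andP[_ /eqP hE]]; last by rewrite hE.
rewrite /eset /vset /= eqxx /= andbC; congr (_ && _).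
apply/eqP/subsetP => [<- z|h].
  by rewrite mem_enum => /setIP[].
by apply/setIidPl/subsetP => z /h; rewrite mem_enum.
Qed.

Section Janson.
Variables (R : realType) (X I : finType) (e : I -> {set X}) (s : seq X).
Hypothesis us : uniq s.

Definition missed (L : seq I) (E : {set X}) : bool :=
  all (fun i => ~~ (e i \subset E)) L.

(** Each summand is a lower bound for the probability of [e i], given that the later members are
    missed. A meeting pair is counted once, at its earlier member. *)
Fixpoint janson_weight (q : R) (L : seq I) : R :=
  if L is i :: L' then
    q ^+ #|e i| - \sum_(j <- L' | ~~ [disjoint e i & e j]) q ^+ #|e i :|: e j|
    + janson_weight q L'
  else 0.

(* Conditioning on [e i \subset E] only adds the coordinates in [e i], which do
   not matter for the events disjoint from [i] and only hurt the other misses. *)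
Lemma janson_list (q : R) (L : seq I) : 0 <= q <= 1 ->
  (forall i, i \in L -> e i \subset s) ->
  Ex q s (fun E => (missed L E)%:R) <= expR (- janson_weight q L).
Proof.
move=> q01; elim: L => [|i L IH] es /=; first by rewrite Ex_cst oppr0 expR0.
have esi : e i \subset s by apply: es; rewrite inE eqxx.
have esL j : j \in L -> e j \subset s by move=> jL; apply: es; rewrite inE jL orbT.
have {}IH := IH esL.
set S := \sum_(j <- L | _) _; set a := q ^+ _ - S.
set P := Ex q s (fun E => (missed L E)%:R) in IH *.
have P0 : 0 <= P by apply: Ex_ge0.
have key : a * P <= Ex q s (fun E => ((e i \subset E) && missed L E)%:R).
  case: (leP a 0) => [a0|a0].
    apply: (@le_trans _ _ 0); first by rewrite mulr_le0_ge0.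
    by apply: Ex_ge0.
  (* [e i] is independent of the members in [Ld]; those in [Lc] are subtracted by a union bound,
     which produces [S]. *)
  pose Ld := [seq j <- L | [disjoint e i & e j]].
  pose Lc := [seq j <- L | ~~ [disjoint e i & e j]].
  have missE E : missed L E = missed Ld E && missed Lc E.
    rewrite /missed !all_filter -all_predI; apply: eq_all => j /=.
    by case: [disjoint _ & _]; rewrite //= andbT.
  have Pd : P <= Ex q s (fun E => (missed Ld E)%:R).
    by apply: ler_Ex => // E; rewrite missE ler_nat; case: missed => //; case: missed.
  apply: (@le_trans _ _ (a * Ex q s (fun E => (missed Ld E)%:R))).
    by rewrite ler_pM2l.
  have mono (A E : {set X}) : (missed Ld (A :|: E))%:R <= (missed Ld E)%:R :> R.
    apply: ler_bool => /allP h; apply/allP => j /h; apply: contra => jE.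
    by apply: subset_trans jE (subsetUr _ _).
  apply: (@le_trans _ _ (Ex q s (fun E => (e i \subset E)%:R * (missed Ld E)%:R -
     \sum_(j <- Lc) ((e i :|: e j) \subset E)%:R * (missed Ld E)%:R))); last first.
    apply: ler_Ex => // E; rewrite missE.
    case: (boolP (e i \subset E)) => [iE|iE]; last first.
      rewrite mul0r sub0r oppr_le0; apply: sumr_ge0 => j _; exact: mulr_ge0.
    case: (missed Ld E) => /=; last first.
      by rewrite mulr0 sub0r oppr_le0; apply: sumr_ge0 => j _; exact: mulr_ge0.
    rewrite mul1r; case: (boolP (missed Lc E)) => [_|].
      by rewrite gerBl; apply: sumr_ge0 => j _; exact: mulr_ge0.
    rewrite /missed -has_predC => /hasP[j jL /=]; rewrite negbK => jE.
    rewrite subr_le0 (big_rem j) //= subUset iE jE mul1r lerDl.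
    by apply: sumr_ge0 => k _; exact: mulr_ge0.
  rewrite ExB Ex_sub // Ex_sum mulrBl; apply: lerB.
    apply: ler_wpM2l; first by rewrite exprn_ge0 //; case/andP: q01.
    apply: ler_Ex => // E; apply: ler_bool => /allP h; apply/allP => j jLd; have := h j jLd; apply: contra => jE.
    move: jLd; rewrite mem_filter => /andP[dij _].
    apply/subsetP => z zj; move: (subsetP jE z zj); rewrite inE.
    by case/orP=> // zi; rewrite (disjointFr dij zi) in zj.
  rewrite /S big_filter big_distrl /= [X in X <= _]big_seq_cond [X in _ <= X]big_seq_cond.
  apply: ler_sum => j /andP[jL _].
  rewrite Ex_sub //; last by apply: subUs => //; exact: esL.
  apply: ler_wpM2l; first by rewrite exprn_ge0 //; case/andP: q01.
  by apply: ler_Ex.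
have -> : Ex q s (fun E => (~~ (e i \subset E) && missed L E)%:R) =
          P - Ex q s (fun E => ((e i \subset E) && missed L E)%:R).
  by rewrite -ExB; apply: eq_Ex => E; case: (e i \subset E); case: missed;
     rewrite /= ?subr0 ?subrr.
apply: (@le_trans _ _ ((1 - a) * P)); first by rewrite mulrBl mul1r lerB.
rewrite (opprD a) expRD.
apply: (@le_trans _ _ (expR (- a) * P)); last by rewrite ler_pM2l ?expR_gt0.
by apply: ler_wpM2r => //; rewrite (le_trans _ (expR_ge1Dx _)).
Qed.

Lemma janson_weight_ge (q : R) (L : seq I) : 0 <= q -> uniq L ->
  \sum_(i <- L) q ^+ #|e i| -
  \sum_(i <- L) \sum_(j <- L | (j != i) && ~~ [disjoint e i & e j]) q ^+ #|e i :|: e j|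
  <= janson_weight q L.
Proof.
move=> q0; elim: L => [|i L IH] /=; first by rewrite !big_nil subr0.
case/andP=> iL uL; rewrite !big_cons eqxx /=.
have {}IH := IH uL.
have h1 : \sum_(j <- L | (j != i) && ~~ [disjoint e i & e j]) q ^+ #|e i :|: e j| =
          \sum_(j <- L | ~~ [disjoint e i & e j]) q ^+ #|e i :|: e j|.
  rewrite big_seq_cond [RHS]big_seq_cond; apply: eq_bigl => j.
  case: (boolP (j \in L)) => //= jL; case: eqVneq => // ji.
  by rewrite -ji jL in iL.
have h2 : \sum_(i0 <- L) \sum_(j <- L | (j != i0) && ~~ [disjoint e i0 & e j])
      q ^+ #|e i0 :|: e j| <=
    \sum_(j <- L) \sum_(j0 <- i :: L | (j0 != j) && ~~ [disjoint e j & e j0])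
      q ^+ #|e j :|: e j0|.
  apply: ler_sum => j _; rewrite big_cons; case: ifP => // _.
  by rewrite lerDr exprn_ge0.
rewrite h1; move: h2 IH; lra.
Qed.

Variable A : {set I}.
Hypothesis es : forall i, i \in A -> e i \subset s.

(** The linear bound is applied to a subfamily of density [t], for which the exponent can be made at
    least [t * m - t ^+ 2 * D]; the choice [t = m / (2 * D)] maximises this. As no [e i] is empty,
    [D] contains the diagonal pairs, so [m <= D] and [t] is a probability. *)
Lemma janson (q : R) : 0 <= q <= 1 -> (forall i, i \in A -> e i != set0) ->
  0 < overlap A e q ->
  Ex q s (fun E => [forall i in A, ~~ (e i \subset E)]%:R) <=
  expR (- (mean A e q ^+ 2 / (4 * overlap A e q))).
Proof.
move=> q01 e0 D0; have q0 : 0 <= q by case/andP: q01.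
set m := mean A e q; set D := overlap A e q in D0 *.
have m0 : 0 <= m by apply: sumr_ge0 => i _; rewrite exprn_ge0.
have mD : m <= D.
  apply: ler_sum => i iA; rewrite (bigD1 i) /=; last first.
    by rewrite iA -setI_eq0 setIid e0.
  by rewrite setUid lerDl; apply: sumr_ge0 => j _; rewrite exprn_ge0.
pose t := m / (2 * D).
have t01 : 0 <= t <= 1.
  rewrite divr_ge0 ?mulr_ge0 ?(ltW D0) //= ler_pdivrMr ?mulr_gt0 //; lra.
have [T TA HT] := sample_subset A (fun i => q ^+ #|e i|)
  (fun i j => if ~~ [disjoint e i & e j] then q ^+ #|e i :|: e j| else 0) t01.
have H : Ex q s (fun E => [forall i in A, ~~ (e i \subset E)]%:R) <=
         Ex q s (fun E => (missed (enum T) E)%:R).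
  apply: ler_Ex => // E; apply: ler_bool.
  move=> /'forall_implyP h; apply/allP => i; rewrite mem_enum => iT.
  by apply: h; exact: (subsetP TA).
apply: (le_trans H); apply: (@le_trans _ _ (expR (- janson_weight q (enum T)))).
  by apply: janson_list => // i; rewrite mem_enum => /(subsetP TA); exact: es.
rewrite ler_expR lerN2; apply: (le_trans _ (janson_weight_ge q0 (enum_uniq _))).
set w := (X in _ <= X).
have -> : w = \sum_(i in T) q ^+ #|e i| - \sum_(i in T) \sum_(j in T | j != i)
    (if ~~ [disjoint e i & e j] then q ^+ #|e i :|: e j| else 0).
  rewrite /w big_enum /=; congr (_ - _).
  rewrite big_enum /=; apply: eq_bigr => i _.
  rewrite -big_mkcondr big_enum_cond; apply: eq_bigl => j.
  by rewrite andbA.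
apply: le_trans HT; rewrite -/m.
set B := \sum_(i in A) \sum_(j in A | _) _.
have BD : B <= D.
  apply: ler_sum => i iA; rewrite -big_mkcondr /= big_mkcond [X in _ <= X]big_mkcond.
  apply: ler_sum => j _; case: (j \in A) => //=; case: (j != i) => //=.
  by case: ifP => // _; rewrite exprn_ge0.
apply: (@le_trans _ _ (t * m - t ^+ 2 * D)); last first.
  by rewrite lerB // ler_wpM2l ?sqr_ge0.
rewrite /t le_eqVlt; apply/orP; left; apply/eqP; field.
by rewrite gt_eqF.
Qed.

End Janson.

(** * Copies of patterns *)

Section Copies.
Variables U V : finType.
Implicit Types (P : sgraph U) (g h : {ffun U -> V}).

Definition edges_in P (J : {set U}) : nat := #|eset P :&: pairs J|.

Definition copyE P (g : U -> V) : {set {set V}} :=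
  [set g @: (x : {set U}) | x in eset P].

Lemma edge_sub P x : x \in eset P -> x \subset vset P /\ #|x| = 2%N.
Proof. by move=> /(subsetP (eset_pairs P)); rewrite inE => /andP[? /eqP]. Qed.

Lemma edges_in_vset P : edges_in P (vset P) = e P.
Proof. by rewrite /edges_in (setIidPl (eset_pairs P)). Qed.

Lemma edges_in_le P J : (edges_in P J <= e P)%N.
Proof. by rewrite subset_leq_card // subsetIl. Qed.

Lemma edges_in0 P (J : {set U}) : (#|J| < 2)%N -> edges_in P J = 0%N.
Proof.
move=> J2; apply/eqP; rewrite cards_eq0 -subset0; apply/subsetP => x.
rewrite !inE => /andP[_ /andP[/subset_leq_card xJ /eqP x2]].
by rewrite x2 leqNgt J2 in xJ.
Qed.

Lemma imset_inj_in (D : {set U}) (g : U -> V) (x y : {set U}) :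
  {in D &, injective g} -> x \subset D -> y \subset D -> g @: x = g @: y -> x = y.
Proof.
move=> gi xD yD; wlog suff H : x y xD yD / g @: x = g @: y -> x \subset y.
  by move=> E; apply/eqP; rewrite eqEsubset (H x y) ?(H y x).
move=> E; apply/subsetP => u ux.
have : g u \in g @: y by rewrite -E imset_f.
case/imsetP => w wy guw; rewrite (gi u w) //; [exact: (subsetP xD)|exact: (subsetP yD)].
Qed.

Lemma card_copyE P (g : U -> V) : {in vset P &, injective g} -> #|copyE P g| = e P.
Proof.
move=> gi; rewrite card_in_imset // => x y /edge_sub[xP _] /edge_sub[yP _].
exact: imset_inj_in gi xP yP.
Qed.

Lemma copyE_pairs P (g : U -> V) (Y : {set V}) : {in vset P &, injective g} ->
  g @: vset P \subset Y -> copyE P g \subset pairs Y.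
Proof.
move=> gi gY; apply/subsetP => f /imsetP[x /edge_sub[xP x2] ->].
rewrite inE (subset_trans (imsetS _ xP) gY) card_in_imset ?x2 //.
by move=> a b /(subsetP xP) aP /(subsetP xP) bP; exact: gi.
Qed.

Lemma card_copyE_meet P (g : U -> V) (F : {set {set V}}) (J : {set U}) :
  {in vset P &, injective g} ->
  (forall x, x \in eset P -> g @: x \in F -> x \subset J) ->
  (#|copyE P g :&: F| <= edges_in P J)%N.
Proof.
move=> gi H; apply: (@leq_trans #|[set g @: (x : {set U}) | x in eset P :&: pairs J]|).
  apply/subset_leq_card/subsetP => f; rewrite inE => /andP[/imsetP[x xP ->] fF].
  by apply: imset_f; rewrite !inE xP (H _ xP fF); have [_ ->] := edge_sub xP.
exact: leq_imset_card.
Qed.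

(** Edges of the pattern that leave [J] are new. In the weights below each of them costs a factor
    [q]. *)
Lemma card_copyE_union P (g : U -> V) (F : {set {set V}}) (J : {set U}) :
  {in vset P &, injective g} ->
  (forall x, x \in eset P -> g @: x \in F -> x \subset J) ->
  (#|F| + (e P - edges_in P J) <= #|F :|: copyE P g|)%N.
Proof.
move=> gi H; have := card_copyE_meet gi H.
by rewrite cardsU card_copyE // setIC; have := edges_in_le P J; lia.
Qed.

Definition injP P (g : U -> V) : bool := dinjectiveb g (mem (vset P)).

Lemma injPP P (g : U -> V) : reflect {in vset P &, injective g} (injP P g).
Proof. exact: dinjectiveP. Qed.

Lemma card_family_prod (F : U -> {set V}) :
  #|[set g : {ffun U -> V} | [forall u, g u \in F u]]| = (\prod_u #|F u|)%N.
Proof.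
have := card_family (fun u => mem (F u)); rewrite foldrE big_image /= => <-.
by apply: eq_card => g; rewrite inE; apply/forallP/familyP.
Qed.

Lemma card_family2 (J : {set U}) (A Y : {set V}) :
  #|[set g : {ffun U -> V} | [forall u, g u \in (if u \in J then A else Y)]]| =
  (#|A| ^ #|J| * #|Y| ^ (#|U| - #|J|))%N.
Proof.
rewrite card_family_prod (bigID (fun u => u \in J)) /=; congr (_ * _)%N.
  by rewrite (eq_bigr (fun=> #|A|)) ?prod_nat_const // => u ->.
rewrite (eq_bigr (fun=> #|Y|)) => [|u /negbTE-> //].
rewrite prod_nat_const; congr (_ ^ _)%N.
by rewrite -(cardC (mem J)) addKn; apply: eq_card => u; rewrite !inE.
Qed.

Definition ovl P g h : {set U} := [set u in vset P | h u \in g @: vset P].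

Variables (R : realType) (Y : {set V}) (P : sgraph U) (q : R).
Hypotheses (q0 : 0 < q) (q1 : q <= 1) (Y0 : (0 < #|Y|)%N).

(** Maps are total on [U], so a copy of a pattern on fewer vertices is counted once for each choice
    of the free values. This factor is common to all copies of the pattern and cancels in every
    normalised bound. *)
Definition injmaps : {set {ffun U -> V}} :=
  [set g : {ffun U -> V} | [forall u, g u \in Y] && injP P g].

Lemma card_injmaps : (#|injmaps| <= #|Y| ^ #|U|)%N.
Proof.
have -> : (#|Y| ^ #|U| = #|[set g : {ffun U -> V} |
    [forall u, g u \in (if u \in set0 then set0 else Y)]]|)%N.
  by rewrite card_family2 !cards0 subn0 mul1n.
apply/subset_leq_card/subsetP => g; rewrite !inE => /andP[/forallP h _].
by apply/forallP => u; rewrite inE.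
Qed.

Lemma card_ovl g (J : {set U}) :
  (#|[set h in injmaps | ovl P g h == J]| <= #|U| ^ #|J| * #|Y| ^ (#|U| - #|J|))%N.
Proof.
apply: (@leq_trans (#|g @: vset P| ^ #|J| * #|Y| ^ (#|U| - #|J|))); last first.
  rewrite leq_mul2r; apply/orP; right.
  case: #|J| => // j; rewrite leq_exp2r //.
  exact: leq_trans (leq_imset_card _ _) (max_card _).
rewrite -card_family2; apply/subset_leq_card/subsetP => h; rewrite !inE.
case/andP=> /andP[/forallP hY _] /eqP <-; apply/forallP => u.
by case: ifP => //; rewrite inE => /andP[].
Qed.

Lemma copyE_meet_ovl g h (x : {set U}) : x \in eset P ->
  h @: x \in copyE P g -> x \subset ovl P g h.
Proof.
move=> xP /imsetP[y yP E]; apply/subsetP => u ux; rewrite inE.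
have [xP' _] := edge_sub xP; have [yP' _] := edge_sub yP.
rewrite (subsetP xP') //=; have : h u \in g @: y by rewrite -E imset_f.
by move=> /imsetP[w wy ->]; rewrite imset_f // (subsetP yP').
Qed.

(* Normalised by the square of the expected number of copies, the pairs of
   copies that meet in the vertex set [J] of [P] contribute at most
   [1 / (N ^ #|J| * q ^ e(J))]. *)
Lemma sum_pairs (Q : pred {set U}) :
  \sum_(g in injmaps) \sum_(h in injmaps | Q (ovl P g h))
     q ^+ #|copyE P g :|: copyE P h| <=
  (#|Y|%:R ^+ #|U| * q ^+ e P) ^+ 2 * (#|U|%:R ^+ #|U|) *
  \sum_(J : {set U} | Q J) (#|Y|%:R ^+ #|J| * q ^+ edges_in P J)^-1.
Proof.
set N := #|Y|%:R : R; set b := #|U|.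
have N0 : 0 < N by rewrite ltr0n.
have step g : g \in injmaps ->
  \sum_(h in injmaps | Q (ovl P g h)) q ^+ #|copyE P g :|: copyE P h| <=
  N ^+ b * q ^+ (e P).*2 * b%:R ^+ b *
  \sum_(J : {set U} | Q J) (N ^+ #|J| * q ^+ edges_in P J)^-1.
  rewrite inE => /andP[_ /injPP gi].
  rewrite (partition_big (ovl P g) Q) /=; last by move=> h /andP[].
  rewrite big_distrr /=; apply: ler_sum => J QJ.
  apply: (@le_trans _ _ (\sum_(h in [set h in injmaps | ovl P g h == J])
     q ^+ ((e P).*2 - edges_in P J))).
    rewrite big_mkcond [X in _ <= X]big_mkcond; apply: ler_sum => h _.
    rewrite [h \in [set _ in _ | _]]inE.
    case: (boolP (h \in injmaps)) => //= hI.
    case: eqVneq => [E|]; rewrite ?andbF //= andbT; case: ifP => // _.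
    have hi : {in vset P &, injective h} by move: hI; rewrite inE => /andP[_ /injPP].
    apply: ler_wiXn2l => //; first exact: ltW.
    have := card_copyE_union hi (copyE_meet_ovl (g := g) (h := h)).
    rewrite E card_copyE //; have := edges_in_le P J => h1 h2; rewrite -addnn; apply: leq_trans h2; rewrite addnBA //.
    by rewrite exprn_ge0 // ltW.
  rewrite sumr_const -[X in X <= _]mulr_natl.
  have Jb : (#|J| <= b)%N by exact: max_card.
  apply: (@le_trans _ _ ((b ^ #|J| * #|Y| ^ (b - #|J|))%:R *
     q ^+ ((e P).*2 - edges_in P J))).
    apply: ler_wpM2r; first by rewrite exprn_ge0 // ltW.
    by rewrite ler_nat card_ovl.
  have bJ : (b ^ #|J|)%:R <= b%:R ^+ b :> R.
    rewrite -natrX ler_nat; case: (posnP b) Jb => [->|b0 Jb]; last by rewrite leq_pexp2l.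
    by rewrite leqn0 => /eqP->.
  have -> : N ^+ b * q ^+ (e P).*2 * b%:R ^+ b * (N ^+ #|J| * q ^+ edges_in P J)^-1 =
            b%:R ^+ b * (N ^+ (b - #|J|) * q ^+ ((e P).*2 - edges_in P J)).
    have E1 : N ^+ b = N ^+ (b - #|J|) * N ^+ #|J| by rewrite -exprD subnK.
    have E2 : q ^+ (e P).*2 = q ^+ ((e P).*2 - edges_in P J) * q ^+ edges_in P J.
      by rewrite -exprD subnK //; have := edges_in_le P J; lia.
    have B0 : N ^+ #|J| != 0 by rewrite expf_neq0 ?gt_eqF.
    have D0 : q ^+ edges_in P J != 0 by rewrite expf_neq0 ?gt_eqF.
    rewrite E1 E2; move: B0 D0; move: (N ^+ #|J|) (q ^+ edges_in P J) => x y x0 y0.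
    move: (N ^+ (b - #|J|)) (q ^+ _) (b%:R ^+ b) => x' y' z.
    by field; rewrite x0 y0.
  have -> : (b ^ #|J| * #|Y| ^ (b - #|J|))%:R = (b ^ #|J|)%:R * N ^+ (b - #|J|) :> R.
    by rewrite natrM [X in _ * X]natrX.
  rewrite -mulrA; apply: ler_wpM2r => //.
  by rewrite mulr_ge0 // exprn_ge0 // ltW.
apply: le_trans (ler_sum _ step) _.
rewrite sumr_const -[X in X <= _]mulr_natl.
set S := \sum_(J | _) _.
have S0 : 0 <= S.
  by apply: sumr_ge0 => J _; rewrite invr_ge0 mulr_ge0 // exprn_ge0 // ltW.
apply: (@le_trans _ _ (N ^+ b * (N ^+ b * q ^+ (e P).*2 * b%:R ^+ b * S))).
  apply: ler_wpM2r; last by rewrite /N -natrX ler_nat card_injmaps.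
  by rewrite !mulr_ge0 // ?exprn_ge0 // ltW.
have -> : (N ^+ b * q ^+ e P) ^+ 2 = (N ^+ b) ^+ 2 * q ^+ (e P).*2.
  by rewrite exprMn -muln2 [q ^+ (_ * _)]exprM.
move: (N ^+ b) (q ^+ _) (b%:R ^+ b) => a c d.
by rewrite le_eqVlt; apply/orP; left; apply/eqP; ring.
Qed.

End Copies.

(** * Critical systems of copies *)

Lemma bool_le_sum (R : numDomainType) (I J : finType) (A : pred I) (M : I -> {set J})
    (b : bool) (c : I -> J -> bool) :
  (b -> exists i, exists2 j, A i & (j \in M i) && c i j) ->
  b%:R <= \sum_(i | A i) \sum_(j in M i) (c i j)%:R :> R.
Proof.
case: b => [/(_ isT)[i [j Ai /andP[jM cij]]]|_]; last first.
  by apply: sumr_ge0 => i _; apply: sumr_ge0.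
rewrite (bigD1 i) //= (bigD1 j) //= cij -addrA lerDl addr_ge0 //; first exact: sumr_ge0.
by apply: sumr_ge0 => k _; apply: sumr_ge0.
Qed.

Lemma sum_le_card (R : numDomainType) (I : finType) (A : pred I) (f : I -> R) c :
  0 <= c -> (forall i, A i -> f i <= c) -> \sum_(i | A i) f i <= #|I|%:R * c.
Proof.
move=> c0 h; apply: (le_trans (ler_sum _ h)).
rewrite sumr_const -[X in X <= _]mulr_natl; apply: ler_wpM2r => //.
by rewrite ler_nat max_card.
Qed.

Notation ext_index U := (sgraph U * U * {set U})%type.

Section Hypergraph.
Variables (U V : finType) (J1 J2 : {set sgraph U}).

(** Only the vertex set of a copy is recorded, since a two-colouring sees nothing else of it. *)
Definition typ (J : {set sgraph U}) (E : {set {set V}}) (S : {set V}) : bool :=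
  [exists P in J, [exists g : {ffun U -> V},
    [&& injP P g, copyE P g \subset E & g @: vset P == S]]].

Definition critical (E : {set {set V}}) (A : {set {set V}} * {set {set V}}) : bool :=
  [&& [forall S in A.1, typ J1 E S], [forall T in A.2, typ J2 E T],
      [forall S in A.1, forall z in S, exists T in A.2, S :&: T == [set z]] &
      [forall T in A.2, forall z in T, exists S in A.1, T :&: S == [set z]]].

(* [E] contains a critical system having [S] as a copy of the first type. *)
Definition in_crit1 S E := [exists A, critical E A && (S \in A.1)].
Definition in_crit2 T E := [exists A, critical E A && (T \in A.2)].
Definition has_crit E := [exists A, critical E A && (A.1 != set0)].

Lemma crit1_next S E z : in_crit1 S E -> z \in S ->
  exists T, [/\ typ J2 E T, T :&: S = [set z] & in_crit2 T E].
Proof.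
move=> /existsP[A /andP[cA SA]] zS.
have /and4P[_ /forall_inP h2 /forall_inP h _] := cA.
have /forall_inP/(_ _ zS)/exists_inP[T TA /eqP ST] := h _ SA.
exists T; split; [exact: h2|by rewrite setIC|].
by apply/existsP; exists A; rewrite cA.
Qed.

Lemma crit2_next T E z : in_crit2 T E -> z \in T ->
  exists S, [/\ typ J1 E S, S :&: T = [set z] & in_crit1 S E].
Proof.
move=> /existsP[A /andP[cA SA]] zS.
have /and4P[/forall_inP h1 _ _ /forall_inP h] := cA.
have /forall_inP/(_ _ zS)/exists_inP[S SA' /eqP ST] := h _ SA.
exists S; split; [exact: h1|by rewrite setIC|].
by apply/existsP; exists A; rewrite cA.
Qed.

Definition ext_ok (J : {set sgraph U}) (t : ext_index U) : bool :=
  [&& t.1.1 \in J, t.1.2 \in vset t.1.1 & t.2 \subset vset t.1.1 :\ t.1.2].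

(* Attaching a copy of the pattern [t.1.1] at [z], with [z] in the role of
   [t.1.2], to an explored vertex set [Z]: besides [z] it meets [Z] in the image
   of [t.2], and it meets [S] in [z] only. *)
Definition exts (Z S : {set V}) (z : V) (t : ext_index U) : {set {ffun U -> V}} :=
  [set g : {ffun U -> V} | [&& injP t.1.1 g, g t.1.2 == z,
     [forall u, (u \notin vset t.1.1) ==> (g u == z)],
     g @: vset t.1.1 :&: S == [set z] &
     [set u in vset t.1.1 :\ t.1.2 | g u \in Z] == t.2]].

Lemma typ_ext J E Z S T z : typ J E T -> T :&: S = [set z] ->
  exists t, exists2 g, ext_ok J t & [&& g \in exts Z S z t,
    copyE t.1.1 g \subset E & g @: vset t.1.1 == T].
Proof.
move=> /exists_inP[P PJ /existsP[g /and3P[/injPP gi gE /eqP gT]]] TS.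
have : z \in T.
  by have : z \in T :&: S; [rewrite TS set11|case/setIP].
rewrite -gT => /imsetP[u0 u0P zE].
(* Off the pattern the map is constant, so that free values do not inflate the count of
   extensions. *)
pose g' := [ffun u => if u \in vset P then g u else z].
have g'E u : u \in vset P -> g' u = g u by move=> uP; rewrite ffunE uP.
have g'im (x : {set U}) : x \subset vset P -> g' @: x = g @: x.
  by move=> xP; apply: eq_in_imset => u /(subsetP xP); exact: g'E.
exists (P, u0, [set u in vset P :\ u0 | g' u \in Z]), g'; rewrite /ext_ok /=.
  by rewrite PJ u0P; apply/subsetP => u; rewrite inE => /andP[].
rewrite inE /= eqxx andbT g'E // -zE eqxx /=.
rewrite g'im // gT TS !eqxx !andbT /=; apply/andP; split.
  apply/andP; split.
    by apply/injPP => a b aP bP; rewrite !g'E //; exact: gi.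
  by apply/forallP => u; apply/implyP => /negbTE uP; rewrite ffunE uP.
apply: subset_trans gE; apply/subsetP => f /imsetP[x xP ->].
by rewrite g'im ?imset_f //; have [] := edge_sub xP.
Qed.

Section ExtSum.
Variables (R : realType) (q : R) (F : {set {set V}}) (Z S : {set V}) (z : V).
Hypotheses (q0 : 0 <= q) (q1 : q <= 1).
Hypotheses (FZ : F \subset pairs Z) (zS : z \in S)
  (Fz : forall f, f \in F -> z \in f -> f \subset S).

(** An exposed edge at [z] lies in [S], and the new copy meets [S] in [z] alone; hence no edge of
    the copy at [z] was exposed before. Any other exposed edge of the copy has both ends in [Z],
    that is, in the image of [t.2]. *)
Lemma ext_meet t g x : ext_ok J1 t || ext_ok J2 t -> g \in exts Z S z t ->
  x \in eset t.1.1 -> g @: x \in F -> x \subset t.2.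
Proof.
move=> tok; rewrite inE => /and5P[/injPP gi /eqP gz _ /eqP gS /eqP tE] xP xF.
have [xsub x2] := edge_sub xP.
have tok0 : t.1.2 \in vset t.1.1 by case/orP: tok => /and3P[].
have u0x : t.1.2 \notin x.
  apply/negP => u0x; have zx : z \in g @: x by rewrite -gz imset_f.
  have := Fz xF zx => sub.
  have : g @: x \subset [set z].
    by rewrite -gS subsetI sub imsetS.
  move=> /subset_leq_card; rewrite cards1 card_in_imset ?x2 //.
  by move=> a b /(subsetP xsub) aP /(subsetP xsub) bP; exact: gi.
apply/subsetP => u ux; rewrite -tE !inE (subsetP xsub) // andbT.
have -> /= : u != t.1.2 by apply: contraNneq u0x => <-.
have := subsetP FZ _ xF; rewrite inE => /andP[/subsetP sub _].
by apply: sub; rewrite imset_f.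
Qed.

Lemma card_exts t : ext_ok J1 t || ext_ok J2 t ->
  (#|exts Z S z t| <= #|Z| ^ #|t.2| * #|V| ^ (v t.1.1 - 1 - #|t.2|))%N.
Proof.
case: t => [[P u0] I] /= tok.
have [u0P IP] : u0 \in vset P /\ I \subset vset P :\ u0 by case/orP: tok => /and3P[].
pose fam u := if u \in I then Z else if u \in vset P :\ u0 then setT else [set z].
apply: (@leq_trans #|[set g : {ffun U -> V} | [forall u, g u \in fam u]]|).
  apply/subset_leq_card/subsetP => g; rewrite !inE /=.
  case/and5P=> _ /eqP gu0 /forallP gout _ /eqP IE; apply/forallP => u; rewrite /fam -IE.
  rewrite !inE; case: eqVneq => [->|uu0] /=; first by rewrite inE gu0.
  case: (boolP (u \in vset P)) => uP /=; last by rewrite inE (implyP (gout u)).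
  by case: ifP.
rewrite card_family_prod (bigID (fun u => u \in I)) /=; apply: leq_mul.
  rewrite (eq_bigr (fun=> #|Z|)) ?prod_nat_const // => u uI.
  by rewrite /fam uI.
rewrite (bigID (fun u => u \in vset P :\ u0)) /= [X in (_ * X)%N]big1 ?muln1; last first.
  by move=> u /andP[uI uP]; rewrite /fam (negPf uI) (negPf uP) cards1.
rewrite (eq_bigr (fun=> #|V|)); last first.
  by move=> u /andP[uI uP]; rewrite /fam (negPf uI) uP cardsT.
rewrite prod_nat_const; apply/eq_leq; congr (_ ^ _)%N.
have -> : (v P - 1 = #|vset P :\ u0|)%N by rewrite /v (cardsD1 u0 (vset P)) u0P add1n subn1.
rewrite -cardsDS //; apply: eq_card => u; rewrite !inE.
by rewrite unfold_in /= !inE.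
Qed.

Lemma ext_sum t : ext_ok J1 t || ext_ok J2 t ->
  \sum_(g in exts Z S z t) q ^+ #|F :|: copyE t.1.1 g| <=
  q ^+ #|F| * (#|Z|%:R ^+ #|t.2| * (#|V|%:R ^+ (v t.1.1 - 1 - #|t.2|) *
    q ^+ (e t.1.1 - edges_in t.1.1 t.2))).
Proof.
move=> tok; apply: (@le_trans _ _ (\sum_(g in exts Z S z t)
    q ^+ (#|F| + (e t.1.1 - edges_in t.1.1 t.2)))).
  apply: ler_sum => g gM; apply: ler_wiXn2l => //.
  apply: card_copyE_union => [|x]; last exact: ext_meet.
  by move: gM; rewrite inE => /and5P[/injPP].
rewrite sumr_const -[X in X <= _]mulr_natl exprD.
set a := q ^+ #|F|; set c := q ^+ (e _ - _).
have -> : a * (#|Z|%:R ^+ #|t.2| * (#|V|%:R ^+ (v t.1.1 - 1 - #|t.2|) * c)) =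
  (#|Z| ^ #|t.2| * #|V| ^ (v t.1.1 - 1 - #|t.2|))%:R * (a * c).
  rewrite natrM !natrX; move: (_ ^+ #|t.2|) (_ ^+ (v _ - _ - _)) => z1 z2; ring.
apply: ler_wpM2r; first by rewrite mulr_ge0 // exprn_ge0.
by rewrite ler_nat card_exts.
Qed.

End ExtSum.
End Hypergraph.

(** * Exploring a critical system *)

Section Sparse.
Variables (R : realType) (U : finType) (b0 x : R).

(** With w^(-b0) vertices and edge probability w, a graph J has about w^(-(b0 v(J) - e(J))) copies.
    So there are at most about w^(-x) copies of [P], and no non-empty part of [P] is rarer than [P]
    itself. *)
Definition sparse1 (P : sgraph U) : Prop :=
  [/\ (2 <= v P)%N, b0 * (v P)%:R - (e P)%:R <= x &
      forall J : {set U}, J \subset vset P -> J != set0 ->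
        b0 * (v P)%:R - (e P)%:R <= b0 * #|J|%:R - (edges_in P J)%:R].

(** [P] attains its own [m1], and the value [y] of it is at least [x]. *)
Definition dense2 (P : sgraph U) : Prop :=
  (2 <= v P)%N /\ exists2 y, x <= y &
    (e P)%:R = y * ((v P)%:R - 1) /\
    forall J : {set U}, J \subset vset P -> J != set0 ->
      (edges_in P J)%:R <= y * (#|J|%:R - 1).

End Sparse.

Section Exploration.
Variables (R : realType) (U V : finType) (J1 J2 : {set sgraph U}).
Variables (b0 x w eps q : R).
Hypotheses (b0_gt0 : 0 < b0) (x0 : 0 < x) (xb : x <= b0).
Hypotheses (sp1 : forall P, P \in J1 -> sparse1 b0 x P)
           (de2 : forall P, P \in J2 -> dense2 x P).
Hypotheses (w0 : 0 < w) (w1 : w <= 1) (Vw : #|V|%:R = w `^ (- b0)).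
Hypotheses (eps0 : 0 < eps) (eps1 : eps <= 1).
Hypotheses (q0 : 0 <= q) (q1 : q <= 1) (qw : q <= eps * w).

(** Everything is measured in powers of [w]: a free vertex has weight [W (- b0)], a new edge at most
    [eps * W 1]. Since [w <= 1], larger exponents mean smaller weights. *)
Let W t := w `^ t.
Let b := #|U|.
Let C : R := #|{: ext_index U}|%:R + 1.
Let ss := enum (pairs [set: V]).

Local Lemma W_gt0 t : 0 < W t. Proof. exact: powR_gt0. Qed.

Local Lemma W_ge0 t : 0 <= W t. Proof. exact: powR_ge0. Qed.

Local Lemma W_le t t' : t' <= t -> W t <= W t'.
Proof. by move=> h; apply: ger_powR; rewrite ?w0. Qed.

Local Lemma W_D t t' : W (t + t') = W t * W t'.
Proof. by rewrite /W powRD //; apply/implyP => _; rewrite gt_eqF. Qed.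

Local Lemma W_X t n : W t ^+ n = W (t * n%:R).
Proof. by rewrite /W powRrM powR_mulrn // powR_ge0. Qed.

Local Lemma C_ge1 : 1 <= C. Proof. by rewrite lerDr. Qed.

Local Lemma C_ge0 : 0 <= C. Proof. exact: le_trans ler01 C_ge1. Qed.

Local Lemma weight a m : #|V|%:R ^+ a * q ^+ m <= eps ^+ m * W (m%:R - b0 * a%:R).
Proof.
rewrite Vw -/(W _) W_X addrC W_D mulrCA -mulNr; apply: ler_wpM2l; first exact/ltW/W_gt0.
apply: (@le_trans _ _ ((eps * w) ^+ m)); first by apply: lerXn2r; rewrite ?nnegrE // mulr_ge0 // ltW.
by rewrite exprMn /W powR_mulrn // ltW.
Qed.

Local Lemma weight_le a m c t : eps ^+ m <= c -> t <= m%:R - b0 * a%:R ->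
  #|V|%:R ^+ a * q ^+ m <= c * W t.
Proof.
move=> h1 h2; apply: (le_trans (weight _ _)); apply: ler_pM => //.
- exact/exprn_ge0/ltW.
- exact/ltW/W_gt0.
exact: W_le.
Qed.

Local Lemma eps_X m : eps ^+ m <= 1.
Proof. by rewrite exprn_ile1 // ltW. Qed.

Local Lemma eps_X1 m : (0 < m)%N -> eps ^+ m <= eps.
Proof. by case: m => // m _; rewrite exprS ler_piMr ?eps_X // ltW. Qed.

Section State.
Variables (F : {set {set V}}) (Z S : {set V}) (z : V).
Hypotheses (FZ : F \subset pairs Z) (SZ : S \subset Z) (zS : z \in S)
  (Fz : forall f, f \in F -> z \in f -> f \subset S).

Local Lemma ext_vK t (J : {set sgraph U}) : ext_ok J t ->
  [/\ (#|t.2| <= v t.1.1 - 1)%N, (0 < v t.1.1)%N & t.2 \subset vset t.1.1].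
Proof.
case: t => [[P u0] I] /and3P[/= _ u0P IP].
have vP : (v P = #|vset P :\ u0|.+1)%N by rewrite /v (cardsD1 u0) u0P.
rewrite vP subn1 /=; split=> //; first exact: subset_leq_card.
exact: subset_trans IP (subsetDl _ _).
Qed.

(** A sparse copy at a given vertex, otherwise on new vertices: the exponent is e - b0 (v - 1), at
    least b0 - x. *)
Local Lemma ext1_reg t : ext_ok J1 t -> t.2 == set0 ->
  \sum_(g in exts Z S z t) q ^+ #|F :|: copyE t.1.1 g| <=
  q ^+ #|F| * (eps * W (b0 - x)).
Proof.
move=> tok /eqP t0; have tok' : ext_ok J1 t || ext_ok J2 t by rewrite tok.
apply: (le_trans (ext_sum q0 q1 FZ Fz tok')).
have [P1 P2 P3] := sp1 (let: And3 h _ _ := and3P tok in h).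
rewrite t0 cards0 expr0 mul1r subn0 edges_in0 ?cards0 // subn0.
apply: ler_wpM2l; first exact: exprn_ge0.
(* From v >= 2 and b0 v - e <= x <= b0 the pattern has at least b0 > 0 edges, which is where the
   factor [eps] comes from. *)
have e0 : (0 < e t.1.1)%N.
  have v2 : 2 <= (v t.1.1)%:R :> R by rewrite (ler_nat R 2).
  have h := ler_wpM2l (ltW b0_gt0) v2; have h0 := b0_gt0.
  by rewrite -(ltr0n R); move: P2 xb; lra.
apply: weight_le; first exact: eps_X1.
rewrite (natrB _ (ltnW P1)).
by move: P2; lra.
Qed.

(** If the copy meets explored vertices besides [z], then minimality of [P] in [sparse1] shows that
    the part outside [t.2] has weight at most 1 before [z] is fixed. Compared with a regular
    extension a factor [W x] is gained, up to a power of [#|Z|]. *)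
Local Lemma ext1_deg t : ext_ok J1 t -> t.2 != set0 ->
  \sum_(g in exts Z S z t) q ^+ #|F :|: copyE t.1.1 g| <=
  q ^+ #|F| * (#|Z|%:R ^+ b * W b0).
Proof.
move=> tok t0; have tok' : ext_ok J1 t || ext_ok J2 t by rewrite tok.
apply: (le_trans (ext_sum q0 q1 FZ Fz tok')).
have [P1 P2 P3] := sp1 (let: And3 h _ _ := and3P tok in h).
have [ta tv tsub] := ext_vK tok.
apply: ler_wpM2l; first exact: exprn_ge0.
apply: ler_pM; rewrite ?mulr_ge0 ?exprn_ge0 //.
  apply: ler_weXn2l; last exact: max_card.
  rewrite (ler_nat R 1) card_gt0; apply/set0Pn; exists z; exact: (subsetP SZ).
rewrite -[leRHS]mul1r; apply: weight_le; first exact: eps_X.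
rewrite (natrB _ ta) (natrB _ tv) (natrB _ (edges_in_le _ _)).
by have := P3 _ tsub t0; lra.
Qed.

(** The weight is large, one factor [W (x - b0)] for each new vertex. Each of these vertices will
    demand a sparse copy of weight [W (b0 - x)], and the product is 1. *)
Local Lemma ext2_reg t : ext_ok J2 t -> t.2 == set0 ->
  \sum_(g in exts Z S z t) q ^+ #|F :|: copyE t.1.1 g| <=
  q ^+ #|F| * (eps * W ((x - b0) * (v t.1.1 - 1)%:R)).
Proof.
move=> tok /eqP t0; have tok' : ext_ok J1 t || ext_ok J2 t by rewrite tok orbT.
apply: (le_trans (ext_sum q0 q1 FZ Fz tok')).
have [P1 [y xy [ey _]]] := de2 (let: And3 h _ _ := and3P tok in h).
rewrite t0 cards0 expr0 mul1r subn0 edges_in0 ?cards0 // subn0.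
apply: ler_wpM2l; first exact: exprn_ge0.
have v2 : 2 <= (v t.1.1)%:R :> R by rewrite (ler_nat R 2).
have e0 : (0 < e t.1.1)%N.
  rewrite -(ltr0n R) ey mulr_gt0 //; [exact: lt_le_trans xy|by move: v2; lra].
apply: weight_le; first exact: eps_X1.
rewrite (natrB _ (ltnW P1)) ey.
by nra.
Qed.

(** Removing [t.2], with e(t.2) <= y (|t.2| - 1), leaves one edge share [y] more than the new
    vertices account for; this is the additional [x] in the exponent. *)
Local Lemma ext2_deg t : ext_ok J2 t -> t.2 != set0 ->
  \sum_(g in exts Z S z t) q ^+ #|F :|: copyE t.1.1 g| <=
  q ^+ #|F| * (#|Z|%:R ^+ b * (eps * W ((x - b0) * (v t.1.1 - 1 - #|t.2|)%:R + x))).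
Proof.
move=> tok t0; have tok' : ext_ok J1 t || ext_ok J2 t by rewrite tok orbT.
apply: (le_trans (ext_sum q0 q1 FZ Fz tok')).
have [P1 [y xy [ey yJ]]] := de2 (let: And3 h _ _ := and3P tok in h).
have [ta tv tsub] := ext_vK tok.
have {}yJ := yJ _ tsub t0.
have ta' : 1 + #|t.2|%:R <= (v t.1.1)%:R :> R.
  by rewrite nat1r ler_nat -(ltn_predK tv) ltnS -subn1.
apply: ler_wpM2l; first exact: exprn_ge0.
apply: ler_pM; rewrite ?mulr_ge0 ?exprn_ge0 //.
  apply: ler_weXn2l; last exact: max_card.
  rewrite (ler_nat R 1) card_gt0; apply/set0Pn; exists z; exact: (subsetP SZ).
have e0 : (0 < e t.1.1 - edges_in t.1.1 t.2)%N.
  by rewrite subn_gt0 -(ltr_nat R) ey; move: x0 xy yJ ta'; nra.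
apply: weight_le; first exact: eps_X1.
rewrite (natrB _ ta) (natrB _ tv) (natrB _ (edges_in_le _ _)) ey.
by nra.
Qed.

Local Lemma ext_state t (J : {set sgraph U}) g : ext_ok J t -> g \in exts Z S z t ->
  F :|: copyE t.1.1 g \subset pairs (Z :|: g @: vset t.1.1) /\
  (#|Z :|: g @: vset t.1.1| <= #|Z| + b)%N.
Proof.
move=> tok; rewrite inE => /and5P[/injPP gi _ _ _ _]; split.
  rewrite subUset (subset_trans FZ) ?pairsS ?subsetUl //=.
  by apply: copyE_pairs => //; exact: subsetUr.
rewrite (leq_trans (leq_card_setU _ _)) // leq_add2l.
exact: leq_trans (leq_imset_card _ _) (max_card _).
Qed.

End State.

Local Lemma sub_ss (F : {set {set V}}) (Z : {set V}) : F \subset pairs Z -> F \subset ss.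
Proof.
move=> FZ; apply/subsetP => f /(subsetP FZ); rewrite mem_enum; apply/subsetP.
exact/pairsS/subsetT.
Qed.

Local Lemma Ex_le_sub (F : {set {set V}}) (Z : {set V}) (A : pred {set {set V}}) : F \subset pairs Z ->
  Ex q ss (fun E => ((F \subset E) && A E)%:R) <= q ^+ #|F|.
Proof.
move=> FZ; rewrite -(@Ex_subE _ _ q ss) ?enum_uniq ?(sub_ss FZ) //.
by apply: ler_Ex => [|E]; [rewrite q0|apply: ler_bool => /andP[]].
Qed.

(** Total weight of attaching a sparse copy at one vertex: [A0] for regular copies, [D0 s] for
    overlapping ones when at most [s] vertices are explored. The quotient is of order [W x]. *)
Let A0 := C * W (b0 - x).
Let D0 (s : nat) := C * (s%:R ^+ b * W b0).

Local Lemma A0_ge0 : 0 <= A0.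
Proof. by rewrite mulr_ge0 ?C_ge0 ?W_ge0. Qed.
Local Lemma D0_ge0 s : 0 <= D0 s.
Proof. by rewrite mulr_ge0 ?C_ge0 // mulr_ge0 ?W_ge0 // exprn_ge0. Qed.

Local Lemma sum_ext_le (A : pred (ext_index U)) (f : ext_index U -> R) c :
  0 <= c -> (forall t, A t -> f t <= c) -> \sum_(t | A t) f t <= C * c.
Proof.
move=> c0 h; apply: (le_trans (sum_le_card c0 h)); apply: ler_wpM2r => //.
by rewrite lerDl.
Qed.

Section Pending.
Variables (s : nat) (Sf : {set V}).

(* During the exploration [F] is the set of exposed edges and [Z] the set of
   exposed vertices. The copy [Sf] has just been added; the vertices [ys] of
   [Sf], at which a copy of the other type is still to be attached, lie in no
   exposed edge that leaves [Sf]. *)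
Definition pending (F : {set {set V}}) (Z : {set V}) (ys : seq V) : Prop :=
  [/\ F \subset pairs Z, Sf \subset Z, {subset ys <= Sf}, uniq ys &
      forall y f, y \in ys -> f \in F -> y \in f -> f \subset Sf].

(** The new copy meets [Sf] in [y] only, so the remaining vertices [ys] lie on none of its edges. *)
Local Lemma pending_next F Z y ys t g : pending F Z (y :: ys) -> ext_ok J1 t ->
  g \in exts Z Sf y t -> pending (F :|: copyE t.1.1 g) (Z :|: g @: vset t.1.1) ys.
Proof.
case=> FZ SZ ysS /andP[yys uys] Fy tok gM; split=> //.
- by have [] := ext_state FZ tok gM.
- exact: subset_trans SZ (subsetUl _ _).
- by move=> y' h; apply: ysS; rewrite inE h orbT.
move=> y' f y'ys /setUP[fF|fg] y'f.
  by apply: (Fy y') => //; rewrite inE y'ys orbT.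
move: gM; rewrite inE => /and5P[_ _ _ /eqP gS _].
have : y' \in g @: vset t.1.1 :&: Sf.
  rewrite inE ysS ?inE ?y'ys ?orbT // andbT.
  by case/imsetP: fg y'f => a /edge_sub[aP _] ->; apply/subsetP/imsetS.
by rewrite gS => /set1P y'y; rewrite -y'y y'ys in yys.
Qed.

(** Union bound over the sparse copy at the next pending vertex. The numbers [c] and [d] stand for
    the cost of what follows a regular and an overlapping attachment. *)
Local Lemma pending_step F Z y ys c d :
  pending F Z (y :: ys) -> (#|Z| <= s)%N -> 0 <= c -> 0 <= d ->
  (forall t g, ext_ok J1 t -> t.2 == set0 -> g \in exts Z Sf y t ->
     Ex q ss (fun E => ((F :|: copyE t.1.1 g \subset E) &&
        (in_crit2 J1 J2 Sf E && in_crit1 J1 J2 (g @: vset t.1.1) E))%:R)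
     <= q ^+ #|F :|: copyE t.1.1 g| * c) ->
  (forall t g, ext_ok J1 t -> t.2 != set0 -> g \in exts Z Sf y t ->
     Ex q ss (fun E => ((F :|: copyE t.1.1 g \subset E) &&
        (in_crit2 J1 J2 Sf E && in_crit1 J1 J2 (g @: vset t.1.1) E))%:R)
     <= q ^+ #|F :|: copyE t.1.1 g| * d) ->
  Ex q ss (fun E => ((F \subset E) && in_crit2 J1 J2 Sf E)%:R) <=
    q ^+ #|F| * (A0 * c + D0 s * d).
Proof.
case=> FZ SZ ysS /andP[yys uys] Fy Zs c0 d0 hc hd.
have ySf : y \in Sf by apply: ysS; rewrite inE eqxx.
have Fy' f : f \in F -> y \in f -> f \subset Sf by apply: Fy; rewrite inE eqxx.
apply: (@le_trans _ _ (Ex q ss (fun E => \sum_(t | ext_ok J1 t) \sum_(g in exts Z Sf y t)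
   ((F :|: copyE t.1.1 g \subset E) &&
        (in_crit2 J1 J2 Sf E && in_crit1 J1 J2 (g @: vset t.1.1) E))%:R))).
  apply: ler_Ex => [|E]; first by rewrite q0.
  apply: bool_le_sum => /andP[FE SE].
  have [T [T1 T2 T3]] := crit2_next SE ySf.
  have [t [g tok /and3P[gM gE /eqP gT]]] := typ_ext Z T1 T2.
  by exists t, g => //; rewrite gM subUset FE gE SE gT T3.
rewrite Ex_sum (bigID (fun t : ext_index U => t.2 == set0)) /= mulrDr.
have qF : 0 <= q ^+ #|F| by exact: exprn_ge0.
apply: lerD.
  rewrite /A0 -!mulrA mulrCA; apply: sum_ext_le.
    by rewrite mulr_ge0 // mulr_ge0 ?W_ge0.
  move=> t /andP[tok t0]; rewrite Ex_sum mulrA.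
  apply: (@le_trans _ _ (\sum_(g in exts Z Sf y t) q ^+ #|F :|: copyE t.1.1 g| * c)).
    by apply: ler_sum => g gM; exact: hc.
  rewrite -mulr_suml; apply: ler_wpM2r => //.
  apply: (le_trans (ext1_reg FZ Fy' tok t0)); apply: ler_wpM2l => //.
  by rewrite ler_piMl // ltW // W_gt0.
rewrite /D0 -!mulrA mulrCA; apply: sum_ext_le.
  by rewrite mulr_ge0 // mulr_ge0 // mulr_ge0 ?W_ge0 // exprn_ge0.
move=> t /andP[tok t0]; rewrite Ex_sum mulrA mulrA.
apply: (@le_trans _ _ (\sum_(g in exts Z Sf y t) q ^+ #|F :|: copyE t.1.1 g| * d)).
  by apply: ler_sum => g gM; exact: hd.
rewrite -mulr_suml; apply: ler_wpM2r => //.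
apply: (le_trans (ext1_deg FZ SZ ySf Fy' tok t0)); apply: ler_wpM2l => //.
apply: ler_wpM2r; first by rewrite ltW // W_gt0.
by apply: lerXn2r; rewrite ?nnegrE ?ler0n ?ler_nat.
Qed.

(** The crude bound for the rest of a block once an overlap has occurred: the gain is then already
    secured, and the exploration ends with the block. *)
Local Lemma pending_deg F Z ys : pending F Z ys -> (#|Z| + b * size ys <= s)%N ->
  Ex q ss (fun E => ((F \subset E) && in_crit2 J1 J2 Sf E)%:R) <=
    q ^+ #|F| * (A0 + D0 s) ^+ size ys.
Proof.
elim: ys F Z => [|y ys IH] F Z pF; rewrite /= => hs.
  by rewrite expr0 mulr1; case: pF => FZ _ _ _ _; exact: Ex_le_sub FZ.
have AD : 0 <= A0 + D0 s by rewrite addr_ge0 ?A0_ge0 ?D0_ge0.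
rewrite exprS mulrDl; apply: (pending_step pF).
- by move: hs; clear; lia.
- exact: exprn_ge0.
- exact: exprn_ge0.
- move=> t g tok _ gM; have pF' := pending_next pF tok gM.
  apply: le_trans (IH _ _ pF' _).
    by apply: ler_Ex => [|E]; [rewrite q0|apply: ler_bool => /and3P[-> ->]].
  case: pF => FZ _ _ _ _; have [_ h] := ext_state FZ tok gM.
  by move: hs h; rewrite mulnS; clear; lia.
move=> t g tok _ gM; have pF' := pending_next pF tok gM.
apply: le_trans (IH _ _ pF' _).
  by apply: ler_Ex => [|E]; [rewrite q0|apply: ler_bool => /and3P[-> ->]].
case: pF => FZ _ _ _ _; have [_ h] := ext_state FZ tok gM.
by move: hs h; rewrite mulnS; clear; lia.
Qed.

Definition open_state (F : {set {set V}}) (Z S : {set V}) (z : V) : Prop :=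
  [/\ F \subset pairs Z, S \subset Z, z \in S &
      forall f, f \in F -> z \in f -> f \subset S].

(** [B] bounds the weight of all later blocks; it carries the induction hypothesis of
    [open_bound]. *)
Variable B : R.
Hypothesis B0 : 0 <= B.
Hypothesis open_le : forall F Z S z, open_state F Z S z -> (#|Z| <= s)%N ->
  Ex q ss (fun E => ((F \subset E) && in_crit1 J1 J2 S E)%:R) <= q ^+ #|F| * B.

(** A sparse pattern has at least two vertices, so a regular copy has a new vertex. Exposed edges at
    that vertex belong to the copy, and the next block can start there. *)
Local Lemma open_next F Z y ys t g : pending F Z (y :: ys) -> ext_ok J1 t ->
  t.2 == set0 -> g \in exts Z Sf y t ->
  exists z, open_state (F :|: copyE t.1.1 g) (Z :|: g @: vset t.1.1)
    (g @: vset t.1.1) z.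
Proof.
case=> FZ SZ ysS _ _ tok /eqP t0 gM.
have [h1 _ _] := sp1 (let: And3 h _ _ := and3P tok in h).
have [F'Z _] := ext_state FZ tok gM.
have u0P : t.1.2 \in vset t.1.1 by case/and3P: tok.
have : (0 < #|vset t.1.1 :\ t.1.2|)%N.
  by move: h1; rewrite /v (cardsD1 t.1.2) u0P.
rewrite card_gt0 => /set0Pn[u uP].
exists (g u); split => //; first exact: subsetUr.
  by rewrite imset_f //; move: uP => /setD1P[].
have guZ : g u \notin Z.
  apply/negP => guZ; move: gM; rewrite inE => /and5P[_ _ _ _ /eqP].
  by rewrite t0 => /setP /(_ u); rewrite !inE guZ andbT -in_setD1 uP.
move=> f /setUP[fF|] guf.
  move: (subsetP FZ f fF); rewrite inE => /andP[/subsetP fZ _].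
  by rewrite fZ in guZ.
by move/imsetP: guf => [a /edge_sub[aP _] ->] _; exact: imsetS.
Qed.

(** If all attachments are regular, then the last copy opens the next block, whence the factor [B].
    Otherwise one of the pending vertices carries an overlapping copy, and no further block is
    explored. *)
Local Lemma pending_reg F Z y ys : pending F Z (y :: ys) ->
  (#|Z| + b * (size ys).+1 <= s)%N ->
  Ex q ss (fun E => ((F \subset E) && in_crit2 J1 J2 Sf E)%:R) <=
  q ^+ #|F| * (A0 ^+ (size ys).+1 * B +
    (size ys).+1%:R * D0 s * (A0 + D0 s) ^+ size ys).
Proof.
have AD : 0 <= A0 + D0 s by rewrite addr_ge0 ?A0_ge0 ?D0_ge0.
elim: ys F Z y => [|y' ys IH] F Z y pF hs.
  rewrite expr0 expr1 mulr1 mul1r -[X in _ + X]mulr1.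
  apply: (pending_step pF) => //; first by move: hs; clear; lia.
    move=> t g tok t0 gM; have [z oz] := open_next pF tok t0 gM.
    apply: le_trans (open_le oz _).
      by apply: ler_Ex => [|E]; [rewrite q0|apply: ler_bool => /and3P[-> _ ->]].
    by case: pF => FZ _ _ _ _; have [_ h] := ext_state FZ tok gM; move: hs h => /=; clear; lia.
  move=> t g tok _ gM; rewrite mulr1.
  by case: pF => FZ _ _ _ _; have [h _] := ext_state FZ tok gM; exact: Ex_le_sub h.
set l := (size ys).+1.
have Ag := A0_ge0; have Dg := D0_ge0 s.
apply: (@le_trans _ _ (q ^+ #|F| * (A0 * (A0 ^+ l * B + l%:R * D0 s * (A0 + D0 s) ^+ size ys)
   + D0 s * (A0 + D0 s) ^+ l))).
  apply: (pending_step pF) => //.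
  - by move: hs => /=; clear; lia.
    apply: addr_ge0; first by rewrite mulr_ge0 // exprn_ge0.
    by rewrite mulr_ge0 ?exprn_ge0 // mulr_ge0.
  - exact: exprn_ge0.
  - move=> t g tok _ gM; have pF' := pending_next pF tok gM.
    apply: le_trans (IH _ _ _ pF' _).
      by apply: ler_Ex => [|E]; [rewrite q0|apply: ler_bool => /and3P[-> ->]].
    case: pF => FZ _ _ _ _; have [_ h] := ext_state FZ tok gM.
    by move: hs h => /=; rewrite !mulnS; clear; lia.
  move=> t g tok _ gM; have pF' := pending_next pF tok gM.
  apply: le_trans (pending_deg pF' _).
    by apply: ler_Ex => [|E]; [rewrite q0|apply: ler_bool => /and3P[-> ->]].
  case: pF => FZ _ _ _ _; have [_ h] := ext_state FZ tok gM.
  by move: hs h => /=; rewrite !mulnS; clear; lia.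
apply: ler_wpM2l; first exact: exprn_ge0.
have pw : 0 <= (A0 + D0 s) ^+ size ys by exact: exprn_ge0.
have c0 : 0 <= l%:R :> R by [].
rewrite -/l -natr1 [A0 ^+ l.+1]exprS [(A0 + D0 s) ^+ l]exprS.
move: pw; move: ((A0 + D0 s) ^+ size ys) (A0 ^+ l) => p aL p0.
move: Ag Dg c0; move: A0 (D0 s) (l%:R : R) => a d c a0 d0' c0.
have H : 0 <= c * d * d * p by rewrite !mulr_ge0.
by move: H; nra.
Qed.

End Pending.
Local Lemma card_vset_le (P : sgraph U) : (v P <= b)%N.
Proof. exact: max_card. Qed.

Local Lemma ext_new (Z S : {set V}) (z : V) t (J : {set sgraph U}) g : ext_ok J t ->
  g \in exts Z S z t -> z \in Z ->
  #|g @: vset t.1.1 :\: Z| = (v t.1.1 - 1 - #|t.2|)%N.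
Proof.
move=> /and3P[_ u0P tsub]; rewrite inE => /and5P[/injPP gi /eqP gz _ _ /eqP tE] zZ.
have -> : g @: vset t.1.1 :\: Z = g @: ((vset t.1.1 :\ t.1.2) :\: t.2).
  apply/setP => y; apply/setDP/imsetP => [[/imsetP[u uP ->] gZ]|[u + ->]].
    exists u => //; have uu0 : u != t.1.2 by apply: contraNneq gZ => ->; rewrite gz.
    by rewrite -tE !inE uu0 uP /= (negPf gZ).
  by rewrite -tE !inE => /andP[/nandP[h|h] /andP[h1 h2]];
    [rewrite h1 h2 in h|rewrite imset_f].
rewrite card_in_imset; last first.
  by move=> a c /setDP[/setD1P[_ aP] _] /setDP[/setD1P[_ cP] _]; exact: gi.
by rewrite cardsDS // /v (cardsD1 t.1.2 (vset _)) u0P add1n subn1.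
Qed.

(** Only the new vertices of the dense copy become pending: an old one may lie on exposed edges that
    leave the copy. *)
Local Lemma block_pending F Z S z t g : open_state F Z S z -> ext_ok J2 t ->
  g \in exts Z S z t ->
  pending (g @: vset t.1.1) (F :|: copyE t.1.1 g) (Z :|: g @: vset t.1.1)
    (enum (g @: vset t.1.1 :\: Z)).
Proof.
case=> FZ SZ zS Fz tok gM; split.
- by have [] := ext_state FZ tok gM.
- exact: subsetUr.
- by move=> y; rewrite mem_enum => /setDP[].
- exact: enum_uniq.
move=> y f; rewrite mem_enum => /setDP[yT yZ] /setUP[fF|] yf.
  move: (subsetP FZ f fF); rewrite inE => /andP[/subsetP fZ _].
  by rewrite fZ in yZ.
by move/imsetP: yf => [a /edge_sub[aP _] ->] _; exact: imsetS.
Qed.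

(** A first vertex can be chosen in [W (- b0)] ways and a sparse copy through it has weight
    [eps * W (b0 - x)]; together this gives [W (- x)]. *)
Local Lemma start_sum (A : {set V} -> pred {set {set V}}) B : 0 <= B ->
  (forall F Z S z, open_state F Z S z -> (#|Z| <= b.+1)%N ->
    Ex q ss (fun E => ((F \subset E) && A S E)%:R) <= q ^+ #|F| * B) ->
  Ex q ss (fun E => [exists S : {set V}, typ J1 E S && A S E]%:R) <=
    C * eps * (W (- x) * B).
Proof.
move=> B0 HB.
have start z : open_state set0 [set z] [set z] z.
  by split; rewrite ?sub0set ?set11 // => f; rewrite inE.
have key (z : V) : Ex q ss (fun E => [exists S : {set V}, (z \in S) && (typ J1 E S && A S E)]%:R) <=
    C * (eps * W (b0 - x) * B).
  have [FZ SZ zS Fz] := start z.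
  apply: (@le_trans _ _ (Ex q ss (fun E => \sum_(t | ext_ok J1 t && (t.2 == set0))
     \sum_(g in exts [set z] [set z] z t)
     ((set0 :|: copyE t.1.1 g \subset E) && A (g @: vset t.1.1) E)%:R))).
    apply: ler_Ex => [|E]; first by rewrite q0.
    apply: bool_le_sum => /existsP[S /and3P[zS' tS cS]].
    have SI : S :&: [set z] = [set z] by apply/setIidPr; rewrite sub1set.
    have [t [g tok /and3P[gM gE /eqP gT]]] := typ_ext [set z] tS SI.
    exists t, g; last by rewrite gM set0U gE gT cS.
    rewrite tok /=; move: gM; rewrite inE => /and5P[/injPP gi /eqP gz _ _ /eqP <-].
    rewrite -subset0; apply/subsetP => u; rewrite !inE => /andP[/andP[uu0 uP] /eqP gu].
    case/and3P: tok => _ u0P _.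
    by rewrite (gi u t.1.2) ?eqxx // gu gz in uu0.
  rewrite Ex_sum; apply: sum_ext_le.
    by rewrite mulr_ge0 // mulr_ge0 ?W_ge0 // ltW.
  move=> t /andP[tok t0]; rewrite Ex_sum.
  apply: (@le_trans _ _ (\sum_(g in exts [set z] [set z] z t)
     q ^+ #|set0 :|: copyE t.1.1 g| * B)); last first.
    rewrite -mulr_suml; apply: ler_wpM2r => //.
    by apply: (le_trans (ext1_reg FZ Fz tok t0)); rewrite cards0 expr0 mul1r.
  apply: ler_sum => g gM; have [h1 h3] := ext_state FZ tok gM.
  apply: (HB _ ([set z] :|: g @: vset t.1.1) _ z); last first.
    by rewrite (leq_trans h3) // cards1.
  split=> //; first exact: subsetUr.
    move: gM; rewrite inE => /and5P[_ /eqP gz _ _ _]; rewrite -gz imset_f //.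
    by case/and3P: tok.
  by move=> f; rewrite set0U => /imsetP[a /edge_sub[aP _] ->] _; exact: imsetS.
apply: (@le_trans _ _ (Ex q ss (fun E => \sum_z
   [exists S : {set V}, (z \in S) && (typ J1 E S && A S E)]%:R))).
  apply: ler_Ex => [|E]; first by rewrite q0.
  case: (boolP [exists S, _]) => [|_]; last by apply: sumr_ge0.
  case/existsP=> S /andP[tS AS].
  have /exists_inP[P PJ /existsP[g /and3P[/injPP gi _ /eqP gS]]] := tS.
  have [v2 _ _] := sp1 PJ.
  have /set0Pn[u uP] : vset P != set0 by rewrite -card_gt0 (leq_trans _ v2).
  rewrite (bigD1 (g u)) //= (introT existsP) ?lerDl ?sumr_ge0 //.
  by exists S; rewrite tS AS -gS imset_f.
rewrite Ex_sum; apply: (le_trans (ler_sum _ (fun z _ => key z))).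
rewrite sumr_const -[X in X <= _]mulr_natl Vw -/(W _).
have -> : W (- x) = W (- b0) * W (b0 - x) by rewrite -W_D addKr.
by move: (W _) (W _) => z1 z2; rewrite le_eqVlt; apply/orP; left; apply/eqP; ring.
Qed.

Lemma copy_start :
  Ex q ss (fun E => [exists S : {set V}, typ J1 E S]%:R) <= C * eps * W (- x).
Proof.
have := @start_sum (fun _ _ => true) 1 ler01; rewrite mulr1.
have -> : Ex q ss (fun E => [exists S : {set V}, typ J1 E S && true]%:R) =
          Ex q ss (fun E => [exists S : {set V}, typ J1 E S]%:R).
  by apply: eq_Ex => E; congr (nat_of_bool _)%:R; apply: eq_existsb => S; rewrite andbT.
by apply=> F Z S z [FZ _ _ _] _; rewrite mulr1; exact: Ex_le_sub FZ.
Qed.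

(** A block consists of a dense copy and a sparse copy at each of its new vertices, at most [b.+1]
    copies; it adds at most [m] vertices. *)
Let m := (b * b.+1)%N.
Let K1 := C ^+ b.+1 * 4 ^+ b.

Local Lemma A0D0 s : (0 < s)%N -> D0 s = A0 * s%:R ^+ b * W x /\
  A0 + D0 s <= 2 * A0 * s%:R ^+ b.
Proof.
move=> s0; have Wb : W b0 = W (b0 - x) * W x by rewrite -W_D subrK.
have E : D0 s = A0 * s%:R ^+ b * W x.
  by rewrite /D0 /A0 Wb; move: (s%:R ^+ b) => u; ring.
split=> //; rewrite E.
have sb : 1 <= s%:R ^+ b :> R by rewrite exprn_ege1 // (ler_nat R 1).
have W1 : W x <= 1 by rewrite -(powRr0 w); apply: W_le; exact: ltW.
move: sb; move: (s%:R ^+ b) => u u1.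
have h1 : A0 <= A0 * u by rewrite ler_peMr ?A0_ge0.
have h2 : A0 * u * W x <= A0 * u.
  by rewrite ler_piMr // mulr_ge0 ?A0_ge0 // (le_trans ler01).
by move: h1 h2; lra.
Qed.

(** The exact cancellation behind the critical exponent: the [l] new vertices of a regular dense
    copy against the [l] sparse copies attached there. *)
Local Lemma A0_X l : A0 ^+ l * W ((x - b0) * l%:R) = C ^+ l.
Proof.
rewrite /A0 exprMn W_X -mulrA -W_D.
have -> : (b0 - x) * l%:R + (x - b0) * l%:R = 0 by ring.
by rewrite /W powRr0 mulr1.
Qed.

Local Lemma l_pow l : (l%:R : R) * 2 ^+ l.-1 <= 4 ^+ l.
Proof.
apply: (@le_trans _ _ (2 ^+ l * 2 ^+ l)); last first.
  by rewrite -exprMn; have -> : (2 * 2 : R) = 4 by ring.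
apply: ler_pM; rewrite ?exprn_ge0 //.
  by rewrite -natrX ler_nat ltnW // ltn_expl.
by apply: ler_weXn2l; [rewrite (ler_nat R 1)|exact: leq_pred].
Qed.

(** The power [A0 ^+ l] is extracted, ready to cancel against the dense copy. The overlapping terms
    keep one factor [W x], because [D0 s] is [A0] times [W x] up to a power of [s]. *)
Local Lemma reg_value s l B : (0 < s)%N -> (0 < l <= b)%N -> 0 <= B ->
  A0 ^+ l * B + l%:R * D0 s * (A0 + D0 s) ^+ l.-1 <=
  A0 ^+ l * (4 ^+ b * (B + s%:R ^+ m * W x)).
Proof.
move=> s0 /andP[l0 lb] B0; have [DE AD] := A0D0 s0.
have Ag := A0_ge0; have AD0 : 0 <= A0 + D0 s by rewrite addr_ge0 ?D0_ge0.
set u := s%:R ^+ b : R in DE AD.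
have u1 : 1 <= u by rewrite exprn_ege1 // (ler_nat R 1).
have um : u ^+ l <= s%:R ^+ m.
  rewrite /u /m -exprM; apply: ler_weXn2l; first by rewrite (ler_nat R 1).
  by rewrite leq_mul2l (leq_trans lb) ?orbT.
have h1 : (A0 + D0 s) ^+ l.-1 <= (2 * A0 * u) ^+ l.-1.
  by apply: lerXn2r; rewrite ?nnegrE // (le_trans AD0).
have f1 : 1 <= 4 ^+ b :> R by rewrite exprn_ege1 // (ler_nat R 1).
have f2 : 4 ^+ l <= 4 ^+ b :> R by apply: ler_weXn2l => //; rewrite (ler_nat R 1).
have h2 : l%:R * D0 s * (A0 + D0 s) ^+ l.-1 <= A0 ^+ l * (4 ^+ b * (s%:R ^+ m * W x)).
  apply: (@le_trans _ _ (l%:R * D0 s * (2 * A0 * u) ^+ l.-1)).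
    by apply: ler_wpM2l h1; rewrite mulr_ge0 ?D0_ge0.
  have -> : l%:R * D0 s * (2 * A0 * u) ^+ l.-1 =
            A0 ^+ l * (l%:R * 2 ^+ l.-1 * (u ^+ l * W x)).
    rewrite DE; move: A0 (W x) => a wx; rewrite !exprMn -(prednK l0) !exprS /=.
    move: (l.-1.+1%:R) (2 ^+ _) (a ^+ _) (u ^+ _) => z1 z2 z3 z4; ring.
  apply: ler_wpM2l; first exact: exprn_ge0.
  have u0 := le_trans ler01 u1.
  apply: ler_pM.
  - by rewrite mulr_ge0 // exprn_ge0.
  - by rewrite mulr_ge0 ?W_ge0 // exprn_ge0.
  - exact: le_trans (l_pow l) f2.
  by apply: ler_wpM2r um; exact: W_ge0.
apply: (le_trans (lerD (lexx _) h2)).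
rewrite -mulrDr [4 ^+ b * (B + _)]mulrDr; apply: ler_wpM2l; first exact: exprn_ge0.
by rewrite lerD2r ler_peMl.
Qed.

Local Lemma deg_value s l : (0 < s)%N -> (l <= b)%N ->
  s%:R ^+ b * (A0 + D0 s) ^+ l <= A0 ^+ l * (4 ^+ b * s%:R ^+ m).
Proof.
move=> s0 lb; have [DE AD] := A0D0 s0.
have Ag := A0_ge0; have AD0 : 0 <= A0 + D0 s by rewrite addr_ge0 ?D0_ge0.
set u := s%:R ^+ b : R in DE AD *.
have u1 : 1 <= u by rewrite exprn_ege1 // (ler_nat R 1).
have um : u * u ^+ l <= s%:R ^+ m.
  rewrite -exprS /u /m -exprM; apply: ler_weXn2l; first by rewrite (ler_nat R 1).
  by rewrite leq_mul2l ltnS lb orbT.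
have h1 : (A0 + D0 s) ^+ l <= (2 * A0 * u) ^+ l.
  by apply: lerXn2r; rewrite ?nnegrE // (le_trans AD0).
apply: (@le_trans _ _ (u * (2 * A0 * u) ^+ l)).
  by apply: ler_wpM2l h1; exact: le_trans ler01 u1.
have -> : u * (2 * A0 * u) ^+ l = A0 ^+ l * (2 ^+ l * (u * u ^+ l)).
  move: A0 => a; rewrite !exprMn; move: (2 ^+ l) (a ^+ l) (u ^+ l) => z1 z2 z3; ring.
apply: ler_wpM2l; first exact: exprn_ge0.
have u0 := le_trans ler01 u1.
apply: ler_pM => //.
  by rewrite mulr_ge0 ?exprn_ge0.
apply: (@le_trans _ _ (4 ^+ l)).
  by apply: lerXn2r; rewrite ?nnegrE ?ler0n ?ler_nat.
by apply: ler_weXn2l => //; rewrite (ler_nat R 1).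
Qed.

(** In a block without overlap all powers of [w] cancel and [eps] survives from the dense copy. An
    overlap, of the dense copy or of a sparse one, leaves a factor [W x] and ends the exploration,
    so [B] does not multiply that term. *)
Local Lemma open_block s B : 0 <= B ->
  (forall F Z S z, open_state F Z S z -> (#|Z| <= s)%N ->
    Ex q ss (fun E => ((F \subset E) && in_crit1 J1 J2 S E)%:R) <= q ^+ #|F| * B) ->
  forall F Z S z, open_state F Z S z -> (#|Z| + m <= s)%N ->
    Ex q ss (fun E => ((F \subset E) && in_crit1 J1 J2 S E)%:R) <=
    q ^+ #|F| * (eps * K1 * (B + s%:R ^+ m * W x)).
Proof.
move=> B0 HB F Z S z oS hs; have [FZ SZ zS Fz] := oS.
have zZ : z \in Z by exact: (subsetP SZ).
have Z0 : (0 < #|Z|)%N by rewrite card_gt0; apply/set0Pn; exists z.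
have Zs : (#|Z| <= s)%N by exact: leq_trans (leq_addr _ _) hs.
have s0 : (0 < s)%N by exact: leq_trans Zs.
have qF : 0 <= q ^+ #|F| by exact: exprn_ge0.
apply: (@le_trans _ _ (Ex q ss (fun E => \sum_(t | ext_ok J2 t) \sum_(g in exts Z S z t)
   ((F :|: copyE t.1.1 g \subset E) && in_crit2 J1 J2 (g @: vset t.1.1) E)%:R))).
  apply: ler_Ex => [|E]; first by rewrite q0.
  apply: bool_le_sum => /andP[FE SE].
  have [T [T1 T2 T3]] := crit1_next SE zS.
  have [t [g tok /and3P[gM gE /eqP gT]]] := typ_ext Z T1 T2.
  by exists t, g => //; rewrite gM subUset FE gE gT T3.
have sm : 0 <= s%:R ^+ m * W x by rewrite mulr_ge0 ?W_ge0 // exprn_ge0.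
have f1 : 0 <= 4 ^+ b :> R by exact: exprn_ge0.
have CX l : (l <= b)%N -> C ^+ l <= C ^+ b.
  by move=> lb; apply: ler_weXn2l => //; exact: C_ge1.
have Cb0 : 0 <= C ^+ b by rewrite exprn_ge0 // C_ge0.
have X0 : 0 <= eps * C ^+ b * (4 ^+ b * (B + s%:R ^+ m * W x)).
  by apply: mulr_ge0; [apply: mulr_ge0 => //; exact: ltW|
     apply: mulr_ge0 => //; exact: addr_ge0].
have -> : q ^+ #|F| * (eps * K1 * (B + s%:R ^+ m * W x)) =
    C * (q ^+ #|F| * (eps * C ^+ b * (4 ^+ b * (B + s%:R ^+ m * W x)))).
  rewrite /K1 [C ^+ b.+1]exprS; move: (C ^+ b) (4 ^+ b) (q ^+ _) (s%:R ^+ m) => z1 z2 z3 z4.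
  by ring.
rewrite Ex_sum; apply: sum_ext_le; first exact: mulr_ge0.
move=> t tok; rewrite Ex_sum.
have [vt2 _] := de2 (let: And3 h _ _ := and3P tok in h).
set l := (v t.1.1 - 1 - #|t.2|)%N.
have lb : (l <= b)%N.
  by rewrite (leq_trans (leq_subr _ _)) // (leq_trans (leq_subr _ _)) // card_vset_le.
have lbm : (b + b * l <= m)%N by rewrite /m mulnS leq_add2l leq_mul2l lb orbT.
have gsize g : g \in exts Z S z t -> size (enum (g @: vset t.1.1 :\: Z)) = l.
  by move=> gM; rewrite -cardE (ext_new tok gM zZ).
have gZ g : g \in exts Z S z t -> (#|Z :|: g @: vset t.1.1| + b * l <= s)%N.
  move=> gM; have [_ h] := ext_state FZ tok gM.
  by move: h hs lbm; clear; move: #|_| (b * l)%N => *; lia.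
case: (boolP (t.2 == set0)) => t0.
  have tc : #|t.2| = 0%N by rewrite (eqP t0) cards0.
  have lE : l = (v t.1.1 - 1)%N by rewrite /l tc subn0.
  have l0 : (0 < l)%N by rewrite lE subn_gt0.
  apply: (@le_trans _ _ (\sum_(g in exts Z S z t) q ^+ #|F :|: copyE t.1.1 g| *
     (A0 ^+ l * B + l%:R * D0 s * (A0 + D0 s) ^+ l.-1))).
    apply: ler_sum => g gM; have := block_pending oS tok gM.
    have := gsize g gM; case E : (enum _) => [|y ys]; first by move=> h; rewrite -h in l0.
    move=> /= El pd.
    have := pending_reg B0 HB pd; rewrite El => /(_ (gZ g gM)).
    by rewrite -El.
  rewrite -mulr_suml; apply: (@le_trans _ _ (q ^+ #|F| * (eps * W ((x - b0) * l%:R)) *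
     (A0 ^+ l * (4 ^+ b * (B + s%:R ^+ m * W x))))).
    apply: ler_pM.
    - by apply: sumr_ge0 => g _; exact: exprn_ge0.
    - apply: addr_ge0; first by rewrite mulr_ge0 ?exprn_ge0 ?A0_ge0.
      by rewrite mulr_ge0 ?exprn_ge0 ?addr_ge0 ?A0_ge0 ?D0_ge0 // mulr_ge0 ?D0_ge0.
    - by have := ext2_reg FZ Fz tok t0; rewrite -lE.
    by apply: reg_value => //; rewrite l0.
  rewrite -mulrA; apply: ler_wpM2l => //.
  have -> : eps * W ((x - b0) * l%:R) * (A0 ^+ l * (4 ^+ b * (B + s%:R ^+ m * W x))) =
     eps * C ^+ l * (4 ^+ b * (B + s%:R ^+ m * W x)).
    rewrite -(A0_X l); move: (4 ^+ b) (A0 ^+ l) (W (_ * _)) (s%:R ^+ m) => z1 z2 z3 z4; ring.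
  apply: ler_wpM2r; first by apply: mulr_ge0 => //; exact: addr_ge0.
  by apply: ler_wpM2l; [exact: ltW|exact: CX].
apply: (@le_trans _ _ (\sum_(g in exts Z S z t) q ^+ #|F :|: copyE t.1.1 g| *
     (A0 + D0 s) ^+ l)).
  apply: ler_sum => g gM; have := block_pending oS tok gM => pd.
  by have := pending_deg pd; rewrite gsize // => /(_ _ (gZ g gM)).
have ADl : 0 <= (A0 + D0 s) ^+ l by rewrite exprn_ge0 ?addr_ge0 ?A0_ge0 ?D0_ge0.
rewrite -mulr_suml; apply: (@le_trans _ _ (q ^+ #|F| * (s%:R ^+ b *
   (eps * W ((x - b0) * l%:R + x))) * (A0 + D0 s) ^+ l)).
  apply: ler_wpM2r => //; apply: (le_trans (ext2_deg FZ SZ zS Fz tok t0)).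
  apply: ler_wpM2l => //; apply: ler_wpM2r.
    by rewrite mulr_ge0 ?W_ge0 // ltW.
  by apply: lerXn2r; rewrite ?nnegrE ?ler0n ?ler_nat.
rewrite -mulrA; apply: ler_wpM2l => //.
have -> : s%:R ^+ b * (eps * W ((x - b0) * l%:R + x)) * (A0 + D0 s) ^+ l =
   (eps * W ((x - b0) * l%:R + x)) * (s%:R ^+ b * (A0 + D0 s) ^+ l).
  by move: (_ ^+ l) (s%:R ^+ b) (W _) => z1 z2 z3; ring.
apply: (@le_trans _ _ (eps * W ((x - b0) * l%:R + x) * (A0 ^+ l * (4 ^+ b * s%:R ^+ m)))).
  by apply: ler_wpM2l; [rewrite mulr_ge0 ?W_ge0 // ltW|exact: deg_value].
have -> : eps * W ((x - b0) * l%:R + x) * (A0 ^+ l * (4 ^+ b * s%:R ^+ m)) =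
   eps * C ^+ l * (4 ^+ b * (s%:R ^+ m * W x)).
  rewrite W_D -(A0_X l); move: (4 ^+ b) (A0 ^+ l) (W (_ * _)) (W x) (s%:R ^+ m) => z1 z2 z3 z4 z5.
  by ring.
apply: ler_pM.
- by rewrite mulr_ge0 ?exprn_ge0 ?C_ge0 // ltW.
- exact: mulr_ge0.
- by apply: ler_wpM2l; [exact: ltW|exact: CX].
by apply: ler_wpM2l => //; rewrite lerDr.
Qed.

Hypothesis heps : eps * K1 * (2 * 2 ^+ (m * m)) <= 1.

(* [T] is the number of blocks explored before stopping. Each regular block gains
   a factor [1/2]; an irregular one gains [W x] once, and the exploration stops. *)
Local Lemma open_bound T s F Z S z : open_state F Z S z -> (#|Z| <= s)%N ->
  Ex q ss (fun E => ((F \subset E) && in_crit1 J1 J2 S E)%:R) <=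
  q ^+ #|F| * (2^-1 ^+ T + 2 ^+ (m * s) * W x).
Proof.
have h2 (n : nat) : 1 <= 2 ^+ n :> R by rewrite exprn_ege1 // (ler_nat R 1).
elim: T s F Z S z => [|T IH] s F Z S z oS Zs.
  have [FZ _ _ _] := oS; apply: (le_trans (Ex_le_sub _ FZ)).
  by rewrite ler_peMr ?exprn_ge0 // expr0 lerDl mulr_ge0 ?W_ge0 //.
have hi : 0 <= 2^-1 ^+ T :> R by rewrite exprn_ge0 // invr_ge0.
have B0 : 0 <= 2^-1 ^+ T + 2 ^+ (m * (s + m)) * W x.
  by rewrite addr_ge0 // mulr_ge0 ?W_ge0 //; exact: le_trans ler01 (h2 _).
have hs : (#|Z| + m <= s + m)%N by rewrite leq_add2r.
apply: (le_trans (open_block B0 (IH (s + m)%N) oS hs)).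
apply: ler_wpM2l; first exact: exprn_ge0.
have sm : (s + m)%:R ^+ m <= 2 ^+ (m * (s + m)) :> R.
  rewrite mulnC exprM; apply: lerXn2r; rewrite ?nnegrE //.
  by rewrite -natrX ler_nat ltnW // ltn_expl.
have K0 : 0 <= eps * K1.
  by rewrite /K1 mulr_ge0 //; [exact: ltW|rewrite mulr_ge0 ?exprn_ge0 ?C_ge0].
apply: (@le_trans _ _ (eps * K1 * (2^-1 ^+ T + 2 * 2 ^+ (m * (s + m)) * W x))).
  apply: ler_wpM2l => //; have := ler_wpM2r (W_ge0 x) sm.
  by move: (_ ^+ m) (2 ^+ _) => z1 z2; lra.
(* A block enlarges the bound on the explored set from [s] to [s + m]; the resulting factor
   [2 ^+ (m * m)] is what [heps] absorbs. *)
have -> : 2 ^+ (m * (s + m)) = 2 ^+ (m * m) * 2 ^+ (m * s) :> R by rewrite mulnDr exprD mulrC.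
rewrite exprS mulrDr; have := h2 (m * m)%N; have := h2 (m * s)%N; move: heps K0 hi (W_ge0 x).
move: (2 ^+ (m * m)) (2 ^+ (m * s)) (eps * K1) (2^-1 ^+ T) (W x) => a c k t w' h k0 t0 w0' c1 a1.
apply: lerD.
  by apply: ler_wpM2r => //; nra.
have : k * (2 * a) * (c * w') <= 1 * (c * w').
  by apply: ler_wpM2r h; rewrite mulr_ge0 // (le_trans ler01).
by lra.
Qed.

Lemma crit_start : Ex q ss (fun E => (has_crit J1 J2 E)%:R) <=
  C * eps * (1 + 2 ^+ (m * b.+1)).
Proof.
have h2 (n : nat) : 1 <= 2 ^+ n :> R by rewrite exprn_ege1 // (ler_nat R 1).
have Wp := W_gt0 (- x).
(* So many blocks that their gain outweighs the factor [W (- x)] for the starting copy. *)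
have [T hT] : exists T : nat, W (- x) * 2^-1 ^+ T <= 1.
  exists (Num.Def.archi_bound (W (- x))).
  rewrite exprVn ler_pdivrMr ?exprn_gt0 // mul1r.
  apply: (le_trans (ltW (archi_boundP (W_ge0 _)))).
  by rewrite -natrX ler_nat ltnW // ltn_expl.
set B := 2^-1 ^+ T + 2 ^+ (m * b.+1) * W x.
have B0 : 0 <= B.
  by rewrite addr_ge0 ?exprn_ge0 ?invr_ge0 // mulr_ge0 ?W_ge0 //; exact: le_trans ler01 (h2 _).
apply: (@le_trans _ _ (Ex q ss (fun E =>
  [exists S : {set V}, typ J1 E S && in_crit1 J1 J2 S E]%:R))).
  apply: ler_Ex => [|E]; first by rewrite q0.
  apply: ler_bool => /existsP[A /andP[cA /set0Pn[S SA]]].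
  have /and4P[/forall_inP/(_ _ SA) tS _ _ _] := cA.
  by apply/existsP; exists S; rewrite tS; apply/existsP; exists A; rewrite cA.
apply: (le_trans (start_sum B0 _)) => [F Z S z oS Zs|]; first exact: open_bound oS Zs.
apply: ler_wpM2l; first by rewrite mulr_ge0 ?C_ge0 // ltW.
rewrite /B mulrDr; apply: lerD => //.
have -> : W (- x) * (2 ^+ (m * b.+1) * W x) = 2 ^+ (m * b.+1) * W (- x + x).
  by rewrite W_D; move: (2 ^+ _) (W x) (W _) => z1 z2 z3; ring.
by rewrite addNr /W powRr0 mulr1.
Qed.

End Exploration.

(** * Two-colourings of one class *)

Section Colouring.
Variables (U V : finType).
Implicit Types (A : {set {set V}} * {set {set V}}).

Definition proper A (c : {ffun V -> bool}) : bool :=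
  [forall S in A.1, [exists z in S, ~~ c z]] &&
  [forall T in A.2, [exists z in T, c z]].

Definition colourable A : bool := [exists c, proper A c].

Lemma colourable_swap A : colourable (A.2, A.1) = colourable A.
Proof.
suff H B : colourable B -> colourable (B.2, B.1).
  by apply/idP/idP => /H //; case: A.
case/existsP=> c /andP[/forall_inP h1 /forall_inP h2]; apply/existsP.
exists [ffun z => ~~ c z]; apply/andP; split; apply/forall_inP => S SA /=.
  have /exists_inP[z zS cz] := h2 _ SA; apply/exists_inP; exists z => //.
  by rewrite ffunE cz.
have /exists_inP[z zS cz] := h1 _ SA; apply/exists_inP; exists z => //.
by rewrite ffunE cz.
Qed.

(* In a proper colouring of [A] without [S] all of [S] is [true]; recolouring
   [z] must spoil some [T], which then meets [S] in [z] only. *)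
Lemma uncolourable_link A S z : ~~ colourable A ->
  colourable (A.1 :\ S, A.2) -> S \in A.1 -> z \in S ->
  [exists T in A.2, S :&: T == [set z]].
Proof.
move=> nA /existsP[c /andP[/= /forall_inP h1 /forall_inP h2]] SA zS.
have cS y : y \in S -> c y.
  move=> yS; apply: contraT => cy; case/negP: nA; apply/existsP; exists c.
  apply/andP; split; last exact/forall_inP.
  apply/forall_inP => S' S'A; case: (eqVneq S' S) => [->|S'S].
    by apply/exists_inP; exists y.
  by apply: h1; rewrite !inE S'S.
pose c' : {ffun V -> bool} := [ffun y => c y && (y != z)].
apply: contraT => /exists_inPn H; case/negP: nA; apply/existsP; exists c'.
apply/andP; split; apply/forall_inP => T TA.
  case: (eqVneq T S) => [->|TS].
    by apply/exists_inP; exists z; rewrite // ffunE eqxx andbF.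
  have /exists_inP[y yT cy] : [exists y in T, ~~ c y] by apply: h1; rewrite !inE TS.
  by apply/exists_inP; exists y; rewrite // ffunE (negPf cy).
apply: contraT => /exists_inPn H'; have := H _ TA.
have /exists_inP[y yT cy] := h2 _ TA.
have yz : y = z by have := H' _ yT; rewrite ffunE cy /= negbK => /eqP.
case/eqP; apply/setP => u; rewrite !inE; apply/andP/eqP => [[uS uT]|->].
  by have := H' _ uT; rewrite ffunE cS //= negbK => /eqP.
by rewrite zS -yz yT.
Qed.

Variables J1 J2 : {set sgraph U}.

Definition splits (E : {set {set V}}) : bool :=
  colourable ([set S | typ J1 E S], [set T | typ J2 E T]).

Lemma splitsP E : reflect (exists c : {ffun V -> bool},
   (forall S, typ J1 E S -> exists2 z, z \in S & ~~ c z) /\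
   (forall T, typ J2 E T -> exists2 z, z \in T & c z)) (splits E).
Proof.
apply: (iffP existsP) => [[c /andP[/forall_inP h1 /forall_inP h2]]|[c [h1 h2]]];
  exists c.
  by split=> S tS; [apply/exists_inP/h1|apply/exists_inP/h2]; rewrite inE.
by apply/andP; split; apply/forall_inP => S; rewrite inE => tS;
  [apply/exists_inP/h1|apply/exists_inP/h2].
Qed.

(** An uncolourable system of least size is critical by [uncolourable_link], applied on both sides.
    It has a copy of the first type, since otherwise the constant colouring [true] is proper. *)
Lemma nsplits_crit E : (forall P, P \in J2 -> (0 < v P)%N) ->
  ~~ splits E -> has_crit J1 J2 E.
Proof.
move=> v2 nE; set A0 := ([set S | typ J1 E S], [set T | typ J2 E T]).
pose ok A := [&& A.1 \subset A0.1, A.2 \subset A0.2 & ~~ colourable A].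
have ok0 : ok A0 by rewrite /ok !subxx.
case: (arg_minnP (fun A => (#|A.1| + #|A.2|)%N) ok0) => -[A1 A2] /and3P[/= s1 s2 nA] minA.
have n1 S : S \in A1 -> colourable (A1 :\ S, A2).
  move=> SA; apply: contraT => nc.
  have /minA : ok (A1 :\ S, A2).
    by rewrite /ok /= nc s2 (subset_trans (subsetDl _ _) s1).
  by rewrite /= (cardsD1 S A1) SA; clear; move: #|_| => x; lia.
have n2 S : S \in A2 -> colourable (A2 :\ S, A1).
  move=> SA; rewrite (colourable_swap (A1, A2 :\ S)); apply: contraT => nc.
  have /minA : ok (A1, A2 :\ S).
    by rewrite /ok /= nc s1 (subset_trans (subsetDl _ _) s2).
  by rewrite /= (cardsD1 S A2) SA; clear; move: #|A1| #|_ :\ _| => x y; lia.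
apply/existsP; exists (A1, A2); apply/andP; split; last first.
  apply: contraNneq nA => /= A10; apply/existsP; exists [ffun => true].
  apply/andP; split; apply/forall_inP => S /=; first by rewrite A10 inE.
  move=> SA; have := subsetP s2 _ SA; rewrite inE => /exists_inP[P PJ].
  case/existsP=> g /and3P[_ _ /eqP <-].
  have /set0Pn[u uP] : vset P != set0 by rewrite -card_gt0; exact: v2.
  by apply/exists_inP; exists (g u); rewrite ?imset_f // ffunE.
apply/and4P; split=> /=.
- by apply/forall_inP => S /(subsetP s1); rewrite inE.
- by apply/forall_inP => S /(subsetP s2); rewrite inE.
- apply/forall_inP => S SA; apply/forall_inP => z zS.
  exact: (@uncolourable_link (A1, A2) S z nA (n1 _ SA)).
apply/forall_inP => S SA; apply/forall_inP => z zS.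
apply: (@uncolourable_link (A2, A1) S z _ (n2 _ SA)) => //.
by rewrite (colourable_swap (A1, A2)).
Qed.

End Colouring.

Lemma zero_core (R : realType) (U : finType) (J1 J2 : {set sgraph U}) (b0 x : R) :
  0 < b0 -> 0 <= x <= b0 ->
  (forall P, P \in J1 -> sparse1 b0 x P) ->
  (0 < x -> forall P, P \in J2 -> dense2 x P) ->
  (forall P, P \in J2 -> (0 < v P)%N) ->
  exists K eps0 : R, [/\ 0 < K, 0 < eps0 & forall (V : finType) (eps q : R),
    (0 < #|V|)%N -> 0 < eps <= eps0 -> 0 <= q <= 1 ->
    q <= eps * #|V|%:R `^ (- b0^-1) ->
    Ex q (enum (pairs [set: V])) (fun E => (~~ splits J1 J2 E)%:R) <= K * eps].
Proof.
move=> b0g /andP[x0 xb] sp1 de2 vJ2.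
set C : R := #|{: ext_index U}|%:R + 1; set b := #|U|.
set m := (b * b.+1)%N; set K1 := C ^+ b.+1 * 4 ^+ b.
have C1 : 1 <= C by rewrite lerDr.
have h2 (n : nat) : 1 <= 2 ^+ n :> R by rewrite exprn_ege1 // (ler_nat R 1).
have K10 : 1 <= K1 by rewrite mulr_ege1 ?exprn_ege1 // (ler_nat R 1).
have D1 : 1 <= K1 * (2 * 2 ^+ (m * m)).
  by rewrite mulr_ege1 // mulr_ege1 // (ler_nat R 1).
exists (C * (1 + 2 ^+ (m * b.+1))), (K1 * (2 * 2 ^+ (m * m)))^-1.
have Dp : 0 < K1 * (2 * 2 ^+ (m * m)) by exact: lt_le_trans D1.
split.
- rewrite mulr_gt0 ?(lt_le_trans ltr01 C1) // ltr_pwDl //.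
- by rewrite invr_gt0.
move=> V eps q V0 /andP[e0 ee] /andP[q0 q1] qe.
have eps1 : eps <= 1 by apply: (le_trans ee); rewrite invf_le1.
set w : R := #|V|%:R `^ (- b0^-1) in qe.
have Vg : 0 < #|V|%:R :> R by rewrite ltr0n.
have w0 : 0 < w by exact: powR_gt0.
have V1 : 1 <= #|V|%:R :> R by rewrite (ler_nat R 1).
have w1 : w <= 1.
  have neg : - b0^-1 <= 0 :> R by rewrite oppr_le0 invr_ge0 ltW.
  by have := ler_powR V1 neg; rewrite powRr0.
have Vw : #|V|%:R = w `^ (- b0).
  by rewrite /w -powRrM mulrNN mulVf ?gt_eqF // powRr1 // ltW.
have -> : C * (1 + 2 ^+ (m * b.+1)) * eps = C * eps * (1 + 2 ^+ (m * b.+1)).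
  by move: (2 ^+ _) => z; ring.
(* For [x = 0] the factor [W (- x)] is 1, so that with high probability there is no sparse copy at
   all and [true] is a proper colouring. *)
case: (ltgtP 0 x) x0 => // [xg _|xE _].
  apply: (@le_trans _ _ (Ex q (enum (pairs [set: V])) (fun E => (has_crit J1 J2 E)%:R))).
    by apply: ler_Ex => [|E]; [rewrite q0|apply: ler_bool; exact: nsplits_crit].
  apply: (crit_start (x := x) (b0 := b0) (w := w)) => //; first exact: de2.
  rewrite -/b -/C -/m -/K1 -mulrA; apply: (le_trans (ler_wpM2r (ltW Dp) ee)).
  by rewrite mulVf // gt_eqF.
apply: (@le_trans _ _ (Ex q (enum (pairs [set: V])) (fun E => [exists S, typ J1 E S]%:R))).
  apply: ler_Ex => [|E]; first by rewrite q0.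
  apply: ler_bool => /(nsplits_crit vJ2)/existsP[A /andP[cA /set0Pn[S SA]]].
  have /and4P[/forall_inP/(_ _ SA) tS _ _ _] := cA.
  by apply/existsP; exists S.
apply: (le_trans (copy_start J2 b0g xb sp1 w0 w1 Vw e0 eps1 q0 q1 qe)).
rewrite -xE /= oppr0 powRr0 mulr1 -/C ler_peMr //.
  by rewrite mulr_ge0 ?(ltW e0) // (le_trans ler01).
by rewrite lerDl; exact: le_trans ler01 (h2 _).
Qed.

(** * Moon-Moser inequalities *)

Lemma cauchy_card (R : realFieldType) (I : finType) (A : {set I}) (a : I -> R) :
  (\sum_(i in A) a i) ^+ 2 <= #|A|%:R * \sum_(i in A) a i ^+ 2.
Proof.
set S := \sum_(i in A) a i; set N : R := #|A|%:R.
case: (posnP #|A|) => [A0|A0].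
  by rewrite /S /N A0 mul0r; move/eqP: A0; rewrite cards_eq0 => /eqP->; rewrite big_set0 expr0n.
have N0 : 0 < N by rewrite ltr0n.
have : 0 <= \sum_(i in A) (a i * N - S) ^+ 2 by apply: sumr_ge0 => i _; exact: sqr_ge0.
have -> : \sum_(i in A) (a i * N - S) ^+ 2 = N * (N * \sum_(i in A) a i ^+ 2 - S ^+ 2).
  transitivity (\sum_(i in A) (N ^+ 2 * a i ^+ 2 - 2 * N * S * a i + S ^+ 2)).
    by apply: eq_bigr => i _; ring.
  have ES : \sum_(i in A) S ^+ 2 = N * S ^+ 2 by rewrite sumr_const -[LHS]mulr_natl.
  rewrite big_split /= ES sumrB -!big_distrr /= -/S.
  by ring.
by rewrite pmulr_rge0 // subr_ge0.
Qed.

Section Cliques.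
Variables (T : finType) (G : sgraph T).

Definition adj (x y : T) : bool := [set x; y] \in eset G.

Lemma adjC x y : adj x y = adj y x.
Proof. by rewrite /adj setUC. Qed.

Lemma adj_neq x y : adj x y -> x != y.
Proof.
move=> /(subsetP (eset_pairs G)); rewrite inE => /andP[_].
by rewrite cards2; case: (x != y).
Qed.

Definition clique (A : {set T}) : bool :=
  (A \subset vset G) &&
  [forall x in A, forall y in A, (x != y) ==> adj x y].

Definition cliques s : {set {set T}} := [set A | clique A & #|A| == s].

Definition nbs (B : {set T}) : {set T} :=
  [set a in vset G | (a \notin B) && [forall b in B, adj a b]].

Lemma cliqueP (A : {set T}) : reflect (A \subset vset G /\
  forall x y, x \in A -> y \in A -> x != y -> adj x y) (clique A).
Proof.
apply: (iffP andP) => -[h1 h2]; split=> //.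
  by move=> x y xA yA; have /forall_inP/(_ _ xA)/forall_inP/(_ _ yA)/implyP := h2.
by apply/forall_inP => x xA; apply/forall_inP => y yA; apply/implyP; exact: h2.
Qed.

Lemma nbsP (B : {set T}) a : reflect [/\ a \in vset G, a \notin B &
  forall b, b \in B -> adj a b] (a \in nbs B).
Proof. by rewrite inE; apply: (iffP and3P) => -[? ? /forall_inP]. Qed.

(** Double counting of a clique with a distinguished vertex: [A] is [a |: B]. *)
Lemma clique_sum (R : realFieldType) s (f : {set T} -> R) :
  \sum_(B in cliques s) \sum_(a in nbs B) f B =
  \sum_(A in cliques s.+1) \sum_(a in A) f (A :\ a).
Proof.
rewrite !pair_big_dep /=.
rewrite (reindex_onto (fun p : {set T} * T => (p.1 :\ p.2, p.2))
                      (fun p => (p.2 |: p.1, p.2))) /=; last first.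
  move=> [B a] /= /andP[_ /nbsP[_ aB _]]; congr (_, _).
  by rewrite setU1K.
apply: eq_bigl => -[A a] /=; rewrite !inE eqxx /= xpair_eqE eqxx andbT.
apply/idP/idP.
  move=> /andP[/andP[/andP[/cliqueP[AV cA] /eqP As] /andP[aV /forall_inP aA]] /eqP AE].
  have aA' : a \in A by rewrite -AE setU11.
  rewrite aA' andbT (cardsD1 a) aA' As eqxx andbT; apply/cliqueP; split.
    by rewrite -AE subUset sub1set aV AV.
  move=> x y xA yA xy; case: (eqVneq x a) => [xa|xa].
    rewrite xa in xy *.
    by apply: aA; rewrite !inE yA andbT; apply: contraNneq xy => ->.
  case: (eqVneq y a) => [->|ya]; first by rewrite adjC; apply: aA; rewrite !inE xa.
  by apply: cA; rewrite ?inE ?xa ?ya.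
move=> /andP[/andP[/cliqueP[AV cA] /eqP As] aA]; rewrite setD1K // eqxx andbT.
apply/andP; split; apply/andP; split.
- apply/cliqueP; split; first exact: subset_trans (subsetDl _ _) AV.
  by move=> x y /setD1P[_ xA] /setD1P[_ yA]; exact: cA.
- by move: As; rewrite (cardsD1 a) aA add1n => -[->].
- exact: (subsetP AV).
by apply/forall_inP => b /setD1P[ba bA]; apply: cA; rewrite // eq_sym.
Qed.

Lemma sum_nbs (R : realFieldType) s :
  \sum_(B in cliques s) #|nbs B|%:R = s.+1%:R * #|cliques s.+1|%:R :> R.
Proof.
transitivity (\sum_(B in cliques s) \sum_(a in nbs B) (1 : R)).
  by apply: eq_bigr => B _; rewrite sumr_const.
rewrite (clique_sum s (fun=> 1 : R)) mulr_natr -sumr_const; apply: eq_bigr => A.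
by rewrite inE sumr_const => /andP[_ /eqP->].
Qed.

(** A vertex that is a common neighbour of [A :\ a] for two different [a] is adjacent to all of [A].
    So a vertex outside [nbs A] is counted at most once, and one in [nbs A] is counted [s.+1]
    times. *)
Lemma nbs_del (A : {set T}) s : A \in cliques s.+1 ->
  (\sum_(a in A) #|nbs (A :\ a)| <= s * #|nbs A| + v G)%N.
Proof.
rewrite inE => /andP[_ /eqP As].
have -> : (\sum_(a in A) #|nbs (A :\ a)| =
  \sum_(x in vset G) \sum_(a in A) (x \in nbs (A :\ a)))%N.
  rewrite exchange_big /=; apply: eq_bigr => a _.
  rewrite -sum1_card [LHS]big_mkcond [RHS]big_mkcond; apply: eq_bigr => x _.
  by case: (boolP (x \in nbs (A :\ a))) => [/nbsP[-> _ _] //|_]; case: ifP.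
have -> : (s * #|nbs A| + v G = \sum_(x in vset G) (s * (x \in nbs A) + 1))%N.
  rewrite big_split /= sum1_card; congr (_ + _)%N.
  rewrite -big_distrr /=; congr (_ * _)%N.
  rewrite -sum1_card [LHS]big_mkcond [RHS]big_mkcond; apply: eq_bigr => x _.
  by case: (boolP (x \in nbs A)) => [/nbsP[-> _ _] //|_]; case: ifP.
apply: leq_sum => x xV; case: (boolP (x \in nbs A)) => xA.
  rewrite muln1 addn1 -As -sum1_card; apply: leq_sum => a _; exact: leq_b1.
rewrite muln0 add0n.
case: (boolP [exists a in A, x \in nbs (A :\ a)]) => [/exists_inP[a aA xa]|/exists_inPn h]; last first.
  by rewrite big1 // => a aA; rewrite (negPf (h _ aA)).
rewrite (bigD1 a) //= big1 ?addn0 ?leq_b1 // => a' /andP[a'A aa'].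
apply/eqP; rewrite eqb0; apply: contra xA => xa'.
have /nbsP[_ x1 x2] := xa; have /nbsP[_ y1 y2] := xa'.
have h b : b \in A -> (b \in A :\ a) || (b \in A :\ a').
  by move=> bA; rewrite !inE bA !andbT; case: (eqVneq b a) => //= ->; rewrite eq_sym.
apply/nbsP; split=> //.
  by apply/negP => /h /orP[]; apply/negP.
by move=> b /h /orP[/x2|/y2].
Qed.

(** Cauchy-Schwarz for the degrees [#|nbs B|]; the sum of their squares becomes a sum over larger
    cliques, where [nbs_del] applies. *)
Lemma moon_moser (R : realFieldType) s :
  (s.+1%:R * #|cliques s.+1|%:R) ^+ 2 <=
  #|cliques s|%:R * (s%:R * (s.+2%:R * #|cliques s.+2|%:R)
                     + (v G)%:R * #|cliques s.+1|%:R) :> R.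
Proof.
rewrite -sum_nbs; apply: (le_trans (cauchy_card _ _)); apply: ler_wpM2l => //.
have -> : \sum_(B in cliques s) #|nbs B|%:R ^+ 2 =
          \sum_(B in cliques s) \sum_(a in nbs B) #|nbs B|%:R :> R.
  by apply: eq_bigr => B _; rewrite sumr_const expr2 -[RHS]mulr_natl.
rewrite (clique_sum s (fun B => #|nbs B|%:R)) -sum_nbs big_distrr /=.
rewrite mulr_natr -sumr_const -big_split /=; apply: ler_sum => A AK.
by rewrite -natr_sum -natrM -natrD ler_nat; exact: nbs_del.
Qed.

Lemma cliques0 : #|cliques 0| = 1%N.
Proof.
apply/eqP/cards1P; exists set0; apply/setP => A; rewrite !inE cards_eq0.
case: eqVneq => [->|]; rewrite ?andbF // andbT; apply/cliqueP.
by rewrite sub0set; split=> // x y; rewrite inE.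
Qed.

Lemma cliques1 : #|cliques 1| = v G.
Proof.
rewrite /v -(card_imset (mem (vset G)) (@set1_inj T)); apply: eq_card => A.
rewrite inE; apply/andP/imsetP => [[/cliqueP[AV _] /cards1P[x Ax]]|[x xV ->]].
  by exists x => //; move: AV; rewrite Ax sub1set.
split; last by rewrite cards1.
apply/cliqueP; rewrite sub1set; split=> // y z /set1P-> /set1P->.
by rewrite eqxx.
Qed.

Lemma cliques2 : #|cliques 2| = e G.
Proof.
apply: eq_card => A; rewrite inE; apply/andP/idP => [[/cliqueP[AV cA] /cards2P[x [y [xy AE]]]]|AE].
  by have := cA x y; rewrite AE !inE !eqxx orbT /= => /(_ isT isT xy).
have := subsetP (eset_pairs G) _ AE; rewrite inE => /andP[AV A2]; split=> //.
apply/cliqueP; split=> // x y xA yA xy.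
have /cards2P[a [b [ab E]]] := A2; move: xA yA xy AE; rewrite /adj E !inE.
by case/orP=> /eqP-> /orP[]/eqP->; rewrite ?eqxx // => _; rewrite setUC.
Qed.

(** Moon-Moser propagates the bound h(s+1) >= (1 - s (1 - delta)) v(G) h(s) for the numbers [h s] of
    ordered cliques from one [s] to the next. Below [k] the coefficient is at least [kappa], and its
    positivity is what permits the division by [h s]. *)
Lemma clique_growth (R : realFieldType) (delta : R) k (kappa : R) :
  (0 < v G)%N -> delta <= 1 -> 0 < kappa -> (2 <= k)%N ->
  kappa <= 1 - (k%:R - 1) * (1 - delta) ->
  delta * (v G)%:R ^+ 2 <= 2 * (e G)%:R ->
  forall s, (s < k)%N -> kappa * (v G)%:R * (s`! * #|cliques s|)%:R <=
    ((s.+1)`! * #|cliques s.+1|)%:R :> R.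
Proof.
move=> v0 d1 k0 k2 hk he; set n : R := (v G)%:R.
have n0 : 0 < n by rewrite ltr0n.
set h := fun s => (s`! * #|cliques s|)%:R : R.
have mm s : s.+1%:R * h s.+1 ^+ 2 <= h s * (s%:R * h s.+2 + n * h s.+1).
  have := moon_moser R s; rewrite /h !factS !natrM -/n.
  move: (ltr0n R s`!) (ltr0Sn R s); rewrite fact_gt0.
  move: (s`!%:R) #|cliques s|%:R #|cliques s.+1|%:R #|cliques s.+2|%:R => f a b c f0 s0 H.
  have -> : s.+1%:R * (s.+1%:R * f * b) ^+ 2 = (s.+1%:R * f ^+ 2) * (s.+1%:R * b) ^+ 2 by ring.
  have -> : f * a * (s%:R * (s.+2%:R * (s.+1%:R * f) * c) + n * (s.+1%:R * f * b)) =
    (s.+1%:R * f ^+ 2) * (a * (s%:R * (s.+2%:R * c) + n * b)) by ring.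
  by rewrite ler_pM2l // mulr_gt0 // exprn_gt0.
have main s : (s.+1 < k)%N ->
    (1 - s.+1%:R * (1 - delta)) * n * h s.+1 <= h s.+2 /\ 0 < h s.+1.
  elim: s => [|s IH] sk.
    rewrite /h cliques1 cliques2 -/n !mul1n -/n; split=> //.
    have -> : (1 - 1%:R * (1 - delta)) * n * n = delta * n ^+ 2 by ring.
    by rewrite natrM.
  have [H1 H2] := IH (ltnW sk).
  have cs (j : nat) : (j < k)%N -> kappa <= 1 - j%:R * (1 - delta).
    move=> jk; apply: (le_trans hk).
    have : j%:R <= k%:R - 1 :> R by rewrite lerBrDr natr1 ler_nat.
    by move: d1; nra.
  have c1 := cs _ (ltnW sk).
  have H3 : 0 < h s.+2.
    apply: lt_le_trans H1; rewrite !mulr_gt0 //; exact: lt_le_trans c1.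
  split=> //; have := mm s.+1 => M.
  set c := 1 - s.+1%:R * (1 - delta) in H1 c1.
  have M2 : s.+2%:R * h s.+2 * (c * n * h s.+1) <= h s.+1 * (s.+1%:R * h s.+3 + n * h s.+2).
    apply: le_trans M; rewrite expr2 mulrA; apply: ler_wpM2l H1.
    by rewrite mulr_ge0 // ltW.
  have M3 : s.+2%:R * h s.+2 * (c * n) <= s.+1%:R * h s.+3 + n * h s.+2.
    by rewrite -(ler_pM2l H2); apply: le_trans M2; rewrite le_eqVlt; apply/orP; left; apply/eqP; ring.
  have s10 : 0 < s.+1%:R :> R by [].
  rewrite -(ler_pM2l s10).
  have E2 : s.+2%:R = s.+1%:R + 1 :> R by rewrite natr1.
  have : s.+1%:R * ((1 - s.+2%:R * (1 - delta)) * n * h s.+2) =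
         s.+2%:R * h s.+2 * (c * n) - n * h s.+2 by rewrite /c E2; ring.
  by move=> ->; move: M3; lra.
move=> s sk; case: s sk => [|s] sk.
  rewrite !cliques0 cliques1 !mul1n mulr1 -/n ler_piMl ?(ltW n0) //.
  apply: (le_trans hk); rewrite gerBl mulr_ge0 ?subr_ge0 // (ler_nat R 1).
  exact: ltnW.
have [H1 H2] := main _ sk; apply: le_trans H1; apply: ler_wpM2r; first exact: ltW.
apply: ler_wpM2r; first exact: ltW.
apply: (le_trans hk).
have : s.+1%:R <= k%:R - 1 :> R by rewrite lerBrDr natr1 ler_nat.
by move: d1; nra.
Qed.

Lemma clique_supersat (R : realFieldType) (delta : R) k (kappa : R) :
  (0 < v G)%N -> delta <= 1 -> 0 < kappa -> (2 <= k)%N ->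
  kappa <= 1 - (k%:R - 1) * (1 - delta) ->
  delta * (v G)%:R ^+ 2 <= 2 * (e G)%:R ->
  (kappa * (v G)%:R) ^+ k <= k`!%:R * #|cliques k|%:R.
Proof.
move=> v0 d1 k0 k2 hk he.
have gr := clique_growth v0 d1 k0 k2 hk he.
suff H s : (s <= k)%N -> (kappa * (v G)%:R) ^+ s <= (s`! * #|cliques s|)%:R.
  by rewrite -natrM; exact: H.
elim: s => [|s IH] sk; first by rewrite cliques0.
rewrite exprS; apply: le_trans (gr _ sk); apply: ler_wpM2l; last exact: IH (ltnW sk).
by rewrite mulr_ge0 // ltW.
Qed.

End Cliques.

(** * Supersaturation *)

Section Homs.
Variables (T : finType) (G : sgraph T) (k : nat).

(* Homomorphisms into [G] of the complete multipartite graph with classes the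
   fibres of [part]. *)
Definition homs (L : finType) (part : L -> 'I_k) : {set {ffun L -> T}} :=
  [set f : {ffun L -> T} | [forall l, f l \in vset G] &&
    [forall l, forall l', (part l != part l') ==> adj G (f l) (f l')]].

Lemma homsP (L : finType) (part : L -> 'I_k) (f : {ffun L -> T}) :
  reflect ((forall l, f l \in vset G) /\
    forall l l', part l != part l' -> adj G (f l) (f l')) (f \in homs part).
Proof.
rewrite inE; apply: (iffP andP) => -[h1 h2].
  by split; [exact/forallP|move=> l l'; have /forallP/(_ l)/forallP/(_ l')/implyP := h2].
split; first exact/forallP.
by apply/forallP => l; apply/forallP => l'; apply/implyP; exact: h2.
Qed.

Lemma homs_clique : (#|cliques G k| <= #|homs (@id 'I_k)|)%N.
Proof.
pose im (f : {ffun 'I_k -> T}) := f @: [set: 'I_k].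
apply: (@leq_trans #|im @: homs id|); last exact: leq_imset_card.
apply/subset_leq_card/subsetP => A; rewrite inE => /andP[/cliqueP[AV cA] /eqP Ak].
pose f : {ffun 'I_k -> T} := [ffun i => enum_val (cast_ord (esym Ak) i)].
have fA i : f i \in A by rewrite ffunE; exact: enum_valP.
have fi : injective f by move=> i j; rewrite !ffunE => /enum_val_inj/cast_ord_inj.
apply/imsetP; exists f.
  apply/homsP; split=> [i|i j ij]; first exact: (subsetP AV).
  by apply: cA => //; apply: contraNneq ij => /fi->.
apply/esym/eqP; rewrite eqEcard card_imset // cardsT card_ord Ak leqnn andbT.
by apply/subsetP => y /imsetP[i _ ->].
Qed.

(** The new index [m] is a twin of [l0]. Two homomorphisms that agree off [l0] combine to one of the
    larger graph, and Cauchy-Schwarz over the common restrictions counts such pairs. *)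
Lemma homs_twin (R : realFieldType) m (p : nat -> 'I_k) l0 :
  (l0 < m)%N -> p l0 = p m ->
  #|homs (fun i : 'I_m => p i)|%:R ^+ 2 <=
  (v G)%:R ^+ m.-1 * #|homs (fun i : 'I_m.+1 => p i)|%:R :> R.
Proof.
move=> lm pE; set H := homs (fun i : 'I_m => p i).
case: (set_0Vmem H) => [->|[f0 f0H]].
  by rewrite cards0 expr0n mulr_ge0 // exprn_ge0.
pose o0 := Ordinal lm.
have /homsP[fV _] := f0H; set x0 := f0 o0.
(* Overwriting the value at [l0] by a fixed vertex encodes the restriction of [f] to the other
   indices without a change of type. *)
pose er (f : {ffun 'I_m -> T}) : {ffun 'I_m -> T} :=
  [ffun i => if i == o0 then x0 else f i].
pose s c := #|[set f in H | er f == c]|%:R : R.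
have -> : #|H|%:R = \sum_(c in er @: H) s c.
  rewrite -natr_sum; congr _%:R; rewrite -sum1_card.
  rewrite (partition_big er (fun c => c \in er @: H)) /=; last first.
    by move=> f fH; exact: imset_f.
  by apply: eq_bigr => c _; rewrite sum1dep_card.
apply: (le_trans (cauchy_card _ _)); apply: ler_pM => //.
- by apply: sumr_ge0 => c _; exact: sqr_ge0.
- rewrite -natrX ler_nat.
  have -> : (v G ^ m.-1 = #|[set g : {ffun 'I_m -> T} |
      [forall u, g u \in (if u \in [set o0] then [set x0] else vset G)]]|)%N.
    by rewrite card_family2 !cards1 exp1n mul1n card_ord subn1.
  apply/subset_leq_card/subsetP => g /imsetP[f /homsP[fv _] ->].
  rewrite inE; apply/forallP => i; rewrite ffunE inE; case: ifP => _ //.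
  exact: set11.
pose D := [set ff : {ffun 'I_m -> T} * {ffun 'I_m -> T} |
  [&& ff.1 \in H, ff.2 \in H & er ff.2 == er ff.1]].
have -> : \sum_(c in er @: H) s c ^+ 2 = #|D|%:R.
  rewrite -sum1_card.
  rewrite (eq_bigl (fun ff : {ffun 'I_m -> T} * {ffun 'I_m -> T} =>
    (ff.1 \in H) && ((ff.2 \in H) && (er ff.2 == er ff.1)))); last by move=> ff; rewrite inE.
  rewrite -(pair_big_dep (mem H) (fun f f' => (f' \in H) && (er f' == er f))
    (fun _ _ => 1%N)) /=.
  rewrite [in RHS](partition_big er (fun c => c \in er @: H)) /=; last first.
    by move=> f fH; exact: imset_f.
  rewrite natr_sum; apply: eq_bigr => c _.
  rewrite (eq_bigr (fun=> #|[set f in H | er f == c]|)); last first.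
    by move=> f /andP[_ /eqP->]; rewrite sum1dep_card.
  rewrite sum_nat_const natrM expr2; congr (_%:R * _).
  by apply: eq_card => f; rewrite [LHS]inE [RHS]unfold_in.
rewrite ler_nat.
pose ext (ff : {ffun 'I_m -> T} * {ffun 'I_m -> T}) : {ffun 'I_m.+1 -> T} :=
  [ffun i => if unlift ord_max i is Some j then ff.1 j else ff.2 o0].
have extl ff j : ext ff (lift ord_max j) = ff.1 j by rewrite ffunE liftK.
have extm ff : ext ff ord_max = ff.2 o0 by rewrite ffunE unlift_none.
have ext_inj : {in D &, injective ext}.
  move=> [a b] [c d]; rewrite !inE /= => /and3P[_ _ /eqP/ffunP h1] /and3P[_ _ /eqP/ffunP h2] /ffunP E.
  have ac : a = c by apply/ffunP => j; have := E (lift ord_max j); rewrite !extl.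
  have bd0 : b o0 = d o0 by have := E ord_max; rewrite !extm.
  rewrite ac; congr (_, _); apply/ffunP => j; case: (eqVneq j o0) => [->//|jo].
  have := h1 j; have := h2 j.
  by rewrite !ffunE (negPf jo) ac => -> ->.
rewrite -(card_in_imset ext_inj); apply/subset_leq_card/subsetP => F /imsetP[[a b]].
rewrite inE /= => /and3P[/homsP[aV aA] /homsP[bV bA] /eqP/ffunP ab] ->.
have bE j : j != o0 -> b j = a j.
  by move=> jo; have := ab j; rewrite !ffunE (negPf jo).
have cross j : p (lift ord_max j) != p m -> adj G (a j) (b o0).
  rewrite lift_max -pE => pj; have jo : j != o0 by apply: contraNneq pj => ->.
  by rewrite -bE //; exact: bA.
apply/homsP; split=> [i|i i'].
  by case: (unliftP ord_max i) => [j|] ->; rewrite ?extl ?extm.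
case: (unliftP ord_max i) => [j|] ->; case: (unliftP ord_max i') => [j'|] ->;
  rewrite ?extl ?extm.
- by rewrite !lift_max; exact: aA.
- by move=> h; apply: cross.
- by move=> h; rewrite adjC; apply: cross; rewrite eq_sym.
by rewrite eqxx.
Qed.

Lemma homs_restrict (L L' : finType) (part : L' -> 'I_k) (g : L -> L') :
  injective g ->
  (#|homs part| <= #|homs (part \o g)| * v G ^ (#|L'| - #|L|))%N.
Proof.
move=> gi; pose r (f : {ffun L' -> T}) : {ffun L -> T} := [ffun l => f (g l)].
have rH f : f \in homs part -> r f \in homs (part \o g).
  by case/homsP=> fV fA; apply/homsP; split=> [l|l l' h]; rewrite !ffunE //; exact: fA.
rewrite -sum1_card (partition_big r (fun h => h \in homs (part \o g))) //=.
rewrite -[X in (X * _)%N]sum1_card big_distrl /=; apply: leq_sum => h _.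
rewrite sum1dep_card mul1n.
pose fam (u : L') := if [pick l | g l == u] is Some l then [set h l] else vset G.
apply: (@leq_trans #|[set f : {ffun L' -> T} | [forall u, f u \in fam u]]|).
  apply/subset_leq_card/subsetP => f; rewrite !inE => /andP[fH /eqP rf].
  apply/forallP => u; rewrite /fam; case: pickP => [l /eqP <-|_].
    by rewrite -rf ffunE set11.
  by move/andP: fH => [/forallP].
rewrite card_family_prod (bigID (fun u => u \in codom g)) /=.
rewrite [X in (X * _)%N]big1 ?mul1n; last first.
  move=> u /codomP[l ->]; rewrite /fam; case: pickP => [l' _|/(_ l)]; first by rewrite cards1.
  by rewrite eqxx.
rewrite (eq_bigr (fun=> v G)); last first.
  move=> u uN; rewrite /fam; case: pickP => // l /eqP gl.
  by move: uN; rewrite -gl codom_f.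
rewrite prod_nat_const; apply/eq_leq; congr (_ ^ _)%N.
rewrite -(cardC (mem (codom g))) card_codom // addKn; apply: eq_card => u.
by rewrite !inE.
Qed.

End Homs.

Lemma hom_supersat (R : realFieldType) (k : nat) (L : finType) (part : L -> 'I_k)
    (kappa : R) : (2 <= k)%N -> 0 < kappa ->
  exists2 c : R, 0 < c & forall (T : finType) (G : sgraph T) (delta : R),
    (0 < v G)%N -> delta <= 1 -> kappa <= 1 - (k%:R - 1) * (1 - delta) ->
    delta * (v G)%:R ^+ 2 <= 2 * (e G)%:R ->
    c * (v G)%:R ^+ #|L| <= #|homs G part|%:R.
Proof.
move=> k2 k0; have kg : (0 < k)%N by exact: ltnW.
pose i0 := Ordinal kg.
(* The first [k] indices form a clique. The vertices of [L] are added as twins of these, each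
   addition squaring the constant, and in the end the first [k] indices are forgotten. *)
pose p (i : nat) : 'I_k := if (i < k)%N then insubd i0 i else
  nth i0 [seq part l | l <- enum L] (i - k).
have pk (i : 'I_k) : p i = i by rewrite /p ltn_ord; apply: val_inj; rewrite val_insubd ltn_ord.
pose good (m : nat) (c : R) := forall (T : finType) (G : sgraph T) (delta : R),
    (0 < v G)%N -> delta <= 1 -> kappa <= 1 - (k%:R - 1) * (1 - delta) ->
    delta * (v G)%:R ^+ 2 <= 2 * (e G)%:R ->
    c * (v G)%:R ^+ m <= #|homs G (fun i : 'I_m => p i)|%:R.
have step m : exists2 c : R, 0 < c & good (k + m)%N c.
  elim: m => [|m [c c0 IH]].
    exists (kappa ^+ k / k`!%:R); first by rewrite divr_gt0 ?exprn_gt0 // ltr0n fact_gt0.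
    move=> T G delta v0 d1 hk he; rewrite addn0 mulrAC ler_pdivrMr ?ltr0n ?fact_gt0 //.
    rewrite -exprMn [leRHS]mulrC; apply: (le_trans (clique_supersat v0 d1 k0 k2 hk he)).
    apply: ler_wpM2l => //; rewrite ler_nat; apply: (leq_trans (homs_clique G k)).
    apply/subset_leq_card/subsetP => f /homsP[fV fA]; apply/homsP; split=> // i j.
    by rewrite !pk; exact: fA.
  exists (c ^+ 2); first exact: exprn_gt0.
  move=> T G delta v0 d1 hk he; rewrite addnS.
  have n0 : 0 < (v G)%:R :> R by rewrite ltr0n.
  have [l0 l0m pl] : exists2 l0, (l0 < k + m)%N & p l0 = p (k + m)%N.
    by exists (p (k + m)%N); [exact: ltn_addr|rewrite pk].
  have tw := homs_twin G R l0m pl.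
  have nm : 0 < (v G)%:R ^+ (k + m).-1 :> R by exact: exprn_gt0.
  rewrite -(ler_pM2l nm); apply: le_trans tw.
  have := IH _ _ _ v0 d1 hk he; set h : R := #|_|%:R => hh.
  have -> : (v G)%:R ^+ (k + m).-1 * (c ^+ 2 * (v G)%:R ^+ (k + m).+1) =
            (c * (v G)%:R ^+ (k + m)) ^+ 2.
    have km : (0 < k + m)%N by rewrite addn_gt0 kg.
    rewrite -{2 3}(prednK km) !exprS; move: (_ ^+ (k + m).-1) => z; ring.
  by apply: lerXn2r; rewrite ?nnegrE // mulr_ge0 ?(ltW c0) // ltW // exprn_gt0.
have [c c0 gc] := step #|L|; exists c => // T G delta v0 d1 hk he.
have n0 : 0 < (v G)%:R :> R by rewrite ltr0n.
pose g (l : L) : 'I_(k + #|L|) := rshift k (enum_rank l).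
have gi : injective g by move=> a b /rshift_inj/enum_rank_inj.
have partg l : p (g l) = part l.
  rewrite /p /= ltnNge leq_addr /= addKn (nth_map l) ?nth_enum_rank //.
  by rewrite -cardE.
have := homs_restrict G (fun i : 'I_(k + #|L|) => p i) gi.
rewrite card_ord addnK -(ler_nat R) natrM natrX => hr.
have nk : 0 < (v G)%:R ^+ k :> R by exact: exprn_gt0.
have -> : homs G part = homs G ((fun i : 'I_(k + #|L|) => p i) \o g).
  apply/setP => f; apply/homsP/homsP => -[h1 h2]; split=> // l l'; have := h2 l l';
    by rewrite /= !partg.
rewrite -(ler_pM2r nk); apply: le_trans hr; apply: le_trans (gc _ _ _ v0 d1 hk he).
by rewrite -mulrA -exprD addnC.
Qed.

(** * Thinning and dependent random choice *)

Section Boxes.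
Variables (R : realFieldType) (L F : finType).
Implicit Types (M : L -> {set F}) (W : {set {ffun L -> F}}) (t : {ffun L -> F}).

Definition box M : {set {ffun L -> F}} := [set t : {ffun L -> F} | [forall l, t l \in M l]].

Lemma boxP M t : reflect (forall l, t l \in M l) (t \in box M).
Proof. by rewrite inE; exact: forallP. Qed.

Lemma card_box M : #|box M| = (\prod_l #|M l|)%N.
Proof. exact: card_family_prod. Qed.

Definition upd (X : Type) (f : L -> X) l (a : X) : L -> X :=
  fun l' => if l' == l then a else f l'.

Definition updf t l a : {ffun L -> F} := [ffun l' => upd t l a l'].

Lemma updf_same t l a : updf t l a l = a.
Proof. by rewrite ffunE /upd eqxx. Qed.

Lemma updf_id t l : updf t l (t l) = t.
Proof. by apply/ffunP => l'; rewrite ffunE /upd; case: eqVneq => [->|]. Qed.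

Lemma updf_updf t l a a' : updf (updf t l a) l a' = updf t l a'.
Proof. by apply/ffunP => l'; rewrite !ffunE /upd; case: eqVneq => // ln; rewrite ffunE /upd (negPf ln). Qed.

Lemma updf_box M t l a : t \in box M -> a \in M l -> updf t l a \in box M.
Proof.
move=> /boxP tM aM; apply/boxP => l'; rewrite ffunE /upd.
by case: eqVneq => // ->.
Qed.

Lemma prod_upd M l (A : {set F}) :
  (\prod_l' #|upd M l A l'| = #|A| * \prod_(l' | l' != l) #|M l'|)%N.
Proof.
rewrite (bigD1 l) //= {1}/upd eqxx; congr (_ * _)%N.
by apply: eq_bigr => l' ll; rewrite /upd (negPf ll).
Qed.

(* Random thinning: keeping each element of [M l] with probability
   [m / #|M l|] leaves few related pairs, and one deletes those. *)
Lemma thin_coord M W l (rl : rel F) (m c delta : R) :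
  (forall l, 0 < #|M l|)%N -> 0 < c -> 0 < m -> delta <= c / 4 ->
  {in M l, reflexive rl} ->
  #|[set p in setX (M l) (M l) | rl p.1 p.2]|%:R * m <= delta * #|M l|%:R ^+ 2 ->
  c * (\prod_l' #|M l'|)%:R <= #|W :&: box M|%:R ->
  exists A : {set F}, [/\ A \subset M l,
    forall i j, i \in A -> j \in A -> i != j -> ~~ rl i j,
    c / 4 * m <= #|A|%:R &
    c / 2 * (\prod_l' #|upd M l A l'|)%:R <= #|W :&: box (upd M l A)|%:R].
Proof.
move=> M0 c0 m0 dc rrl hD hW.
set N : R := #|M l|%:R in hD; have N0 : 0 < N by rewrite ltr0n.
set Q : R := (\prod_(l' | l' != l) #|M l'|)%:R.
have Q0 : 0 < Q by rewrite ltr0n prodn_gt0 // => l' _.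
have PQ : (\prod_l' #|M l'|)%:R = N * Q by rewrite (bigD1 l) //= natrM.
set D := [set p in _ | _] in hD.
(* The diagonal pairs are counted, by reflexivity of [rl]; this forces [m <= delta * N], so that
   [m / N] is a probability. *)
have DN : N <= #|D|%:R.
  rewrite ler_nat -(card_imset (mem (M l)) (f := fun x => (x, x))); last by move=> x y [].
  apply/subset_leq_card/subsetP => p /imsetP[x xM ->].
  by rewrite !inE /= rrl // andbT; apply/andP.
have mN : m <= delta * N.
  rewrite -(ler_pM2l N0); apply: (le_trans (ler_wpM2r (ltW m0) DN)).
  by apply: (le_trans hD); rewrite expr2 mulrA mulrCA mulrC le_eqVlt; apply/orP; left;
     apply/eqP; ring.
have d0 : 0 < delta by have := lt_le_trans m0 mN; rewrite pmulr_lgt0.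
pose w phi := #|[set t in W :&: box M | t l == phi]|%:R / Q : R.
have sumw (A : {set F}) : A \subset M l ->
    \sum_(phi in A) w phi = #|W :&: box (upd M l A)|%:R / Q.
  move=> AM; rewrite -big_distrl /= -natr_sum; congr (_%:R / _).
  rewrite -sum1_card (partition_big (fun t : {ffun L -> F} => t l) (fun phi => phi \in A)) /=.
    apply: eq_bigr => phi pA; rewrite -sum1_card; apply: eq_bigl => t.
    rewrite !inE -!andbA; congr (_ && _); case: eqVneq => [tl|]; rewrite ?andbF // !andbT.
    apply/forallP/forallP => h l'; have := h l'; rewrite /upd; case: eqVneq => // ->.
      by rewrite tl.
    by rewrite tl => _; exact: (subsetP AM).
  by move=> t; rewrite !inE => /andP[_ /forallP /(_ l)]; rewrite /upd eqxx.
have w0 phi : 0 <= w phi by rewrite divr_ge0 // ltW.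
have w1 phi : w phi <= 1.
  rewrite ler_pdivrMr // mul1r ler_nat.
  have -> : (\prod_(l' | l' != l) #|M l'| = #|box (upd M l [set phi])|)%N.
    by rewrite card_box prod_upd cards1 mul1n.
  apply/subset_leq_card/subsetP => t; rewrite !inE => /andP[/andP[_ /forallP tM] /eqP tl].
  by apply/forallP => l'; rewrite /upd; case: eqVneq => [->|//]; rewrite inE tl.
have updM : box (upd M l (M l)) = box M.
  apply/setP => t; apply/boxP/boxP => h l'; have := h l'; rewrite /upd;
  by case: eqVneq => // ->.
have sumN : c * N <= \sum_(phi in M l) w phi.
  rewrite sumw // updM ler_pdivlMr //; apply: le_trans hW.
  by rewrite PQ mulrA.
pose tt := m / N.
have c4 : c / 4 * N <= \sum_(phi in M l) w phi by apply: le_trans sumN; apply: ler_wpM2r; [exact: ltW|lra].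
have t01 : 0 <= tt <= 1.
  rewrite /tt divr_ge0 ?(ltW m0) ?(ltW N0) //= ler_pdivrMr // mul1r.
  have : c * N <= N.
    apply: (le_trans sumN); rewrite /N -(sumr_const _ (1 : R)).
    by apply: ler_sum => phi _; exact: w1.
  rewrite ger_pMl // => c1.
  have dl1 : delta <= 1 by apply: (le_trans dc); lra.
  by apply: (le_trans mN); rewrite ger_pMl.
(* The shift by [c / 2] makes one lower bound serve twice: as [w <= 1], it bounds the size of the
   subset, and as it is non-negative, the average of [w] on the subset is at least [c / 2]. *)
have [T TM HT] := sample_subset (M l) (fun phi => w phi - c / 2)
  (fun i j => (rl i j)%:R) t01.
have sumI (A : {set F}) : \sum_(i in A) (w i - c / 2) = \sum_(i in A) w i - #|A|%:R * (c / 2).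
  by rewrite sumrB sumr_const -[X in _ - X]mulr_natl.
have DE : #|D|%:R = \sum_(i in M l) \sum_(j in M l) (rl i j)%:R :> R.
  rewrite pair_big /= -natr_sum -sum1_card; congr _%:R.
  rewrite [LHS]big_mkcond [RHS]big_mkcond; apply: eq_bigr => p _; rewrite !inE.
  by case: (p.1 \in M l); case: (p.2 \in M l); case: (rl _ _).
have low : c / 4 * m <= \sum_(i in T) (w i - c / 2) -
    \sum_(i in T) \sum_(j in T | j != i) (rl i j)%:R.
  apply: le_trans HT; rewrite sumI -/N.
  set B := \sum_(i in M l) \sum_(j in _ | _) _.
  have B1 : B <= #|D|%:R.
    rewrite DE; apply: ler_sum => i _; rewrite big_mkcondr /=.
    by apply: ler_sum => j _; case: ifP.
  have h1 : c * m <= tt * \sum_(i in M l) w i.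
    have -> : c * m = tt * (c * N) by rewrite /tt; field; rewrite gt_eqF.
    by apply: ler_wpM2l sumN; case/andP: t01.
  have h2 : tt ^+ 2 * B <= delta * m.
    apply: (@le_trans _ _ (tt ^+ 2 * #|D|%:R)); first by apply: ler_wpM2l B1; exact: sqr_ge0.
    have -> : tt ^+ 2 * #|D|%:R = m / N ^+ 2 * (#|D|%:R * m) by rewrite /tt; field; rewrite gt_eqF.
    have -> : delta * m = m / N ^+ 2 * (delta * N ^+ 2) by field; rewrite gt_eqF.
    by apply: ler_wpM2l hD; rewrite divr_ge0 ?sqr_ge0 // ltW.
  have h3 : tt * (N * (c / 2)) = c / 2 * m by rewrite /tt; field; rewrite gt_eqF.
  have h4 : delta * m <= c / 4 * m by apply: ler_wpM2r dc; exact: ltW.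
  by move: h1 h2 h4; rewrite mulrBr h3; lra.
(* Deleting an element costs at most its weight, which is below 1, whereas every element with a
   related partner contributes at least 1 to the subtracted sum. *)
pose A := [set i in T | ~~ [exists j in T, (j != i) && rl i j]].
have AT : A \subset T by apply/subsetP => i; rewrite inE => /andP[].
have AM : A \subset M l by exact: subset_trans AT TM.
have hA : c / 4 * m <= \sum_(i in A) (w i - c / 2).
  apply: (le_trans low); rewrite -sumrB [X in _ <= X]big_mkcond [X in X <= _]big_mkcond.
  apply: ler_sum => i _; rewrite [i \in A]inE; case: (boolP (i \in T)) => //= iT.
  case: (boolP [exists j in T, _]) => [/exists_inP[j jT /andP[ji rij]]|_] /=; last first.
    by rewrite gerBl; apply: sumr_ge0.
  rewrite subr_le0 (bigD1 j) ?jT //= rij.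
  apply: (@le_trans _ _ 1); last by rewrite lerDl; apply: sumr_ge0.
  by have := w1 i; move: c0; lra.
exists A; split=> //.
- move=> i j; rewrite !inE => /andP[iT /exists_inPn h] /andP[jT _] ij.
  by have := h _ jT; rewrite eq_sym ij.
- apply: (le_trans hA); rewrite -(sumr_const _ (1 : R)); apply: ler_sum => i _.
  by have := w1 i; move: c0; lra.
have hA2 : #|A|%:R * (c / 2) <= \sum_(i in A) w i.
  have : 0 <= \sum_(i in A) (w i - c / 2) by apply: le_trans hA; rewrite mulr_ge0 ?divr_ge0 ?ltW.
  by rewrite sumI subr_ge0.
rewrite sumw // ler_pdivlMr // in hA2; rewrite prod_upd natrM -/Q.
by apply: le_trans hA2; rewrite le_eqVlt; apply/orP; left; apply/eqP; ring.
Qed.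

(** Thinning one coordinate leaves the sets and the related pairs of the others unchanged, so it can
    be repeated, at the price of half the density each time. *)
Lemma thin_all W (rl : L -> rel F) (m : L -> R) (ls : seq L) M (c delta : R) :
  uniq ls -> (forall l, 0 < #|M l|)%N -> 0 < c -> (forall l, 0 < m l) ->
  delta <= c / 2 ^+ size ls / 4 ->
  (forall l, l \in ls -> {in M l, reflexive (rl l)}) ->
  (forall l, l \in ls -> #|[set p in setX (M l) (M l) | rl l p.1 p.2]|%:R * m l <=
     delta * #|M l|%:R ^+ 2) ->
  c * (\prod_l #|M l|)%:R <= #|W :&: box M|%:R ->
  exists M' : L -> {set F}, [/\ forall l, M' l \subset M l,
    forall l, (0 < #|M' l|)%N /\ (l \notin ls -> M' l = M l),
    forall l, l \in ls -> (forall i j, i \in M' l -> j \in M' l -> i != j -> ~~ rl l i j)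
      /\ c / 2 ^+ size ls / 4 * m l <= #|M' l|%:R &
    c / 2 ^+ size ls * (\prod_l #|M' l|)%:R <= #|W :&: box M'|%:R].
Proof.
elim: ls M c => [|l ls IH] M c /= uls M0 c0 m0 dc rr hD hW.
  by exists M; split=> //; rewrite expr0 divr1.
case/andP: uls => lls uls.
have p2 n : 1 <= 2 ^+ n :> R by rewrite exprn_ege1 // (ler_nat R 1).
have cle : c / 2 ^+ (size ls).+1 <= c / 2.
  rewrite exprS invfM mulrA ler_piMr ?divr_ge0 ?(ltW c0) //.
  by rewrite invf_le1 // (lt_le_trans ltr01).
have dc4 : delta <= c / 4 by apply: (le_trans dc); move: cle c0; lra.
have ll : l \in l :: ls by rewrite inE eqxx.
have [A [AM Adis Ac AW]] := thin_coord M0 c0 (m0 l) dc4 (rr _ ll) (hD _ ll) hW.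
have A0 : (0 < #|A|)%N.
  by rewrite -(ltr0n R); apply: lt_le_trans Ac; rewrite !mulr_gt0 ?invr_gt0.
have c2E : c / 2 / 2 ^+ size ls = c / 2 ^+ (size ls).+1 by rewrite exprS invfM mulrA.
have nl l' : l' \in ls -> upd M l A l' = M l'.
  by rewrite /upd; case: eqVneq => // ->; rewrite (negPf lls).
have c20 : 0 < c / 2 by rewrite divr_gt0.
have updA : upd M l A l = A by rewrite /upd eqxx.
have M0' l' : (0 < #|upd M l A l'|)%N by rewrite /upd; case: eqVneq.
have dc' : delta <= c / 2 / 2 ^+ size ls / 4 by rewrite c2E.
have rr' l' : l' \in ls -> {in upd M l A l', reflexive (rl l')}.
  by move=> l'ls; rewrite nl //; apply: rr; rewrite inE l'ls orbT.
have hD' l' : l' \in ls -> #|[set p in setX (upd M l A l') (upd M l A l') | rl l' p.1 p.2]|%:R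
   * m l' <= delta * #|upd M l A l'|%:R ^+ 2.
  by move=> l'ls; rewrite nl //; apply: hD; rewrite inE l'ls orbT.
have [M' [h1 h2 h3 h4]] := IH _ _ uls M0' c20 m0 dc' rr' hD' AW.
have M'l : M' l = A by have [_ ->] := h2 l.
exists M'; split.
- move=> l'; case: (eqVneq l' l) => [->|l'l]; first by rewrite M'l.
  by have := h1 l'; rewrite /upd (negPf l'l).
- move=> l'; have [h5 h6] := h2 l'; split=> //; rewrite inE negb_or => /andP[l'l l'ls].
  by rewrite h6 // /upd (negPf l'l).
- move=> l'; rewrite inE; case: (eqVneq l' l) => [->|l'l] /= => [_|l'ls].
    rewrite M'l; split=> //; apply: le_trans Ac; apply: ler_wpM2r; first exact: ltW.
    by move: cle c0; lra.
  by have := h3 _ l'ls; rewrite c2E.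
by rewrite -c2E.
Qed.

End Boxes.

Section Adaptive.
Variables (R : realFieldType) (L F U : finType) (M : L -> {set F}).
Implicit Types (W : {set {ffun L -> F}}) (t y : {ffun L -> F}) (Psi : {ffun U -> F}).
Implicit Types (Phi : {ffun L -> {ffun U -> F}}).

(** Coordinate [l] is frozen to the [#|U|] entries of [Psi]: a point stays if it is in [W] whichever
    entry is put there. Its own value at [l] no longer matters, so all refinements live in the same
    box. *)
Definition refine W l Psi : {set {ffun L -> F}} :=
  [set t in box M | [forall u, updf t l (Psi u) \in W]].

Definition refines W Phi (ls : seq L) := foldl (fun W l => refine W l (Phi l)) W ls.

Definition section W y l : {set F} := [set p in M l | updf y l p \in W].

Definition tuples (S : {set F}) : {set {ffun U -> F}} :=
  [set Psi : {ffun U -> F} | [forall u, Psi u \in S]].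

Lemma card_tuples S : #|tuples S| = (#|S| ^ #|U|)%N.
Proof. by rewrite /tuples card_family_prod prod_nat_const. Qed.

Lemma refines_ext W Phi Phi' (ls : seq L) :
  {in ls, Phi =1 Phi'} -> refines W Phi ls = refines W Phi' ls.
Proof.
elim: ls W => //= l ls IH W h; rewrite (h l) ?inE ?eqxx //; apply: IH => l' l'ls.
by apply: h; rewrite inE l'ls orbT.
Qed.

Lemma refinesP W Phi (ls : seq L) t (chi : {ffun L -> U}) : uniq ls ->
  t \in refines W Phi ls ->
  [ffun l => if l \in ls then Phi l (chi l) else t l] \in W.
Proof.
elim: ls W => [|l ls IH] W /=.
  by move=> _ tW; rewrite (_ : [ffun _ => _] = t) //; apply/ffunP => l; rewrite ffunE.
case/andP=> lls uls /(IH _ uls); rewrite inE => /andP[_ /forallP/(_ (chi l))].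
set t1 := updf _ _ _; suff -> : [ffun l' => if l' \in l :: ls then Phi l' (chi l') else t l'] = t1 by [].
apply/ffunP => l'; rewrite !ffunE /upd !inE.
by case: (eqVneq l' l) => [->|l'l] //=; rewrite ffunE.
Qed.

Definition bad_tuples W y l (thr : R) : {set {ffun U -> F}} :=
  [set Psi in tuples (section W y l) | #|refine W l Psi|%:R < thr].

(* Dependent random choice: the section is taken at a random point [y]. *)
Lemma dependent_choice W l (c eps : R) :
  W \subset box M -> (forall l, 0 < #|M l|)%N -> 0 < c -> 0 < eps ->
  c * #|box M|%:R <= #|W|%:R ->
  exists y, [/\ y \in box M, c / 2 * #|M l|%:R <= #|section W y l|%:R &
    #|bad_tuples W y l (eps * (c / 2) ^+ #|U|.+1 * #|box M|%:R)|%:R <=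
    eps * #|section W y l|%:R ^+ #|U|].
Proof.
move=> WM M0 c0 e0 hW; set B := #|box M|%:R in hW *; set b := #|U|.
set thr := eps * _ * B; set m : R := #|M l|%:R.
have m0 : 0 < m by rewrite ltr0n.
have B0 : 0 < B by rewrite ltr0n card_box prodn_gt0.
have sumS : \sum_(y in box M) #|section W y l|%:R = m * #|W|%:R.
  transitivity (\sum_(y in box M) \sum_(p in M l) (updf y l p \in W)%:R : R).
    apply: eq_bigr => y _; rewrite -natr_sum; congr _%:R; rewrite -sum1_card.
    rewrite [LHS]big_mkcond [RHS]big_mkcond; apply: eq_bigr => p _; rewrite inE.
    by case: (p \in M l).
  transitivity (\sum_(t in W) \sum_(p in M l) (1 : R)); last first.
    by rewrite !sumr_const mulr_natr.
  rewrite (eq_bigr (fun y => \sum_(p in M l | updf y l p \in W) 1)); last first.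
    by move=> y _; rewrite [RHS]big_mkcondr /=; apply: eq_bigr => p _; case: ifP.
  rewrite !pair_big_dep /=.
  rewrite (reindex_onto (fun p : {ffun L -> F} * F => (updf p.1 l p.2, p.1 l))
     (fun p : {ffun L -> F} * F => (updf p.1 l p.2, p.1 l))) /=; last first.
    by move=> [y p] _ /=; rewrite updf_updf updf_id updf_same.
  apply: eq_bigl => -[t p] /=; rewrite updf_updf updf_id updf_same eqxx andbT.
  case: (boolP (t \in W)) => tW /=; last by rewrite !andbF.
  have tM := subsetP WM _ tW; have /boxP/(_ l) -> := tM; rewrite /= !andbT.
  apply/idP/idP => [/boxP/(_ l)|pM]; first by rewrite updf_same.
  exact: updf_box.
pose good := [set y in box M | c / 2 * m <= #|section W y l|%:R].
have goodB : c / 2 * B <= #|good|%:R.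
  have sec_le y : #|section W y l|%:R <= m.
    by rewrite ler_nat subset_leq_card //; apply/subsetP => p; rewrite inE => /andP[].
  have : m * (c * B) <= m * (#|good|%:R + c / 2 * B).
    apply: (@le_trans _ _ (m * #|W|%:R)); first by rewrite ler_pM2l.
    rewrite -sumS; apply: (@le_trans _ _ (\sum_(y in box M)
        ((y \in good)%:R * m + c / 2 * m))).
      apply: ler_sum => y yM; rewrite [y \in good]inE yM /=.
      case: (boolP (c / 2 * m <= _)) => h; last first.
        by rewrite mul0r add0r ltW // ltNge.
      by rewrite /= mul1r ler_wpDr // mulr_ge0 ?divr_ge0 // ltW.
    rewrite big_split /= sumr_const -mulr_suml -[X in _ + X]mulr_natl -/B.
    have -> : \sum_(y in box M) (y \in good)%:R = #|good|%:R :> R.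
      rewrite -natr_sum -sum1_card; congr _%:R.
      rewrite [LHS]big_mkcond [RHS]big_mkcond; apply: eq_bigr => y _.
      by rewrite [y \in good]inE; case: (y \in box M); case: (_ <= _).
    by rewrite le_eqVlt; apply/orP; left; apply/eqP; ring.
  by rewrite ler_pM2l //; lra.
(* [Psi] consists of members of the section at [y] exactly if [y] is in [refine W l Psi]; hence a
   tuple with few extensions is counted for few [y]. *)
have sumbad : \sum_(y in box M) #|bad_tuples W y l thr|%:R <= m ^+ b * thr.
  apply: (@le_trans _ _ (\sum_(y in box M) \sum_(Psi in tuples (M l) |
     #|refine W l Psi|%:R < thr) (y \in refine W l Psi)%:R)).
    apply: ler_sum => y yM; rewrite -natr_sum ler_nat -sum1_card.
    rewrite [X in (X <= _)%N]big_mkcond [X in (_ <= X)%N]big_mkcond.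
    apply: leq_sum => Psi _; case: ifP => //; rewrite inE => /andP[/=].
    rewrite inE => /forallP h ->; rewrite andbT ifT; last first.
      by rewrite inE; apply/forallP => u; have := h u; rewrite inE => /andP[].
    rewrite inE yM; apply: leq_trans (leqnn 1) _; rewrite lt0b.
    by apply/forallP => u; have := h u; rewrite inE => /andP[].
  rewrite exchange_big /=.
  apply: (@le_trans _ _ (\sum_(Psi in tuples (M l)) thr)).
    rewrite big_mkcondr /=; apply: ler_sum => Psi _; case: ifP => [h|_]; last first.
      by rewrite !mulr_ge0 ?exprn_ge0 ?divr_ge0 ?ltW.
    apply: le_trans (ltW h); rewrite -natr_sum ler_nat -sum1_card.
    rewrite [X in (X <= _)%N]big_mkcond [X in (_ <= X)%N]big_mkcond.
    by apply: leq_sum => y _; case: ifP => // _; case: ifP.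
  by rewrite sumr_const card_tuples -[X in X <= _]mulr_natl natrX.
have [y yg hy] : exists2 y, y \in good &
    #|bad_tuples W y l thr|%:R <= eps * #|section W y l|%:R ^+ b.
  suff : ~~ [forall y in good, eps * #|section W y l|%:R ^+ b <
      #|bad_tuples W y l thr|%:R].
    by case/forall_inPn => y yg; rewrite -leNgt => h; exists y.
  apply/negP => /forall_inP H.
  have g0 : (0 < #|good|)%N.
    by rewrite -(ltr0n R); apply: lt_le_trans goodB; rewrite mulr_gt0 ?divr_gt0.
  have [y0 y0g] := card_gt0P g0.
  have H1 : \sum_(y in good) (eps * (c / 2 * m) ^+ b) < \sum_(y in good) #|bad_tuples W y l thr|%:R.
    apply: ltr_sum; first by apply/hasP; exists y0; rewrite ?mem_index_enum.
    move=> y yg; apply: le_lt_trans (H _ yg); apply: ler_wpM2l; first exact: ltW.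
    move: yg; rewrite inE => /andP[_ h]; apply: lerXn2r => //; rewrite nnegrE //.
    by rewrite mulr_ge0 ?divr_ge0 // ltW.
  have H2 : \sum_(y in good) #|bad_tuples W y l thr|%:R <= m ^+ b * thr.
    apply: le_trans sumbad; rewrite [X in X <= _]big_mkcond [X in _ <= X]big_mkcond.
    apply: ler_sum => y _; rewrite [y \in good]inE; case: (y \in box M) => //=.
    by case: ifP.
  have := lt_le_trans H1 H2; apply/negP; rewrite -leNgt.
  rewrite sumr_const -[X in _ <= X]mulr_natl.
  have -> : m ^+ b * thr = c / 2 * B * (eps * (c / 2 * m) ^+ b).
    rewrite /thr; move: (c / 2) => h; rewrite exprS exprMn.
    by move: (m ^+ b) (h ^+ b) => z1 z2; ring.
  by apply: ler_wpM2r goodB; rewrite mulr_ge0 ?exprn_ge0 ?mulr_ge0 ?divr_ge0 // ltW.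
by exists y; split=> //; move: yg; rewrite inE => /andP[].
Qed.

(** The density that remains after [i] rounds of [dependent_choice] followed by the choice of a
    tuple that is not bad. *)
Fixpoint density_seq (c eps : R) (i : nat) : R :=
  if i is j.+1 then eps * (density_seq c eps j / 2) ^+ #|U|.+1 else c.

Lemma density_seq_gt0 c eps i : 0 < c -> 0 < eps -> 0 < density_seq c eps i.
Proof. by move=> c0 e0; elim: i => //= i IH; rewrite mulr_gt0 ?exprn_gt0 ?divr_gt0. Qed.

(** The second round is a single random object, while the choices are made one after the other. So
    the hypothesis demands a good found tuple after every possible history [Phi] and at every
    admissible [y]; [round_two] secures this by a union bound over the pairs. *)
Lemma adaptive_choice W (ls : seq L) (c eps : R) (i : nat) (found : L -> pred {ffun U -> F}) :
  uniq ls -> W \subset box M -> (forall l, 0 < #|M l|)%N -> 0 < c -> 0 < eps ->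
  density_seq c eps i * #|box M|%:R <= #|W|%:R ->
  (forall ps l rest Phi y, ls = ps ++ l :: rest ->
     let ci := density_seq c eps (i + size ps) in
     let W' := refines W Phi ps in
     let bad := bad_tuples W' y l (eps * (ci / 2) ^+ #|U|.+1 * #|box M|%:R) in
     y \in box M -> ci / 2 * #|M l|%:R <= #|section W' y l|%:R ->
     #|bad|%:R <= eps * #|section W' y l|%:R ^+ #|U| ->
     exists2 Psi, found l Psi & Psi \in tuples (section W' y l) :\: bad) ->
  exists Phi, (forall l, l \in ls -> found l (Phi l)) /\ refines W Phi ls != set0.
Proof.
move=> uls WM M0 c0 e0.
have dB j : 0 < density_seq c eps j * #|box M|%:R.
  by rewrite mulr_gt0 ?density_seq_gt0 // ltr0n card_box prodn_gt0.
elim: ls W i uls WM => [|l ls IH] W i /= uls WM hW H.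
  have : (0 < #|W|)%N by rewrite -(ltr0n R); exact: lt_le_trans hW.
  rewrite card_gt0 => W0; have /set0Pn[t tW] := W0.
  have [Psi0|noU] := pickP (fun _ : {ffun L -> {ffun U -> F}} => true).
    by exists Psi0.
  by exists [ffun l => [ffun _ => t l]].
case/andP: uls => lls uls.
have [y [yM hy hb]] := dependent_choice l WM M0 (density_seq_gt0 i c0 e0) e0 hW.
have := H [::] l ls [ffun l => [ffun _ => y l]] y erefl.
rewrite /= addn0 => /(_ yM hy hb)[Psi fPsi].
rewrite inE => /andP[nbad PsiS].
have W1M : refine W l Psi \subset box M by apply/subsetP => t; rewrite inE => /andP[].
have W1d : density_seq c eps i.+1 * #|box M|%:R <= #|refine W l Psi|%:R.
  by move: nbad; rewrite inE PsiS /= -leNgt.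
have [|Phi [hPhi hne]] := IH _ i.+1 uls W1M W1d.
  move=> ps l' rest Phi y' lsE.
  pose Phi' : {ffun L -> {ffun U -> F}} := [ffun k => if k == l then Psi else Phi k].
  have E : refines (refine W l Psi) Phi ps = refines W Phi' (l :: ps).
    rewrite /= ffunE eqxx; apply: refines_ext => k kps; rewrite ffunE ifN //.
    by apply: contraNneq lls => <-; rewrite lsE mem_cat kps.
  rewrite addSnnS E.
  by apply: (H (l :: ps) l' rest Phi' y'); rewrite lsE.
exists [ffun k => if k == l then Psi else Phi k]; split.
  move=> k; rewrite inE ffunE; case: (eqVneq k l) => [-> _ //|kl] /= kls.
  exact: hPhi.
rewrite /= ffunE eqxx.
rewrite (@refines_ext _ _ Phi) // => k kls; rewrite ffunE ifN //.
by apply: contraNneq lls => <-.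
Qed.

End Adaptive.

(** * First round *)

Lemma card_exists_le (T I : finType) (A : I -> {set T}) :
  (#|[set y | [exists i, y \in A i]]| <= \sum_i #|A i|)%N.
Proof.
rewrite -sum1_card; under [X in (_ <= X)%N]eq_bigr do rewrite -sum1_card big_mkcond.
rewrite exchange_big /= big_mkcond; apply: leq_sum => y _; rewrite inE.
by case: existsP => // -[i yi]; rewrite (bigD1 i) //= yi.
Qed.

Lemma edges_in_cap (U : finType) (P : sgraph U) (J : {set U}) :
  edges_in P (J :&: vset P) = edges_in P J.
Proof.
apply: eq_card => x; rewrite !inE subsetI; case: (boolP (x \in eset P)) => //= xP.
by have [-> _] := edge_sub xP; rewrite andbT.
Qed.

Lemma card_noninj (U V : finType) (Y : {set V}) :
  (#|[set g : {ffun U -> V} | [forall u, g u \in Y] && ~~ injectiveb g]| <=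
   #|U| ^ 2 * #|Y| ^ (#|U| - 1))%N.
Proof.
pose C (p : U * U) := if p.1 == p.2 then set0 else
  [set g : {ffun U -> V} | [forall u, g u \in Y] && (g p.1 == g p.2)].
apply: (@leq_trans #|[set g | [exists p, g \in C p]]|).
  apply/subset_leq_card/subsetP => g; rewrite !inE => /andP[gY].
  move=> /injectivePn[u [u' uu' E]]; apply/existsP; exists (u, u').
  by rewrite /C /= (negPf uu') inE gY E eqxx.
apply: (leq_trans (card_exists_le _)).
have -> : (#|U| ^ 2 * #|Y| ^ (#|U| - 1) = \sum_(p : U * U) #|Y| ^ (#|U| - 1))%N.
  by rewrite sum_nat_const card_prod mulnn.
apply: leq_sum => -[u u'] _; rewrite /C /=; case: eqVneq => [_|uu']; first by rewrite cards0.
case: (set_0Vmem [set g : {ffun U -> V} | [forall u, g u \in Y] && (g u == g u')]) => [->|[g0]].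
  by rewrite cards0.
rewrite inE => /andP[/forallP g0Y _]; set x0 := g0 u.
pose er (g : {ffun U -> V}) : {ffun U -> V} := [ffun z => if z == u' then x0 else g z].
rewrite -(card_in_imset (f := er)); last first.
  move=> g h; rewrite !inE => /andP[_ /eqP gu] /andP[_ /eqP hu] /ffunP E.
  have ne z : z != u' -> g z = h z by move=> zu; have := E z; rewrite !ffunE (negPf zu).
  by apply/ffunP => z; case: (eqVneq z u') => [->|/ne//]; rewrite -gu -hu ne.
have -> : (#|Y| ^ (#|U| - 1) = #|[set g : {ffun U -> V} |
    [forall z, g z \in (if z \in [set u'] then [set x0] else Y)]]|)%N.
  by rewrite card_family2 !cards1 exp1n mul1n.
apply/subset_leq_card/subsetP => h /imsetP[g]; rewrite inE => /andP[/forallP gY _] ->.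
rewrite inE; apply/forallP => z; rewrite ffunE inE; case: ifP => _ //; exact: set11.
Qed.

Section OverlapBound.
Variables (R : realType) (U V : finType) (Y : {set V}) (P : sgraph U) (q lam : R).
Hypotheses (q0 : 0 < q) (q1 : q <= 1) (Y0 : (0 < #|Y|)%N) (lam0 : 0 < lam).

(** If every possible intersection pattern has at least [lam] expected copies, then the meeting
    pairs amount to a fraction of order [1 / lam] of the squared mean. *)
Lemma sum_pairs_le (Q : pred {set U}) :
  (forall J, Q J -> lam <= #|Y|%:R ^+ #|J| * q ^+ edges_in P J) ->
  \sum_(g in injmaps Y P) \sum_(h in injmaps Y P | Q (ovl P g h))
     q ^+ #|copyE P g :|: copyE P h| <=
  (#|Y|%:R ^+ #|U| * q ^+ e P) ^+ 2 * (#|U|%:R ^+ #|U| * 2 ^+ #|U|) / lam.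
Proof.
move=> HQ; apply: (le_trans (sum_pairs P q0 q1 Y0 Q)).
rewrite -[leRHS]mulrA -[leLHS]mulrA; apply: ler_wpM2l; first exact: sqr_ge0.
rewrite -mulrA; apply: ler_wpM2l; first exact: exprn_ge0.
have cU : #|{: {set U}}|%:R = 2 ^+ #|U| :> R.
  have E : [set: {set U}] = powerset [set: U] by apply/setP => J; rewrite !inE subsetT.
  by rewrite -natrX -(cardsT U) -card_powerset -E cardsT.
rewrite -cU; have iv : 0 <= lam^-1 by rewrite invr_ge0 ltW.
have N0 : 0 < #|Y|%:R :> R by rewrite ltr0n.
apply: (@le_trans _ _ (\sum_(J : {set U} | Q J) lam^-1)).
  apply: ler_sum => J QJ; rewrite lef_pV2 ?posrE ?HQ // mulr_gt0 ?exprn_gt0 //.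
rewrite sumr_const -[X in X <= _]mulr_natl; apply: ler_wpM2r => //.
by rewrite ler_nat max_card.
Qed.

Lemma overlap_le (A : {set {ffun U -> V}}) : A \subset injmaps Y P ->
  (forall J : {set U}, J \subset vset P -> (0 < edges_in P J)%N ->
     lam <= #|Y|%:R ^+ #|J| * q ^+ edges_in P J) ->
  overlap A (fun g : {ffun U -> V} => copyE P g) q <=
  (#|Y|%:R ^+ #|U| * q ^+ e P) ^+ 2 * (#|U|%:R ^+ #|U| * 2 ^+ #|U|) / lam.
Proof.
move=> AI HJ; set Q := fun J : {set U} => (J \subset vset P) && (0 < edges_in P J)%N.
have HQ J : Q J -> lam <= #|Y|%:R ^+ #|J| * q ^+ edges_in P J by case/andP; exact: HJ.
apply: le_trans (sum_pairs_le HQ).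
have t0 (g h : {ffun U -> V}) : 0 <= q ^+ #|copyE P g :|: copyE P h| by rewrite exprn_ge0 // ltW.
rewrite /overlap [X in X <= _]big_mkcond [X in _ <= X]big_mkcond.
apply: ler_sum => g _; case: (boolP (g \in A)) => gA; last first.
  by case: ifP => // _; apply: sumr_ge0 => h _.
rewrite (subsetP AI _ gA) [X in X <= _]big_mkcond [X in _ <= X]big_mkcond.
apply: ler_sum => h _; case: (boolP (h \in A)) => hA /=; last by case: ifP.
rewrite (subsetP AI _ hA) /=; case: (boolP [disjoint _ & _]) => //= nd; first by case: ifP.
rewrite ifT //; apply/andP; split; first by apply/subsetP => u; rewrite inE => /andP[].
move: nd; rewrite -setI_eq0 => /set0Pn[f /setIP[fg /imsetP[x xP fE]]].
rewrite card_gt0; apply/set0Pn; exists x; rewrite inE xP inE.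
have [_ ->] := edge_sub xP; rewrite andbT.
by apply: (copyE_meet_ovl xP); rewrite -fE.
Qed.

End OverlapBound.

Section UnionPattern.
Variables (L U : finType) (P : L -> sgraph U).

Definition union_edges : {set {set L * U}} :=
  [set y | [exists l, y \in [set pair l @: (x : {set U}) | x in eset (P l)]]].

Lemma union_pattern_subproof : union_edges \subset pairs [set p : L * U | p.2 \in vset (P p.1)].
Proof.
apply/subsetP => y; rewrite inE => /existsP[l /imsetP[x xP ->]].
have [xV x2] := edge_sub xP; rewrite inE card_imset ?x2; last by move=> ? ? [].
rewrite andbT; apply/subsetP => p /imsetP[u ux ->]; rewrite inE /=.
exact: (subsetP xV).
Qed.

(** The disjoint union of all patterns: a tuple of copies, one for each [l], becomes a copy of a
    single pattern, to which the second moment method applies. *)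
Definition union_pattern : sgraph (L * U)%type :=
  @SGraph _ ([set p : L * U | p.2 \in vset (P p.1)], union_edges) union_pattern_subproof.

Definition layer (J : {set L * U}) l : {set U} := [set u | (l, u) \in J].

Lemma card_layers (J : {set L * U}) : #|J| = (\sum_l #|layer J l|)%N.
Proof.
rewrite -sum1_card; under [RHS]eq_bigr do rewrite -sum1_card.
rewrite pair_big_dep /=; apply: eq_bigl => -[l u]; by rewrite inE.
Qed.

Lemma edges_in_union (J : {set L * U}) :
  (edges_in union_pattern J <= \sum_l edges_in (P l) (layer J l))%N.
Proof.
apply: (@leq_trans (\sum_l #|[set pair l @: (x : {set U}) | x in eset (P l) :&: pairs (layer J l)]|)).
  apply: leq_trans (card_exists_le _); apply/subset_leq_card/subsetP => y.
  rewrite inE inE => /andP[/existsP[l /imsetP[x xP ->]]]; rewrite inE => /andP[yJ _].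
  rewrite inE; apply/existsP; exists l; apply: imset_f; rewrite !inE xP /=.
  have [_ ->] := edge_sub xP; rewrite andbT; apply/subsetP => u ux; rewrite inE.
  by apply: (subsetP yJ); apply: imset_f.
by apply: leq_sum => l _; exact: leq_imset_card.
Qed.

Lemma copyE_union (V : finType) (f : {ffun L * U -> V}) l (K : {set {set V}}) :
  copyE union_pattern f \subset K -> copyE (P l) (fun u => f (l, u)) \subset K.
Proof.
move=> fK; apply/subsetP => y /imsetP[x xP ->]; apply: (subsetP fK).
apply/imsetP; exists (pair l @: x); last by rewrite -imset_comp.
by rewrite inE; apply/existsP; exists l; exact: imset_f.
Qed.

End UnionPattern.

Section RoundOne.
Variables (R : realType) (V U L : finType) (G : sgraph V) (k : nat).
Variables (part : L -> 'I_k) (P : L -> sgraph U) (x : L -> R) (b0 K q c a : R).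
Notation F := {ffun U -> V}.
Let n : R := #|V|%:R.
Let b := #|U|.
Let ss := enum (pairs [set: V]).
Hypotheses (b0_gt0 : 0 < b0) (x0 : forall l, 0 <= x l) (K1 : 1 <= K) (q0 : 0 < q) (q1 : q <= 1).
Hypotheses (V0 : (0 < #|V|)%N) (nE : n = (K / q) `^ b0) (vG : vset G = [set: V]).
Hypothesis hP : forall l, (0 < v (P l))%N.
Hypothesis hx : forall l (J : {set U}), J \subset vset (P l) -> J != set0 ->
  (edges_in (P l) J)%:R + x l <= b0 * #|J|%:R.

Definition complete : {set {ffun L -> F}} :=
  [set t : {ffun L -> F} | [forall l, forall l', (part l != part l') ==>
     [forall u, forall u', adj G (t l u) (t l' u')]]].

Definition copies (E : {set {set V}}) l : {set F} :=
  [set g : F | injP (P l) g && (copyE (P l) g \subset E)].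

Definition meets l : rel F :=
  fun g h => ~~ [disjoint g @: vset (P l) & h @: vset (P l)].

Definition meeting E l : {set F * F} :=
  [set p in setX (copies E l) (copies E l) | meets l p.1 p.2].

(** [nu l] bounds from below the expected number of copies of every non-empty part of [P l], and
    thereby the number of disjoint copies that thinning can keep. [mu l] is the expected number of
    copies, up to injectivity. *)
Let nu l := K `^ b0 * q `^ (- x l).
Let mu l := n ^+ b * q ^+ e (P l).
Let C3 : R := b%:R ^+ b * 2 ^+ b.

Let n0 : 0 < n. Proof. by rewrite ltr0n. Qed.

Let nX j m : n ^+ j * q ^+ m = K `^ (b0 * j%:R) * q `^ (m%:R - b0 * j%:R).
Proof.
have Kp : 0 < K by exact: lt_le_trans K1.
rewrite nE -powR_mulrn ?powR_ge0 // -powRrM powRM ?invr_ge0 ?ltW //.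
rewrite -mulrA; congr (_ * _); rewrite -powR_inv1 ?ltW // -powRrM mulN1r.
rewrite -powR_mulrn ?ltW // -powRD; first by rewrite addrC.
by apply/implyP => _; rewrite gt_eqF.
Qed.

Lemma nu_le l (J : {set U}) : J \subset vset (P l) -> J != set0 ->
  nu l <= n ^+ #|J| * q ^+ edges_in (P l) J.
Proof.
move=> JP J0; rewrite nX; have := hx JP J0 => h.
have J1 : 1 <= #|J|%:R :> R by rewrite (ler_nat R 1) card_gt0.
apply: ler_pM; rewrite ?powR_ge0 //.
  by apply: ler_powR => //; rewrite ler_peMr // ltW.
by apply: ger_powR; [rewrite q0|move: h; lra].
Qed.

Let PL := union_pattern P.

Lemma edges_union_le (J : {set L * U}) : (edges_in PL J)%:R <= b0 * #|J|%:R.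
Proof.
apply: (@le_trans _ _ (\sum_l edges_in (P l) (layer J l))%:R).
  by rewrite ler_nat edges_in_union.
rewrite card_layers !natr_sum big_distrr /=; apply: ler_sum => l _.
rewrite -edges_in_cap; set J' := _ :&: _.
have J'J : #|J'|%:R <= #|layer J l|%:R :> R by rewrite ler_nat subset_leq_card // subsetIl.
apply: (@le_trans _ _ (b0 * #|J'|%:R)); last by apply: ler_wpM2l => //; exact: ltW.
case: (eqVneq J' set0) => [->|J'0].
  by rewrite edges_in0 ?cards0 // mulr0.
by have := hx (subsetIr _ _ : J' \subset vset (P l)) J'0; have := x0 l; lra.
Qed.

(** This is the second moment condition for the systems of copies: the relative variance is of order
    [1 / K]. *)
Lemma union_weight (J : {set L * U}) : (0 < edges_in PL J)%N ->
  K <= n ^+ #|J| * q ^+ edges_in PL J.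
Proof.
move=> J0; have Kp : 0 < K by exact: lt_le_trans K1.
rewrite nX; have := edges_union_le J; have : 1 <= (edges_in PL J)%:R :> R by rewrite (ler_nat R 1).
move=> h1 h2; rewrite -[leLHS]mulr1; apply: ler_pM => //; first exact: ltW.
  by have := ler_powR K1 (le_trans h1 h2); rewrite powRr1 ?(ltW Kp).
have q01 : 0 < q <= 1 by rewrite q0.
have h3 : (edges_in PL J)%:R - b0 * #|J|%:R <= 0 by rewrite subr_le0.
by have := ger_powR q01 h3; rewrite powRr0.
Qed.

Hypotheses (c0 : 0 < c) (a1 : 1 <= a).
Hypothesis hhom : c * n ^+ #|{: L * U}| <= #|homs G (fun p : L * U => part p.1)|%:R.
Hypothesis hn : 2 * #|{: L * U}|%:R ^+ 2 <= c * n.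

(** From [c] one half is lost to non-injective maps and one half to Chebyshev; [a] is the factor by
    which Markov lets each count exceed its mean bound. [C2] compares the number of meeting pairs so
    allowed with the square of [c1 * mu l]. *)
Let c1 := c / 4 / a ^+ #|L|.
Let C2 := a * C3 / c1 ^+ 2.

Definition rich (E : {set {set V}}) : bool :=
  [&& c1 * (\prod_l #|copies E l|)%:R <= #|complete :&: box (copies E)|%:R,
      [forall l, #|meeting E l|%:R * nu l <= C2 * #|copies E l|%:R ^+ 2] &
      [forall l, 0 < #|copies E l|]%N].

Let A := [set f in homs G (fun p : L * U => part p.1) | injectiveb f].
Let eA (f : {ffun L * U -> V}) := copyE PL f.

Let ag0 : 0 < a. Proof. exact: lt_le_trans a1. Qed.
Let c1g0 : 0 < c1. Proof. by rewrite !divr_gt0 ?exprn_gt0. Qed.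
Let mu0 l : 0 < mu l. Proof. by rewrite mulr_gt0 ?exprn_gt0. Qed.

Let injA : A \subset injmaps [set: V] PL.
Proof.
apply/subsetP => f; rewrite !inE => /andP[_ /injectiveP fi]; apply/andP; split.
  by apply/forallP => u; rewrite inE.
by apply/injPP => p p' _ _; exact: fi.
Qed.

Let cardA : c / 2 * n ^+ #|{: L * U}| <= #|A|%:R.
Proof.
have hh := hhom; have hn' := hn; rewrite /A; set H := homs _ _ in hh *.
set m := #|{: L * U}| in hh hn' *.
have h1 : (#|H| <= #|[set f in H | injectiveb f]| + m ^ 2 * #|[set: V]| ^ (m - 1))%N.
  apply: (leq_trans _ (leq_add (leqnn _) (card_noninj _ _))).
  rewrite -(cardsID [set f : {ffun L * U -> V} | injectiveb f] H); apply: leq_add.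
    by apply/subset_leq_card/subsetP => f /setIP[fH]; rewrite inE => fi; rewrite inE fH.
  apply/subset_leq_card/subsetP => f /setDP[_]; rewrite [f \in [set _ | injectiveb _]]inE [f \in [set _ | _]]inE => ->; rewrite andbT.
  by apply/forallP => u; rewrite inE.
have h2 : (m ^ 2 * #|[set: V]| ^ (m - 1))%:R <= c / 2 * n ^+ m.
  rewrite cardsT natrM !natrX -/n; case: (posnP m) => [m0|mg].
    by rewrite m0 expr0n mul0r expr0 mulr1 divr_ge0 // ltW.
  have -> : n ^+ m = n * n ^+ (m - 1) by rewrite -exprS subn1 prednK.
  rewrite mulrA; apply: ler_wpM2r; first by rewrite exprn_ge0 // ltW.
  by move: hn'; lra.
have : #|H|%:R <= #|[set f in H | injectiveb f]|%:R + (m ^ 2 * #|[set: V]| ^ (m - 1))%:R :> R.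
  by rewrite -natrD ler_nat.
by move: hh h2; lra.
Qed.

Let eAs f : f \in A -> eA f \subset ss.
Proof.
rewrite inE => /andP[_ /injectiveP fi]; apply/subsetP => y yf; rewrite mem_enum.
apply: (subsetP _ _ yf); apply: copyE_pairs; last exact: subsetT.
by move=> p p' _ _; exact: fi.
Qed.

Let meanA : c / 2 * \prod_l mu l <= mean A eA q.
Proof.
have Pm : \prod_l mu l <= n ^+ #|{: L * U}| * q ^+ e PL.
  rewrite /mu big_split /= prodr_const -exprM card_prod mulnC -expr_sum.
  apply: ler_wpM2l; first by rewrite exprn_ge0 // ltW.
  apply: ler_wiXn2l; [exact: ltW|exact: q1|].
  rewrite -edges_in_vset (leq_trans (edges_in_union _ _)) //.
  by apply: leq_sum => l _; exact: edges_in_le.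
apply: (@le_trans _ _ (c / 2 * (n ^+ #|{: L * U}| * q ^+ e PL))).
  by apply: ler_wpM2l Pm; rewrite divr_ge0 // ltW.
rewrite /mean (eq_bigr (fun=> q ^+ e PL)); last first.
  by move=> f /(subsetP injA); rewrite inE => /andP[_ /injPP fi]; rewrite /eA card_copyE.
rewrite sumr_const -[X in _ <= X]mulr_natl mulrA; apply: ler_wpM2r cardA.
by rewrite exprn_ge0 // ltW.
Qed.

Let mean0 : 0 < mean A eA q.
Proof.
apply: lt_le_trans meanA; rewrite mulr_gt0 ?divr_gt0 //.
by apply: prodr_gt0 => l _.
Qed.

Let C5 : R := #|{: L * U}|%:R ^+ #|{: L * U}| * 2 ^+ #|{: L * U}|.

Let few_homs : Ex q ss (fun E => (cnt R A eA E < mean A eA q / 2)%R%:R) <= 16 * C5 / c ^+ 2 / K.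
Proof.
have Kp : 0 < K by exact: lt_le_trans K1.
apply: (le_trans (chebyshev_half (enum_uniq _) eAs _ mean0)); first by rewrite ltW.
have VT : (0 < #|[set: V]|)%N by rewrite cardsT.
have ov : overlap A eA q <= (n ^+ #|{: L * U}| * q ^+ e PL) ^+ 2 * C5 / K.
  have := overlap_le q0 q1 VT Kp injA; rewrite cardsT -/n; apply=> J _ J0.
  exact: union_weight.
have mlow : c / 2 * (n ^+ #|{: L * U}| * q ^+ e PL) <= mean A eA q.
  rewrite /mean (eq_bigr (fun=> q ^+ e PL)); last first.
    by move=> f /(subsetP injA); rewrite inE => /andP[_ /injPP fi]; rewrite /eA card_copyE.
  rewrite sumr_const -[X in _ <= X]mulr_natl mulrA; apply: ler_wpM2r cardA.
  by rewrite exprn_ge0 // ltW.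
set z := n ^+ _ * q ^+ _ in ov mlow.
have z0 : 0 < z by rewrite mulr_gt0 ?exprn_gt0.
rewrite ler_pdivrMr ?exprn_gt0 //.
apply: (@le_trans _ _ (16 * C5 / c ^+ 2 / K * (c / 2 * z) ^+ 2)).
  have -> : 16 * C5 / c ^+ 2 / K * (c / 2 * z) ^+ 2 = 4 * (z ^+ 2 * C5 / K).
    by field; rewrite !gt_eqF.
  by rewrite ler_pM2l.
apply: ler_wpM2l; first by rewrite !divr_ge0 ?mulr_ge0 ?exprn_ge0 // ltW.
by apply: lerXn2r mlow; rewrite nnegrE; [rewrite mulr_ge0 ?divr_ge0 ?(ltW c0) ?(ltW z0)|exact: ltW].
Qed.

Let many_copies l : Ex q ss (fun E => (a * mu l <= #|copies E l|%:R)%R%:R) <= a^-1.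
Proof.
have q01 : 0 <= q <= 1 by rewrite ltW.
have am0 : 0 < a * mu l by rewrite mulr_gt0.
apply: (le_trans (Ex_markov _ q01 am0 _)) => //.
rewrite (ler_pdivrMr _ _ am0) mulKf ?gt_eqF //.
have E1 (E : {set {set V}}) : #|copies E l|%:R =
   \sum_(g in injmaps [set: V] (P l)) (copyE (P l) g \subset E)%:R :> R.
  rewrite -natr_sum -sum1_card; congr _%:R; rewrite [LHS]big_mkcond [RHS]big_mkcond.
  apply: eq_bigr => g _; rewrite !inE.
  have -> : [forall u, g u \in [set: V]] by apply/forallP => u; rewrite inE.
  by case: (injP (P l) g); case: (copyE (P l) g \subset E).
rewrite (eq_Ex _ _ E1) Ex_sum.
rewrite (eq_bigr (fun=> q ^+ e (P l))); last first.
  move=> g; rewrite inE => /andP[_ /injPP gi]; rewrite Ex_subE ?enum_uniq ?card_copyE //.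
  apply/subsetP => y yf; rewrite mem_enum; apply: (subsetP _ _ yf).
  by apply: copyE_pairs => //; exact: subsetT.
rewrite sumr_const -[X in X <= _]mulr_natl; apply: ler_wpM2r; first by rewrite exprn_ge0 // ltW.
by rewrite /n /b -natrX ler_nat -(cardsT V) card_injmaps.
Qed.

Let many_meetings l :
  Ex q ss (fun E => (a * (mu l ^+ 2 * C3 / nu l) <= #|meeting E l|%:R)%R%:R) <= a^-1.
Proof.
have q01 : 0 <= q <= 1 by rewrite ltW.
have nu0 : 0 < nu l by rewrite mulr_gt0 ?powR_gt0 // (lt_le_trans ltr01).
have b1 : (0 < b)%N by apply: leq_trans (hP l) _; exact: max_card.
have C30 : 0 < C3 by rewrite mulr_gt0 ?exprn_gt0 // ltr0n.
have B0 : 0 < mu l ^+ 2 * C3 / nu l.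
  by apply: divr_gt0 nu0; apply: mulr_gt0 C30; exact: exprn_gt0.
have am0 : 0 < a * (mu l ^+ 2 * C3 / nu l) by rewrite mulr_gt0.
apply: (le_trans (Ex_markov _ q01 am0 _)) => //.
rewrite (ler_pdivrMr _ _ am0) mulKf ?gt_eqF //.
have E1 (E : {set {set V}}) : #|meeting E l|%:R =
   \sum_(g in injmaps [set: V] (P l)) \sum_(h in injmaps [set: V] (P l) | meets l g h)
     (copyE (P l) g :|: copyE (P l) h \subset E)%:R :> R.
  rewrite pair_big_dep /= -natr_sum -sum1_card; congr _%:R; rewrite [LHS]big_mkcond [RHS]big_mkcond.
  apply: eq_bigr => -[g h] _; rewrite !inE /= subUset.
  have T (g' : F) : [forall u, g' u \in [set: V]] by apply/forallP => u; rewrite inE.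
  rewrite !T /=; 
  by case: (injP (P l) g); case: (injP (P l) h); case: (copyE (P l) g \subset E); case: (copyE (P l) h \subset E);
    case: (meets l g h).
rewrite (eq_Ex _ _ E1) Ex_sum.
have VT : (0 < #|[set: V]|)%N by rewrite cardsT.
have HQ (J : {set U}) : (J \subset vset (P l)) && (J != set0) ->
    nu l <= #|[set: V]|%:R ^+ #|J| * q ^+ edges_in (P l) J.
  by rewrite cardsT => /andP[h1 h2]; exact: nu_le.
have := sum_pairs_le q0 q1 VT nu0 HQ; rewrite cardsT -/n -/b -/(mu l) -/C3; apply: le_trans.
apply: ler_sum => g gI; rewrite Ex_sum [X in X <= _]big_mkcond [X in _ <= X]big_mkcond.
have pi (g' : F) : g' \in injmaps [set: V] (P l) -> copyE (P l) g' \subset ss.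
  rewrite inE => /andP[_ /injPP gi]; apply/subsetP => y yf; rewrite mem_enum; apply: (subsetP _ _ yf).
  by apply: copyE_pairs => //; exact: subsetT.
apply: ler_sum => h _; case: (boolP (h \in injmaps _ _)) => //= hI.
case: (boolP (meets l g h)) => m; last by case: ifP => // _; rewrite exprn_ge0 // ltW.
rewrite Ex_subE ?enum_uniq //; last by apply: subUs; exact: pi.
rewrite ifT //; apply/andP; split; first by apply/subsetP => u; rewrite inE => /andP[].
move: m; rewrite /meets -setI_eq0 => /set0Pn[y /setIP[yg /imsetP[u uP yu]]].
by apply/set0Pn; exists u; rewrite inE uP -yu.
Qed.

Let rich_of E : ~~ (cnt R A eA E < mean A eA q / 2) ->
  (forall l, ~~ (a * mu l <= #|copies E l|%:R)) ->
  (forall l, ~~ (a * (mu l ^+ 2 * C3 / nu l) <= #|meeting E l|%:R)) -> rich E.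
Proof.
rewrite -leNgt => hZ hN hD.
have hN' l : #|copies E l|%:R <= a * mu l by rewrite ltW // ltNge.
have Zle : cnt R A eA E <= #|complete :&: box (copies E)|%:R.
  pose cur (f : {ffun L * U -> V}) : {ffun L -> F} := [ffun l => [ffun u => f (l, u)]].
  have curi : injective cur.
    move=> f g /ffunP E'; apply/ffunP => -[l u]; have := E' l; rewrite !ffunE => /ffunP/(_ u).
    by rewrite !ffunE.
  have -> : cnt R A eA E = #|[set f in A | eA f \subset E]|%:R.
    rewrite /cnt -natr_sum -sum1_card; congr _%:R; rewrite [LHS]big_mkcond [RHS]big_mkcond.
    by apply: eq_bigr => f _; rewrite [f \in [set _ in _ | _]]inE; case: (f \in A); case: (_ \subset _).
  rewrite ler_nat -(card_imset _ curi); apply/subset_leq_card/subsetP => t /imsetP[f].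
  rewrite inE => /andP[]; rewrite inE => /andP[/homsP[_ fA] /injectiveP fi] fE ->.
  rewrite inE; apply/andP; split.
    rewrite inE; apply/forallP => l; apply/forallP => l'; apply/implyP => ll.
    by apply/forallP => u; apply/forallP => u'; rewrite !ffunE; exact: fA.
  apply/boxP => l; rewrite ffunE inE; apply/andP; split.
    by apply/injPP => u u' _ _; rewrite !ffunE => /fi[].
  have -> : copyE (P l) [ffun u => f (l, u)] = copyE (P l) (fun u => f (l, u)).
    by apply: eq_imset => y; apply: eq_imset => u; rewrite ffunE.
  exact: copyE_union fE.
have low : c / 4 * \prod_l mu l <= #|complete :&: box (copies E)|%:R.
  by apply: le_trans (le_trans hZ Zle); move: meanA; lra.
have prodle : (\prod_l #|copies E l|)%:R <= a ^+ #|L| * \prod_l mu l.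
  rewrite natr_prod -(prodr_const (mem L) a) -big_split /=; apply: ler_prod => l _.
  by rewrite ler0n hN'.
(* The lower bound for one coordinate comes from the upper bounds for the others: with few copies
   there, the joined systems could not be so many. *)
have Nlow l : c1 * mu l <= #|copies E l|%:R.
  have Zp : #|complete :&: box (copies E)|%:R <= (\prod_l #|copies E l|)%:R :> R.
    by rewrite -card_box ler_nat subset_leq_card // subsetIr.
  have Pm0 : 0 < \prod_(l' | l' != l) mu l' by apply: prodr_gt0.
  rewrite -(ler_pM2r Pm0) -(ler_pM2r (exprn_gt0 #|L| ag0)).
  have -> : c1 * mu l * \prod_(l' | l' != l) mu l' * a ^+ #|L| = c / 4 * \prod_l mu l.
    rewrite [in RHS](bigD1 l) //= /c1; move: (\prod_(_ | _) _) (exprn_gt0 #|L| ag0).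
    by move: (a ^+ _) => z y z0; field; rewrite gt_eqF.
  apply: (le_trans (le_trans low Zp)); rewrite (bigD1 l) //= natrM -mulrA; apply: ler_wpM2l => //.
  rewrite natr_prod mulrC; apply: (@le_trans _ _ (\prod_(l' | l' != l) (a * mu l'))).
    by apply: ler_prod => l' _; rewrite ler0n hN'.
  rewrite big_split /= prodr_const; apply: ler_wpM2r; first exact: ltW.
  by apply: ler_weXn2l => //; exact: max_card.
apply/and3P; split.
- apply: le_trans low; rewrite /c1.
  have aL : 0 < a ^+ #|L| by exact: exprn_gt0.
  have -> : c / 4 * \prod_l mu l = c / 4 / a ^+ #|L| * (a ^+ #|L| * \prod_l mu l).
    by move: aL; move: (a ^+ _) (\prod_l _) => z y z0; field; rewrite gt_eqF.
  by apply: ler_wpM2l prodle; exact: ltW.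
- apply/forallP => l.
  have nu0 : 0 < nu l by rewrite mulr_gt0 ?powR_gt0 // (lt_le_trans ltr01).
  have hD' : #|meeting E l|%:R <= a * (mu l ^+ 2 * C3 / nu l) by rewrite ltW // ltNge.
  rewrite -ler_pdivlMr //; apply: (le_trans hD').
  have -> : C2 * #|copies E l|%:R ^+ 2 / nu l = a * C3 / nu l * (#|copies E l|%:R / c1) ^+ 2.
    by rewrite /C2; move: c1g0; move: c1 => z z0; field; rewrite !gt_eqF.
  have -> : a * (mu l ^+ 2 * C3 / nu l) = a * C3 / nu l * mu l ^+ 2 by ring.
  apply: ler_wpM2l.
    apply: divr_ge0; last exact: ltW.
    by apply: mulr_ge0; [exact: ltW|rewrite mulr_ge0 ?exprn_ge0].
  apply: lerXn2r; rewrite ?nnegrE; [exact: ltW|by rewrite divr_ge0 // ltW|].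
  by rewrite ler_pdivlMr // mulrC Nlow.
apply/forallP => l; rewrite -(ltr0n R); apply: lt_le_trans (Nlow l).
by rewrite mulr_gt0.
Qed.

Lemma round_one :
  Ex q ss (fun E => (~~ rich E)%:R) <= 16 * C5 / c ^+ 2 / K + 2 * #|L|%:R / a.
Proof.
have q01 : 0 <= q <= 1 by rewrite ltW.
pose f E : R := (cnt R A eA E < mean A eA q / 2)%R%:R +
  \sum_l ((a * mu l <= #|copies E l|%:R)%R%:R + (a * (mu l ^+ 2 * C3 / nu l) <= #|meeting E l|%:R)%R%:R).
apply: (@le_trans _ _ (Ex q ss f)).
  apply: ler_Ex => // E; case: (boolP (rich E)) => [_|nr].
    by rewrite addr_ge0 // sumr_ge0 // => l _; rewrite addr_ge0.
  rewrite /f; case: (boolP (cnt R A eA E < _)) => h1.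
    by rewrite lerDl sumr_ge0 // => l _; rewrite addr_ge0.
  rewrite add0r; case: (boolP [exists l, (a * mu l <= #|copies E l|%:R) ||
      (a * (mu l ^+ 2 * C3 / nu l) <= #|meeting E l|%:R)]) => [/existsP[l hl]|/existsPn H].
    rewrite (bigD1 l) //= -[X in X <= _]addr0; apply: lerD; last first.
      by rewrite sumr_ge0 // => l' _; rewrite addr_ge0.
    by case/orP: hl => ->; rewrite ?lerDl ?lerDr.
  by case/negP: nr; apply: rich_of => // l; have := H l; rewrite negb_or => /andP[].
rewrite ExD Ex_sum; apply: lerD; first exact: few_homs.
apply: (@le_trans _ _ (\sum_(l : L) (a^-1 + a^-1))).
  apply: ler_sum => l _; rewrite ExD; apply: lerD; first exact: many_copies.
  exact: many_meetings.
rewrite sumr_const -[X in X <= _]mulr_natl le_eqVlt; apply/orP; left; apply/eqP.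
by rewrite cardT -cardE; ring.
Qed.

End RoundOne.

(** * Second round: one coordinate *)

Lemma overlap_gt0 (R : realFieldType) (X I : finType) (A : {set I}) (e : I -> {set X})
    (q : R) i : 0 < q -> i \in A -> e i != set0 -> 0 < overlap A e q.
Proof.
move=> q0 iA ei; rewrite /overlap (bigD1 i) //= (bigD1 i) /=; last by rewrite iA -setI_eq0 setIid.
rewrite -addrA ltr_pwDl ?exprn_gt0 // addr_ge0 //; apply: sumr_ge0 => j _.
  by rewrite exprn_ge0 // ltW.
by apply: sumr_ge0 => k _; rewrite exprn_ge0 // ltW.
Qed.

Section RoundTwo.
Variables (R : realType) (V U : finType) (r : nat).
Variables (B : 'I_r -> sgraph U) (i1 : 'I_r) (E1 : {set {set V}}).
Notation F := {ffun U -> V}.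
Let b := #|U|.
Let ss := enum (pairs [set: V]).

Definition spread (Psi : {ffun U -> F}) : {set V} := \bigcup_u (Psi u @: [set: U]).

(* The second round looks for a monochromatic copy anywhere in the vertices used
   by the tuple [Psi] of first-round copies. *)
Definition found (cc : {ffun V -> 'I_r}) (E : {set {set V}}) (Psi : {ffun U -> F}) : bool :=
  [exists j, [exists g : F, [&& injP (B j) g, copyE (B j) g \subset E,
    g @: vset (B j) \subset spread Psi & [forall u in vset (B j), cc (g u) == j]]]].

Variables (S : {set F}) (bad : {set {ffun U -> F}}) (x q eps kappa : R).
Let P := B i1.
Hypothesis SP : forall g, g \in S -> injP P g && (copyE P g \subset E1).
Hypothesis Sdis : forall g h, g \in S -> h \in S -> g != h ->
  [disjoint g @: vset P & h @: vset P].
Hypothesis P0 : (0 < v P)%N.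
Hypotheses (x0 : 0 <= x) (q0 : 0 < q) (q1 : q <= 1) (eps0 : 0 < eps).
Hypothesis hB : forall j (J : {set U}), j != i1 -> J \subset vset (B j) -> J != set0 ->
  (edges_in (B j) J)%:R <= x * (#|J|%:R - 1).
Hypothesis hbad : #|bad|%:R <= eps * #|S|%:R ^+ b.
Hypothesis heps : eps * (2 * r%:R) ^+ b <= 4^-1.
Hypothesis S_large : 4 * b%:R ^+ 2 * (2 * r%:R) <= #|S|%:R :> R.
Hypothesis hkappa : kappa * (2 * r%:R) <= #|S|%:R * q `^ x.
Hypothesis kappa1 : 1 <= kappa.

Let C3 : R := b%:R ^+ b * 2 ^+ b.

Let r1 : 1 <= r%:R :> R. Proof. by rewrite (ler_nat R 1); case: i1 => i /=; case: r. Qed.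
Let r20 : 0 < 2 * r%:R :> R. Proof. by have := r1; lra. Qed.
Let b_gt0 : (0 < b)%N. Proof. by apply: leq_trans P0 _; exact: max_card. Qed.
Let S0 : 0 < #|S|%:R :> R.
Proof.
apply: lt_le_trans S_large; rewrite mulr_gt0 // mulr_gt0 // exprn_gt0 // ltr0n.
exact: b_gt0.
Qed.

Section Selection.
Variables (j : 'I_r) (sel : {ffun F -> option U}).

(** A marking [sel] picks at most one pattern vertex in each copy of [S]. Unlike the colourings of
    [V] these are few: [#|U| + 1] options for each member of [S]. *)
Definition selected : {set F} :=
  [set g in S | if sel g is Some u then u \in vset P else false].

Definition point (g : F) : option V := if sel g is Some u then Some (g u) else None.

Definition points : {set V} := [set y | [exists g in selected, point g == Some y]].

Definition owner (g0 : F) (y : V) : F :=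
  if [pick g in selected | point g == Some y] is Some g then g else g0.

Lemma point_inj g h y : g \in selected -> h \in selected ->
  point g = Some y -> point h = Some y -> g = h.
Proof.
rewrite !inE /point => /andP[gS]; case: (sel g) => // u uP /andP[hS].
case: (sel h) => // u' u'P [gy] [hy]; apply: contraTeq isT => gh.
have := Sdis gS hS gh; rewrite -setI_eq0 => /eqP/setP/(_ y).
by rewrite !inE -{1}gy -hy !imset_f.
Qed.

Lemma ownerP g0 y : y \in points -> owner g0 y \in selected /\ point (owner g0 y) = Some y.
Proof.
rewrite inE => /exists_inP[g gs gy]; rewrite /owner; case: pickP => [h /andP[hs /eqP //]|/(_ g)].
by rewrite gs gy.
Qed.

Lemma card_points : #|points| = #|selected|.
Proof.
case: (set_0Vmem selected) => [s0|[g0 g0s]].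
  rewrite s0 cards0; apply/eqP; rewrite cards_eq0 -subset0; apply/subsetP => y.
  by rewrite inE => /exists_inP[g]; rewrite s0 inE.
rewrite -(card_in_imset (f := owner g0) (D := mem points)); last first.
  move=> y z yp zp E; have [_ h1] := ownerP g0 yp; have [_ h2] := ownerP g0 zp.
  by rewrite E h2 in h1; case: h1.
apply: eq_card => g; apply/imsetP/idP => [[y yp ->]|gs]; first by have [] := ownerP g0 yp.
case gy : (point g) => [y|].
  have yp : y \in points by rewrite inE; apply/exists_inP; exists g; rewrite ?gy.
  exists y => //; have [h1 h2] := ownerP g0 yp; exact: point_inj gs h1 gy h2.
by move: gs gy; rewrite inE /point; case: (sel g) => [u|]; rewrite ?andbF.
Qed.

(** Possible positions of a copy on the marked points. The first-round copies that own the used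
    points must form a tuple that is not bad, so that the tuple can be chosen in
    [adaptive_choice]. *)
Definition good_maps g0 : {set F} :=
  [set g : F | [&& [forall u, g u \in points], injectiveb g &
     [ffun u => owner g0 (g u)] \notin bad]].

Hypothesis sel_large : #|S|%:R <= 2 * r%:R * #|selected|%:R :> R.

Let N : R := #|points|%:R.
Let NS : #|S|%:R <= 2 * r%:R * N. Proof. by rewrite /N card_points. Qed.
Let N0 : 0 < N.
Proof. by have := lt_le_trans S0 NS; rewrite pmulr_rgt0. Qed.

(** Since points determine their owners and conversely, distinct maps have distinct tuples of
    owners. At most a quarter of the maps is non-injective, by [S_large], and at most a quarter has
    a bad tuple, by [heps]. *)
Lemma card_good_maps g0 : N ^+ b / 2 <= #|good_maps g0|%:R.
Proof.
pose all := [set g : F | [forall u, g u \in points]].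
pose ni := [set g : F | [forall u, g u \in points] && ~~ injectiveb g].
pose bd := [set g : F | [forall u, g u \in points] && ([ffun u => owner g0 (g u)] \in bad)].
have hall : #|all| = (#|points| ^ b)%N by rewrite /all card_family_prod prod_nat_const.
have sub : (#|all| <= #|good_maps g0| + #|ni| + #|bd|)%N.
  apply: (@leq_trans #|good_maps g0 :|: ni :|: bd|); last first.
    apply: leq_trans (leq_card_setU _ _) _; rewrite leq_add2r; exact: leq_card_setU.
  apply/subset_leq_card/subsetP => g; rewrite !inE => gp; rewrite gp /=.
  by case: injectiveb => //=; case: (_ \in bad).
have hni : #|ni|%:R <= N ^+ b / 4.
  have := card_noninj U points; rewrite -(ler_nat R) natrM !natrX -/N -/b => h.
  have Nb : N ^+ b = N * N ^+ b.-1 by rewrite -exprS prednK.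
  apply: (le_trans h); rewrite subn1 Nb.
  have : 4 * b%:R ^+ 2 <= N.
    by rewrite -(ler_pM2r r20); apply: (le_trans S_large); rewrite mulrC [leRHS]mulrC mulrC.
  move: (exprn_ge0 b.-1 (ltW N0)); move: (N ^+ b.-1) => z z0; move: N (b%:R ^+ 2) => y w h'.
  have : 0 <= (y - 4 * w) * z by apply: mulr_ge0 z0; rewrite subr_ge0.
  by lra.
have hbd : #|bd|%:R <= N ^+ b / 4.
  apply: (@le_trans _ _ #|bad|%:R).
    rewrite ler_nat -(card_in_imset (f := fun g : F => [ffun u => owner g0 (g u)]) (D := mem bd)).
      by apply/subset_leq_card/subsetP => Psi /imsetP[g]; rewrite inE => /andP[_ ?] ->.
    move=> g h; rewrite !inE => /andP[/forallP gp _] /andP[/forallP hp _] /ffunP E.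
    apply/ffunP => u; have := E u; rewrite !ffunE => Eu.
    have [_ h1] := ownerP g0 (gp u); have [_ h2] := ownerP g0 (hp u).
    by rewrite Eu h2 in h1; case: h1.
  apply: (le_trans hbad); apply: (@le_trans _ _ (eps * (2 * r%:R * N) ^+ b)).
    apply: ler_wpM2l; first exact: ltW.
    by apply: lerXn2r NS; rewrite nnegrE ?ltW // mulr_gt0.
  rewrite exprMn mulrA mulrC; apply: ler_wpM2l heps.
  by rewrite exprn_ge0 // ltW.
have : N ^+ b <= #|good_maps g0|%:R + #|ni|%:R + #|bd|%:R.
  by rewrite /N -natrX -hall -!natrD ler_nat.
by lra.
Qed.

(** A part J of [B j] with an edge has at least N (N q^x)^(|J| - 1) expected copies on N points,
    which is at least [kappa * N] by [hkappa]. So Janson's exponent is a constant times [kappa * N],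
    and N is at least |S| / (2r). *)
Lemma selection_fails g0 : j != i1 -> (0 < e (B j))%N ->
  Ex q ss (fun E => [forall g in good_maps g0, ~~ (copyE (B j) g \subset E)]%:R) <=
  expR (- (kappa * #|S|%:R / (32 * r%:R * C3))).
Proof.
move=> ji ej; set A := good_maps g0.
have AI : A \subset injmaps points (B j).
  apply/subsetP => g; rewrite !inE => /and3P[-> /injectiveP gi _] /=.
  by apply/injPP => u u' _ _; exact: gi.
have pts0 : (0 < #|points|)%N by rewrite -(ltr0n R); exact: N0.
have kp : 0 < kappa by exact: lt_le_trans kappa1.
have C30 : 0 < C3 by rewrite mulr_gt0 ?exprn_gt0 // ltr0n b_gt0.
have inj g : g \in A -> {in vset (B j) &, injective g}.
  by move=> /(subsetP AI); rewrite inE => /andP[_ /injPP].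
have es g : g \in A -> copyE (B j) g \subset ss.
  move=> gA; apply/subsetP => y yf; rewrite mem_enum; apply: (subsetP _ _ yf).
  by apply: copyE_pairs; [exact: inj|exact: subsetT].
have e0 g : g \in A -> copyE (B j) g != set0.
  by move=> gA; rewrite -card_gt0 card_copyE //; exact: inj.
have lamP (J : {set U}) : J \subset vset (B j) -> (0 < edges_in (B j) J)%N ->
    kappa * N <= N ^+ #|J| * q ^+ edges_in (B j) J.
  move=> JB J0; have Jn : J != set0.
    by apply: contraTneq J0 => ->; rewrite edges_in0 ?cards0.
  have Jp : (0 < #|J|)%N by rewrite card_gt0.
  have hJ := hB ji JB Jn.
  have h1 : q `^ (x * (#|J|%:R - 1)) <= q ^+ edges_in (B j) J.
    by rewrite -(powR_mulrn _ (ltW q0)); apply: ger_powR hJ; rewrite q0.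
  have hk : kappa <= N * q `^ x.
    rewrite -(ler_pM2r r20); apply: (le_trans hkappa).
    rewrite [leRHS]mulrAC; apply: ler_wpM2r; first exact: powR_ge0.
    by rewrite mulrC.
  have J2 : (1 < #|J|)%N.
    have x00 : 0 < (edges_in (B j) J)%:R :> R by rewrite ltr0n.
    have := lt_le_trans x00 hJ; case: (#|J|) Jp => // -[|//] _.
    by rewrite subrr mulr0 ltxx.
  apply: (@le_trans _ _ (N ^+ #|J| * q `^ (x * (#|J|%:R - 1)))); last first.
    by apply: ler_wpM2l h1; rewrite exprn_ge0 // ltW.
  have -> : #|J|%:R - 1 = #|J|.-1%:R :> R by rewrite -(prednK Jp) -natr1 addrK.
  rewrite powRrM powR_mulrn ?powR_ge0 // -{1}(prednK Jp) exprS -mulrA -exprMn mulrC.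
  apply: ler_wpM2l; first exact: ltW.
  have k1 : 1 <= N * q `^ x by exact: le_trans hk.
  apply: (le_trans hk); rewrite -{1}[N * _]expr1; apply: ler_weXn2l => //.
  by case: (#|J|) J2 => // -[|].
have lam0 : 0 < kappa * N by rewrite mulr_gt0.
have ov := overlap_le q0 q1 pts0 lam0 AI lamP.
have mn : N ^+ b * q ^+ e (B j) / 2 <= mean A (fun g : F => copyE (B j) g) q.
  rewrite /mean (eq_bigr (fun=> q ^+ e (B j))); last by move=> g gA; rewrite card_copyE //; exact: inj.
  rewrite sumr_const -[X in _ <= X]mulr_natl mulrAC; apply: ler_wpM2r (card_good_maps g0).
  by rewrite exprn_ge0 // ltW.
set z := N ^+ b * q ^+ e (B j) in mn; have z0 : 0 < z by rewrite mulr_gt0 ?exprn_gt0.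
have /card_gt0P[g1 g1A] : (0 < #|A|)%N.
  rewrite -(ltr0n R); apply: lt_le_trans (card_good_maps g0).
  by rewrite divr_gt0 ?exprn_gt0.
have ov0 : 0 < overlap A (fun g : F => copyE (B j) g) q.
  exact: overlap_gt0 q0 g1A (e0 _ g1A).
have q01 : 0 <= q <= 1 by rewrite ltW.
apply: (le_trans (janson (enum_uniq _) es q01 e0 ov0)).
rewrite ler_expR lerN2.
set D := overlap _ _ _ in ov ov0 *; set m := mean _ _ _ in mn *.
have ov' : D <= z ^+ 2 * C3 / (kappa * N) := ov.
apply: (@le_trans _ _ (kappa * N / (16 * C3))).
  have -> : kappa * N / (16 * C3) = kappa * (2 * r%:R * N) / (32 * r%:R * C3).
    by field; rewrite !gt_eqF // (lt_le_trans ltr01 r1).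
  apply: ler_wpM2r.
    rewrite invr_ge0 mulr_ge0 ?mulr_ge0 //; exact: ltW.
  by apply: ler_wpM2l NS; exact: ltW.
rewrite ler_pdivlMr ?mulr_gt0 //.
apply: (@le_trans _ _ ((z / 2) ^+ 2)); last first.
  by apply: lerXn2r => //; rewrite nnegrE ?divr_ge0 ?ltW // (lt_le_trans _ mn) // divr_gt0.
apply: (@le_trans _ _ (kappa * N / (16 * C3) * (4 * (z ^+ 2 * C3 / (kappa * N))))).
  apply: ler_wpM2l.
    by apply: divr_ge0 (ltW lam0) _; apply: mulr_ge0 (ltW C30).
  by rewrite ler_pM2l.
rewrite le_eqVlt; apply/orP; left; apply/eqP; field.
by rewrite !gt_eqF.
Qed.

End Selection.

(** At most half of [S] is monochromatic in colour [i1]: otherwise some tuple that is not bad has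
    such a copy at a fixed index and is found by the edges of [E1] alone. The other copies have a
    vertex of another colour, and by pigeonhole one colour [j] occurs in enough of them. *)
Lemma missing_selection cc E2 :
  (forall Psi, Psi \in tuples U S :\: bad -> ~~ found cc (E1 :|: E2) Psi) ->
  exists j (sel : {ffun F -> option U}), [/\ j != i1, [forall g, sel g \in (if g \in S then setT else [set None])],
    #|S|%:R <= 2 * r%:R * #|selected sel|%:R :> R &
    forall g0, [forall g in good_maps sel g0, ~~ (copyE (B j) g \subset E2)]].
Proof.
move=> H.
have /set0Pn[u0 u0P] : vset P != set0 by rewrite -card_gt0.
pose mono := [set g in S | [forall u in vset P, cc (g u) == i1]].
have eps_half : eps <= 4^-1.
  apply: le_trans heps; rewrite ler_peMr ?(ltW eps0) // exprn_ege1 //.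
  by have := r1; lra.
have mono_small : #|mono|%:R <= #|S|%:R / 2 :> R.
  rewrite leNgt; apply/negP => big.
  pose X := [set Psi in tuples U S | Psi u0 \in mono].
  have cX : #|X| = (#|mono| * #|S| ^ (b - 1))%N.
    have -> : X = [set Psi : {ffun U -> F} | [forall u, Psi u \in (if u \in [set u0] then mono else S)]].
      apply/setP => Psi; rewrite !inE; apply/andP/forallP => [[/forallP h1 h2] u|h].
        by rewrite inE; case: eqVneq => [->|]; [rewrite inE|].
      have := h u0; rewrite inE eqxx => hu0; split; last by move: hu0; rewrite inE.
      apply/forallP => u; have := h u; rewrite inE; case: eqVneq => // _; rewrite inE.
      by case/andP.
    by rewrite card_family2 cards1 expn1.
  have : ~~ (X \subset bad).
    apply/negP => /subset_leq_card; rewrite cX -(ler_nat R) natrM natrX => h.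
    have := le_trans h hbad; apply/negP; rewrite -ltNge.
    rewrite -{1}(prednK b_gt0) exprS subn1 mulrA ltr_pM2r ?exprn_gt0 //.
    by move: big eps_half S0; nra.
  case/subsetPn => Psi; rewrite inE => /andP[PS Pu0] nb.
  have Pin : Psi \in tuples U S :\: bad by rewrite inE nb.
  case/negP: (H _ Pin).
  have /andP[injg cg] : injP P (Psi u0) && (copyE P (Psi u0) \subset E1).
    by apply: SP; move: Pu0; rewrite inE => /andP[].
  apply/existsP; exists i1; apply/existsP; exists (Psi u0); rewrite injg /=.
  rewrite (subset_trans cg (subsetUl _ _)) /=; apply/andP; split; last first.
    by move: Pu0; rewrite inE => /andP[].
  apply/subsetP => y /imsetP[u _ ->]; apply/bigcupP; exists u0 => //.
  by apply: imset_f; rewrite inE.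
pose hit k := [set g in S | [exists u in vset P, cc (g u) == k]].
have [j ji hj] : exists2 j, j != i1 & #|S|%:R <= 2 * r%:R * #|hit j|%:R :> R.
  suff : ~~ [forall j, (j != i1) ==> (2 * r%:R * #|hit j|%:R < #|S|%:R :> R)].
    by case/forallPn=> j; rewrite negb_imply -leNgt => /andP[h1 h2]; exists j.
  apply/negP => /forallP Hj.
  have cov : (#|S| <= #|mono| + \sum_(j | j != i1) #|hit j|)%N.
    rewrite -!sum1_card; under [X in (_ <= _ + X)%N]eq_bigr do rewrite -sum1_card big_mkcond.
    rewrite exchange_big /= [X in (X <= _)%N]big_mkcond [X in (_ <= X + _)%N]big_mkcond -big_split /=.
    apply: leq_sum => g _; case: (boolP (g \in S)) => // gS.
    case: (boolP (g \in mono)) => // gm.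
    have : ~~ [forall u in vset P, cc (g u) == i1] by move: gm; rewrite inE gS.
    case/forall_inPn => u uP ne; rewrite (bigD1 (cc (g u))) //= ifT //.
    by rewrite inE gS; apply/exists_inP; exists u.
  have : \sum_(j | j != i1) #|hit j|%:R <= \sum_(j | j != i1) (#|S|%:R / (2 * r%:R)) :> R.
    apply: ler_sum => j jn; rewrite ler_pdivlMr // mulrC ltW //.
    by have := implyP (Hj j) jn.
  rewrite sumr_const -[X in _ <= X]mulr_natl.
  have -> : #|(fun j : 'I_r => j != i1)| = r.-1.
    by rewrite -[in RHS](card_ord r) -(cardC1 i1); apply: eq_card => k; rewrite inE.
  have rp : (0 < r)%N by rewrite -(ltr0n R) (lt_le_trans ltr01 r1).
  have rE : r.-1%:R = r%:R - 1 :> R by rewrite -[in RHS](prednK rp) -natr1 addrK.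
  have : #|S|%:R <= #|mono|%:R + \sum_(j | j != i1) #|hit j|%:R :> R.
    by rewrite -natr_sum -natrD ler_nat.
  have sE : (r%:R - 1) * (#|S|%:R / (2 * r%:R)) = #|S|%:R / 2 - #|S|%:R / (2 * r%:R) :> R.
    by field; rewrite gt_eqF // (lt_le_trans ltr01 r1).
  have s0 : 0 < #|S|%:R / (2 * r%:R) :> R by rewrite divr_gt0.
  by rewrite rE sE; move: mono_small s0; lra.
pose sel : {ffun F -> option U} :=
  [ffun g => if g \in S then [pick u in vset P | cc (g u) == j] else None].
have selE : selected sel = hit j.
  apply/setP => g; rewrite !inE /sel ffunE; case: (boolP (g \in S)) => //= gS.
  case: pickP => [u /andP[uP cu]|none].
    by rewrite uP; apply/esym/exists_inP; exists u.
  by apply/esym/negbTE/exists_inPn => u uP; have := none u; rewrite uP /= => ->.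
exists j, sel; split=> //.
- by apply/forallP => g; rewrite ffunE; case: ifP => _; rewrite inE.
- by rewrite selE.
move=> g0; apply/forall_inP => g; rewrite inE => /and3P[/forallP gp /injectiveP gi gb].
apply/negP => gE.
have Pin : [ffun u => owner sel g0 (g u)] \in tuples U S :\: bad.
  rewrite inE gb inE; apply/forallP => u; rewrite ffunE.
  by have [] := ownerP g0 (gp u); rewrite inE => /andP[].
case/negP: (H _ Pin).
apply/existsP; exists j; apply/existsP; exists g; apply/and4P; split.
- by apply/injPP => u u' _ _; exact: gi.
- exact: subset_trans gE (subsetUr _ _).
- apply/subsetP => y /imsetP[u _ ->]; apply/bigcupP; exists u => //; rewrite ffunE.
  have [os] := ownerP g0 (gp u); move: (owner _ _ _) os => o _; rewrite /point.
  by case: (sel o) => // w [<-]; apply: imset_f; rewrite inE.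
apply/forall_inP => u _; have [os] := ownerP g0 (gp u); move: (owner _ _ _) os => o _.
by rewrite /point /sel ffunE; case: ifP => // _; case: pickP => // w /andP[_ cw] [<-].
Qed.

(** For [x = 0] the graphs [B j] with [j != i1] have no edge, so every good map is a copy and
    failure is impossible; hence the leading factor. *)
Lemma round_two_single :
  Ex q ss (fun E2 => [exists cc, forall Psi in tuples U S :\: bad,
      ~~ found cc (E1 :|: E2) Psi]%:R) <=
  (x != 0)%:R * (r%:R * (b%:R + 1) ^+ #|S| * expR (- (kappa * #|S|%:R / (32 * r%:R * C3)))).
Proof.
have [g0 g0S] : exists g0, g0 \in S.
  by apply/card_gt0P; rewrite -(ltr0n R).
pose bigsel := [set sel : {ffun F -> option U} |
  [forall g, sel g \in (if g \in S then setT else [set None])]].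
pose A (k : 'I_r) := k != i1.
apply: (@le_trans _ _ (Ex q ss (fun E2 => \sum_(j | A j) \sum_(sel in bigsel)
   ((#|S|%:R <= 2 * r%:R * #|selected sel|%:R :> R) &&
    [forall g in good_maps sel g0, ~~ (copyE (B j) g \subset E2)])%:R))).
  apply: ler_Ex => [|E2]; first by rewrite ltW.
  pose M (_ : 'I_r) := bigsel.
  apply: (@bool_le_sum _ _ _ A M) => /existsP[cc /forall_inP H].
  have [j [sel [h1 h2 h3 h4]]] := missing_selection H.
  by exists j, sel => //; rewrite inE h2 h3 h4.
rewrite Ex_sum; set bound := expR _.
have b0 : 0 <= bound by exact: expR_ge0.
have cs : #|bigsel|%:R = (b%:R + 1) ^+ #|S| :> R.
  rewrite card_family2 cards1 exp1n muln1 cardsT card_option natrX.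
  by rewrite -natr1.
apply: (@le_trans _ _ (\sum_(j | A j) (x != 0)%:R * ((b%:R + 1) ^+ #|S| * bound))).
  apply: ler_sum => j ji; rewrite Ex_sum -cs.
  case: (posnP (e (B j))) => [ej|ej].
    rewrite big1; last first.
      move=> sel _; rewrite -[RHS](Ex_cst q ss 0); apply: eq_Ex => E2.
      case: (boolP (_ <= _)) => //= sl; rewrite (_ : [forall g in _, _] = false) //.
      apply/negbTE/forall_inPn.
      have : (0 < #|good_maps sel g0|)%N.
        rewrite -(ltr0n R); apply: lt_le_trans (card_good_maps sl g0).
        by rewrite divr_gt0 // exprn_gt0 // card_points; move: (lt_le_trans S0 sl); rewrite pmulr_rgt0.
      case/card_gt0P => g gg; exists g => //; rewrite negbK.
      have -> : copyE (B j) g = set0.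
        apply/eqP; rewrite -subset0; apply/subsetP => y /imsetP[z zB _].
        by move/eqP: ej; rewrite cards_eq0 => /eqP ej; rewrite ej inE in zB.
      exact: sub0set.
    by rewrite mulr_ge0 // mulr_ge0.
  have xn : x != 0.
    apply: contraTneq ej => xE; rewrite -leqNgt -edges_in_vset.
    case: (eqVneq (vset (B j)) set0) => [->|vn]; first by rewrite edges_in0 ?cards0.
    by have := hB ji (subxx _) vn; rewrite xE mul0r (ler_nat R _ 0).
  rewrite xn mul1r.
  apply: (@le_trans _ _ (\sum_(sel in bigsel) bound)); last first.
    by rewrite sumr_const -[X in X <= _]mulr_natl.
  apply: ler_sum => sel _.
  case: (boolP (#|S|%:R <= 2 * r%:R * #|selected sel|%:R :> R)) => sl.
    exact: selection_fails.
  by rewrite /= Ex_cst.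
rewrite sumr_const -[X in X <= _]mulr_natl mulrCA; apply: ler_wpM2l => //.
rewrite mulrA; apply: ler_wpM2r => //; apply: ler_wpM2r.
  by rewrite exprn_ge0 // addr_ge0.
by rewrite ler_nat (leq_trans (max_card _)) // card_ord.
Qed.

End RoundTwo.

(** * Second round: all coordinates *)

Lemma density_seq_lb (R : realFieldType) (U : finType) (c eps : R) (N : nat) :
  0 < c -> 0 < eps -> exists2 cm, 0 < cm & forall i, (i <= N)%N -> cm <= density_seq U c eps i.
Proof.
move=> c0 e0; elim: N => [|N [cm cm0 H]].
  by exists c => // -[|].
exists (Num.min cm (density_seq U c eps N.+1)).
  by rewrite lt_min cm0 density_seq_gt0.
move=> i; rewrite leq_eqVlt => /orP[/eqP ->|iN]; first by rewrite ge_min lexx orbT.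
by rewrite ge_min H.
Qed.

Section RoundTwoAll.
Variables (R : realType) (V U L : finType) (G : sgraph V) (k r : nat).
Variables (part : L -> 'I_k) (B : L -> 'I_r -> sgraph U) (i1 : L -> 'I_r) (x : L -> R).
Notation F := {ffun U -> V}.
Let b := #|U|.
Let ss := enum (pairs [set: V]).
Let P l := B l (i1 l).

Definition spanned (cc : {ffun V -> 'I_r}) (E : {set {set V}}) (Y : {set V}) l : bool :=
  [exists j, [exists g : F, [&& injP (B l j) g, copyE (B l j) g \subset E,
    g @: vset (B l j) \subset Y & [forall u in vset (B l j), cc (g u) == j]]]].

Definition arrows (E : {set {set V}}) : bool :=
  [forall cc : {ffun V -> 'I_r}, [exists Y : {ffun L -> {set V}},
    [forall l, forall l', (part l != part l') ==>
      [forall y in Y l, forall z in Y l', adj G y z]] &&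
    [forall l, spanned cc E (Y l) l]]].

Hypothesis P0 : forall l, (0 < v (P l))%N.
Hypothesis x0 : forall l, 0 <= x l.
Hypothesis hB : forall l j (J : {set U}), j != i1 l -> J \subset vset (B l j) -> J != set0 ->
  (edges_in (B l j) J)%:R <= x l * (#|J|%:R - 1).
Variables (c1 C2 N q cm kappa : R).
Hypothesis r0 : (0 < r)%N.
Hypotheses (c10 : 0 < c1) (C20 : 0 < C2) (N0 : 0 < N) (q0 : 0 < q) (q1 : q <= 1).
Let nu l := N * q `^ (- x l).
(** [c2] is the density after thinning, and [eps] makes bad tuples at most a quarter. In [c5] the
    factor [cm / 2] comes from passing to a section, the others from the size of the thinned
    families; sections have at least c5 N q^(-x) elements. *)
Let c2 : R := c1 / 2 ^+ #|L|.
Let eps : R := 4^-1 / (2 * r%:R) ^+ b.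
Let C3 : R := b%:R ^+ b * 2 ^+ b.
Let c5 : R := cm / 2 * (c2 / 4 * (c2 / 4 / C2)).
Hypothesis cm0 : 0 < cm.
Hypothesis hcm : forall i, (i <= #|L|)%N -> cm <= density_seq U c2 eps i.
Hypothesis hkap : (ln (b%:R + 1) + 1) * (32 * r%:R * C3) <= kappa.
Hypothesis kappa1 : 1 <= kappa.
Hypothesis hN : kappa * (2 * r%:R) + 4 * b%:R ^+ 2 * (2 * r%:R) + 1 <= c5 * N.

Variable (E1 : {set {set V}}).
Hypothesis hW : c1 * (\prod_l #|copies P E1 l|)%:R <=
  #|complete U G part :&: box (copies P E1)|%:R.
Hypothesis hD : forall l, #|meeting P E1 l|%:R * nu l <= C2 * #|copies P E1 l|%:R ^+ 2.
Hypothesis hM : forall l, (0 < #|copies P E1 l|)%N.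

Lemma arrows_choice (Phi : {ffun L -> {ffun U -> F}}) (W : {set {ffun L -> F}}) (M : L -> {set F}) :
  W \subset complete U G part -> refines M W Phi (enum L) != set0 ->
  forall l l', part l != part l' -> forall y z, y \in spread (Phi l) -> z \in spread (Phi l') ->
  adj G y z.
Proof.
move=> WC /set0Pn[t tr] l l' ll y z /bigcupP[u _ /imsetP[w _ ->]] /bigcupP[u' _ /imsetP[w' _ ->]].
have := refinesP [ffun m => if m == l then u else u'] (enum_uniq _) tr.
move/(subsetP WC); rewrite inE => /forallP/(_ l)/forallP/(_ l')/implyP/(_ ll).
move/forallP/(_ w)/forallP/(_ w'); rewrite !ffunE !mem_enum !inE eqxx.
suff /negPf-> : l' != l by [].
by apply: contraNneq ll => ->.
Qed.

(** The power of [#|V|] is the number of pairs of a history [Phi] and a point [y]. It is polynomial,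
    whereas each pair fails with probability exponentially small in q^(-x). *)
Lemma round_two :
  Ex q ss (fun E2 => (~~ arrows (E1 :|: E2))%:R) <=
  (#|V|%:R ^+ b ^+ b * #|V|%:R ^+ b) ^+ #|L| *
  (r%:R * \sum_l (x l != 0)%:R * expR (- q `^ (- x l))).
Proof.
have c20 : 0 < c2 by rewrite divr_gt0 ?exprn_gt0.
have r20 : 0 < 2 * r%:R :> R by rewrite mulr_gt0 // ltr0n.
have eps0 : 0 < eps by rewrite divr_gt0 ?exprn_gt0 ?invr_gt0.
have nu0 l : 0 < nu l by rewrite mulr_gt0 ?powR_gt0.
have szL : size (enum L) = #|L| by rewrite -cardE.
pose m l : R := c2 / 4 / C2 * nu l.
have m0 l : 0 < m l by rewrite mulr_gt0 ?divr_gt0.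
have refl l : l \in enum L -> {in copies P E1 l, reflexive (meets P l)}.
  move=> _ g _; rewrite /meets -setI_eq0 setIid -card_gt0.
  have /card_gt0P[u uP] := P0 l; apply/card_gt0P; exists (g u); exact: imset_f.
have hmeet l : l \in enum L ->
    #|[set p in setX (copies P E1 l) (copies P E1 l) | meets P l p.1 p.2]|%:R * m l <=
    c2 / 4 * #|copies P E1 l|%:R ^+ 2.
  move=> _; rewrite /m mulrCA.
  have -> : c2 / 4 * #|copies P E1 l|%:R ^+ 2 = c2 / 4 / C2 * (C2 * #|copies P E1 l|%:R ^+ 2).
    by rewrite mulrA divfK // gt_eqF.
  by apply: ler_wpM2l (hD l); rewrite !divr_ge0 // ltW.
have dl : c2 / 4 <= c1 / 2 ^+ size (enum L) / 4 by rewrite szL.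
have [M' [sM M0 Mdis MW]] := thin_all (enum_uniq L) hM c10 m0 dl refl hmeet hW.
rewrite szL -/c2 in Mdis MW.
set W0 := _ :&: _ in MW; have sW0 : W0 \subset box M' by exact: subsetIr.
have M'0 l : (0 < #|M' l|)%N by have [] := M0 l.
pose ls := enum L; pose ps l := take (index l ls) ls.
pose ci l := density_seq U c2 eps (size (ps l)).
pose WW (Phi : {ffun L -> {ffun U -> F}}) l := refines M' W0 Phi (ps l).
pose SS Phi (y : {ffun L -> F}) l := section M' (WW Phi l) y l.
pose bd Phi y l := bad_tuples U M' (WW Phi l) y l (eps * (ci l / 2) ^+ b.+1 * #|box M'|%:R).
pose cond l (p : {ffun L -> {ffun U -> F}} * {ffun L -> F}) :=
  (ci l / 2 * #|M' l|%:R <= #|SS p.1 p.2 l|%:R) &&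
  (#|bd p.1 p.2 l|%:R <= eps * #|SS p.1 p.2 l|%:R ^+ b).
pose fails l p E2 := cond l p && [exists cc, forall Psi in tuples U (SS p.1 p.2 l) :\: bd p.1 p.2 l,
   ~~ found (B l) cc (E1 :|: E2) Psi].
apply: (@le_trans _ _ (Ex q ss (fun E2 => \sum_(l : L | predT l) \sum_(p in setT) (fails l p E2)%:R))).
  apply: ler_Ex => [|E2]; first by rewrite ltW.
  pose MM (_ : L) := [set: {ffun L -> {ffun U -> F}} * {ffun L -> F}].
  apply: (@bool_le_sum _ _ _ predT MM) => /forallPn[cc Hcc].
  have [/existsP[l /existsP[p lp]]|/existsPn nofail] :=
      boolP [exists l, exists p, cond l p && [forall Psi in tuples U (SS p.1 p.2 l) :\: bd p.1 p.2 l,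
      ~~ found (B l) cc (E1 :|: E2) Psi]].
    exists l, p => //; rewrite inE /=.
    case/andP: lp => h1 h2; rewrite /fails h1; apply/existsP; exists cc; exact: h2.
  exfalso; case/negP: Hcc.
  have := @adaptive_choice R L F U M' W0 ls c2 eps 0 (fun l => found (B l) cc (E1 :|: E2))
     (enum_uniq _) sW0 M'0 c20 eps0.
  rewrite /= card_box => /(_ MW)[|Phi [hf hr]].
    move=> pp l rest Phi y lsE; rewrite add0n.
    have lpp : l \notin pp.
      by have := enum_uniq L; rewrite -/ls lsE cat_uniq /= negb_or => /and3P[_ /andP[]].
    have psE : pp = ps l.
      by rewrite /ps lsE index_cat (negPf lpp) /= eqxx addn0 take_size_cat.
    rewrite psE -card_box => yM h1 h2.
    have := nofail l; move/existsPn/(_ (Phi, y)); rewrite negb_and /cond h1 h2 /=.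
    case/forall_inPn => Psi PP; rewrite negbK => fP; exists Psi => //.
  apply/existsP; exists [ffun l => spread (Phi l)]; apply/andP; split.
    apply/forallP => l; apply/forallP => l'; apply/implyP => ll.
    apply/forall_inP => y; rewrite ffunE => yY; apply/forall_inP => z; rewrite ffunE => zY.
    apply: (arrows_choice _ hr ll yY zY); exact: subsetIl.
  apply/forallP => l; rewrite ffunE; apply: hf; exact: mem_enum.
rewrite Ex_sum.
pose cst l : R := (x l != 0)%:R * (r%:R * expR (- q `^ (- x l))).
apply: (@le_trans _ _ (\sum_l \sum_(p in [set: {ffun L -> {ffun U -> F}} * {ffun L -> F}]) cst l)).
  apply: ler_sum => l _; rewrite Ex_sum; apply: ler_sum => p _.
  have cst0 : 0 <= cst l by rewrite /cst !mulr_ge0 // expR_ge0.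
  rewrite /fails; case: (boolP (cond l p)) => [/andP[h1 h2]|_] /=; last by rewrite Ex_cst.
  set S := SS _ _ _ in h1 h2 *; set bad := bd _ _ _ in h2 *.
  have sSM : S \subset M' l by apply/subsetP => g; rewrite inE => /andP[].
  have b0 : (0 < b)%N by apply: leq_trans (P0 l) _; exact: max_card.
  have C30 : 0 < C3 by rewrite mulr_gt0 ?exprn_gt0 // ltr0n.
  have q01 : 0 < q <= 1 by rewrite q0.
  have qx1 : q `^ x l <= 1 by have := ger_powR q01 (x0 l); rewrite powRr0.
  have qx0 : 0 < q `^ x l by exact: powR_gt0.
  have qxE : q `^ (- x l) * q `^ x l = 1 by rewrite powRN mulVf // gt_eqF.
  have qn1 : 1 <= q `^ (- x l) by rewrite powRN invf_ge1.
  have [Mdl Mcl] := Mdis l (mem_enum _ _).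
  have hc : cm <= ci l.
    by apply: hcm; rewrite /ps size_take -szL; case: ifP => // h; exact: ltnW.
  have c50 : 0 < c5 by rewrite !mulr_gt0 ?divr_gt0 ?invr_gt0.
  have S_ge : c5 * N * q `^ (- x l) <= #|S|%:R.
    apply: le_trans h1; have -> : c5 * N * q `^ (- x l) = cm / 2 * (c2 / 4 * m l).
      by rewrite /c5 /m /nu -!mulrA.
    apply: ler_pM Mcl; rewrite ?ler_pM2r ?invr_gt0 //; last by rewrite mulr_ge0 ?divr_ge0 // ltW.
    by rewrite divr_ge0 // ltW.
  have kr : 0 < kappa * (2 * r%:R) by rewrite mulr_gt0 // (lt_le_trans ltr01).
  have br : 0 <= 4 * b%:R ^+ 2 * (2 * r%:R) :> R by rewrite mulr_ge0 ?mulr_ge0 ?exprn_ge0 // ltW.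
  have hN1 : 1 <= c5 * N by apply: le_trans hN; rewrite lerDr addr_ge0 // ltW.
  have hN2 : 4 * b%:R ^+ 2 * (2 * r%:R) <= c5 * N by apply: le_trans hN; rewrite -addrA ler_wpDl ?(ltW kr) // lerDl.
  have hN3 : kappa * (2 * r%:R) <= c5 * N by apply: le_trans hN; rewrite -addrA lerDl addr_ge0.
  have cN0 : 0 < c5 * N by rewrite mulr_gt0.
  have S_big : c5 * N <= #|S|%:R.
    by apply: le_trans S_ge; rewrite ler_peMr // ltW.
  have S_q : q `^ (- x l) <= #|S|%:R.
    by apply: le_trans S_ge; rewrite ler_peMl // ltW // (lt_le_trans ltr01).
  apply: (@le_trans _ _ ((x l != 0)%:R * (r%:R * (b%:R + 1) ^+ #|S| *
      expR (- (kappa * #|S|%:R / (32 * r%:R * C3)))))).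
    apply: (@round_two_single R V U r (B l) (i1 l) E1 S bad (x l) q eps kappa) => //.
    - move=> g gS; have := subsetP (sM l) _ (subsetP sSM _ gS).
      by rewrite inE.
    - move=> g h gS hS gh; have := Mdl _ _ (subsetP sSM _ gS) (subsetP sSM _ hS) gh.
      by rewrite negbK.
    - exact: P0.
    - by move=> j J; exact: hB.
    - by rewrite /eps divfK // gt_eqF // exprn_gt0.
    - exact: le_trans hN2 S_big.
    - apply: (le_trans hN3); have -> : c5 * N = c5 * N * q `^ (- x l) * q `^ x l by rewrite -mulrA qxE mulr1.
      by apply: ler_wpM2r S_ge; exact: ltW.
  apply: ler_wpM2l => //; rewrite -mulrA; apply: ler_wpM2l => //.
  have b1 : 0 < b%:R + 1 :> R by rewrite ltr_wpDl.
  (* In [hkap] the logarithm pays for the [(b%:R + 1) ^+ #|S|] markings; the summand 1 leaves |S| in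
     the exponent, which is at least q^(-x). *)
  rewrite -[b%:R + 1]lnK // -expRM_natl -expRD ler_expR.
  have h3 : (ln (b%:R + 1) + 1) * #|S|%:R <= kappa * #|S|%:R / (32 * r%:R * C3).
    rewrite mulrAC; apply: ler_wpM2r => //; rewrite ler_pdivlMr ?hkap //.
    by apply: mulr_gt0 C30; rewrite mulr_gt0 // ltr0n.
  rewrite lerBlDr [leRHS]addrC lerBrDr; apply: le_trans h3; rewrite mulrDl mul1r lerD //.
  by rewrite mulrC.
under eq_bigr do rewrite sumr_const.
rewrite sumrMnl -[X in X <= _]mulr_natl.
apply: ler_pM; rewrite ?sumr_ge0 //.
- by move=> l _; rewrite /cst !mulr_ge0 // expR_ge0.
- by rewrite cardsT card_prod !card_ffun natrM !natrX exprMn.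
by rewrite big_distrr /= le_eqVlt; apply/orP; left; apply/eqP; apply: eq_bigr => l _; rewrite mulrCA.
Qed.

End RoundTwoAll.

Lemma arrows_incr (R : realType) (V U L : finType) (G : sgraph V) (k r : nat)
    (part : L -> 'I_k) (B : L -> 'I_r -> sgraph U) :
  incr (fun E => (arrows G part B E)%:R : R).
Proof.
move=> E E' EE; apply: ler_bool => /forallP H; apply/forallP => cc.
have /existsP[Y /andP[h1 /forallP h2]] := H cc; apply/existsP; exists Y; rewrite h1 /=.
apply/forallP => l; have /existsP[j /existsP[g /and4P[gi gE gY gc]]] := h2 l.
apply/existsP; exists j; apply/existsP; exists g; rewrite gi gY gc.
by rewrite (subset_trans gE EE).
Qed.

(** From exp(z) >= (z / (m+1))^(m+1), with [m] so large that [s * m.+1] exceeds the degree [D] by at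
    least one. *)
Lemma powR_expR_decay (R : realType) (D : nat) (A s : R) : 0 < A -> 0 < s ->
  exists2 C, 0 < C & forall n : R, 1 <= n -> n ^+ D * expR (- (A * n `^ s)) <= C / n.
Proof.
move=> A0 s0; have [m hm] : exists m, D.+1%:R <= s * m.+1%:R.
  exists (Num.truncn (D.+1%:R / s)).
  by rewrite -ler_pdivrMl // mulrC ltW // truncnS_gt.
exists ((m.+1%:R / A) ^+ m.+1); first by rewrite exprn_gt0 ?divr_gt0.
move=> n n1; have n0 : 0 < n by exact: lt_le_trans n1.
have z0 : 0 < A * n `^ s by rewrite mulr_gt0 ?powR_gt0.
have h : (A * n `^ s / m.+1%:R) ^+ m.+1 <= expR (A * n `^ s).
  have -> : expR (A * n `^ s) = expR (A * n `^ s / m.+1%:R) ^+ m.+1.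
    by rewrite -expRM_natl [_%:R * _]mulrC divfK.
  apply: lerXn2r.
  - by rewrite nnegrE divr_ge0 // ltW.
  - by rewrite nnegrE expR_ge0.
  - by apply: le_trans (expR_ge1Dx _); rewrite lerDr.
rewrite ler_pdivlMr // mulrAC -exprSr expRN ler_pdivrMr ?expR_gt0 //.
apply: (@le_trans _ _ ((m.+1%:R / A) ^+ m.+1 * (A * n `^ s / m.+1%:R) ^+ m.+1)); last first.
  by apply: ler_wpM2l h; rewrite exprn_ge0 // divr_ge0 // ltW.
rewrite -exprMn.
have -> : m.+1%:R / A * (A * n `^ s / m.+1%:R) = n `^ s.
  have : m.+1%:R != 0 :> R by rewrite pnatr_eq0.
  by move: (m.+1%:R) (n `^ s) => y z yn; field; rewrite yn gt_eqF.
rewrite -!powR_mulrn ?powR_ge0 ?(ltW n0) // -powRrM; exact: ler_powR.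
Qed.

(** * The two rounds together *)

Section OneCore.
Variables (R : realType) (U L : finType) (k r : nat).
Variables (part : L -> 'I_k) (B : L -> 'I_r -> sgraph U) (i1 : L -> 'I_r) (x : L -> R).
Variables (b0 kap : R).
Hypotheses (k2 : (2 <= k)%N) (r0 : (0 < r)%N) (b0_gt0 : 0 < b0) (kap0 : 0 < kap).
Hypothesis P0 : forall l, (0 < v (B l (i1 l)))%N.
Hypothesis x0 : forall l, 0 <= x l.
Hypothesis hx : forall l (J : {set U}), J \subset vset (B l (i1 l)) -> J != set0 ->
  (edges_in (B l (i1 l)) J)%:R + x l <= b0 * #|J|%:R.
Hypothesis hB : forall l j (J : {set U}), j != i1 l -> J \subset vset (B l j) -> J != set0 ->
  (edges_in (B l j) J)%:R <= x l * (#|J|%:R - 1).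
Let b := #|U|.
Let P l := B l (i1 l).

Lemma one_core (eta : R) : 0 < eta -> exists K n0 : R, 0 < K /\
  forall (V : finType) (G : sgraph V) (delta q : R), vset G = [set: V] -> n0 <= #|V|%:R ->
    delta <= 1 -> kap <= 1 - (k%:R - 1) * (1 - delta) ->
    delta * (v G)%:R ^+ 2 <= 2 * (e G)%:R -> q <= 1 -> K * #|V|%:R `^ (- b0^-1) <= q ->
    1 - eta <= Ex q (enum (pairs [set: V])) (fun E => (arrows G part B E)%:R).
Proof.
move=> eta0.
have [c c0 hsup] := hom_supersat (fun p : L * U => part p.1) k2 kap0.
pose C5 : R := #|{: L * U}|%:R ^+ #|{: L * U}| * 2 ^+ #|{: L * U}|.
pose C3 : R := b%:R ^+ b * 2 ^+ b.
have selfexp m : 0 < m%:R ^+ m * 2 ^+ m :> R.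
  apply: mulr_gt0; last exact: exprn_gt0.
  by case: m => [|m]; [rewrite expr0|rewrite exprn_gt0].
have C50 : 0 < C5 by exact: selfexp.
have C30 : 0 < C3 by exact: selfexp.
pose a : R := 1 + 8 * #|L|%:R / eta.
have a1 : 1 <= a by rewrite lerDl divr_ge0 ?mulr_ge0 // ltW.
have a0 : 0 < a by exact: lt_le_trans a1.
pose c1 : R := c / 4 / a ^+ #|L|.
have c10 : 0 < c1 by rewrite !divr_gt0 ?exprn_gt0.
pose C2 : R := a * C3 / c1 ^+ 2.
have C20 : 0 < C2 by exact: divr_gt0 (mulr_gt0 a0 C30) (exprn_gt0 2 c10).
pose c2 : R := c1 / 2 ^+ #|L|.
have c20 : 0 < c2 by rewrite divr_gt0 ?exprn_gt0.
pose eps : R := 4^-1 / (2 * r%:R) ^+ b.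
have r20 : 0 < 2 * r%:R :> R by rewrite mulr_gt0 // ltr0n.
have eps0 : 0 < eps by rewrite divr_gt0 ?exprn_gt0 ?invr_gt0.
have [cm cm0 hcm] := density_seq_lb U #|L| c20 eps0.
pose c5 : R := cm / 2 * (c2 / 4 * (c2 / 4 / C2)).
have c24 : 0 < c2 / 4 by exact: divr_gt0.
have c50 : 0 < c5.
  by apply: mulr_gt0; [exact: divr_gt0|apply: mulr_gt0 => //; exact: divr_gt0].
pose kappa0 : R := (ln (b%:R + 1) + 1) * (32 * r%:R * C3).
have kappa0_ge0 : 0 <= kappa0.
  rewrite mulr_ge0 ?mulr_ge0 ?(ltW C30) // addr_ge0 // ln_ge0 // lerDr //.
pose kappa : R := 1 + kappa0.
pose Z : R := kappa * (2 * r%:R) + 4 * b%:R ^+ 2 * (2 * r%:R) + 1.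
have Z0 : 0 <= Z by rewrite !addr_ge0 ?mulr_ge0 ?addr_ge0 ?exprn_ge0.
(* The second summand brings the Chebyshev error down to [eta / 4]; the third gives [c5] times the
   power b0 of [K] at least [Z], so that sections are as large as the second round requires. *)
pose K : R := 1 + 64 * C5 / (c ^+ 2 * eta) + (Z / c5) `^ b0^-1.
have Ka : 0 <= 64 * C5 / (c ^+ 2 * eta).
  by rewrite divr_ge0 ?mulr_ge0 ?exprn_ge0 ?(ltW c0) ?(ltW C50) ?(ltW eta0).
have K1 : 1 <= K by rewrite /K -addrA lerDl addr_ge0 ?powR_ge0.
have K0 : 0 < K by exact: lt_le_trans K1.
have hN : Z <= c5 * K `^ b0.
  rewrite mulrC -ler_pdivrMr //.
  have -> : Z / c5 = ((Z / c5) `^ b0^-1) `^ b0.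
    by rewrite -powRrM mulVf ?gt_eqF // powRr1 // divr_ge0 // ltW.
  apply: ge0_ler_powR; rewrite ?nnegrE ?powR_ge0 ?(ltW b0_gt0) ?(ltW K0) //.
  by rewrite lerDr addr_ge0.
have KC : 16 * C5 / c ^+ 2 / K <= eta / 4.
  have KK : 64 * C5 / (c ^+ 2 * eta) <= K.
    by rewrite /K [1 + _]addrC -addrA lerDl addr_ge0 ?powR_ge0.
  rewrite ler_pdivrMr // -ler_pdivrMl ?divr_gt0 //; apply: le_trans KK.
  rewrite le_eqVlt; apply/orP; left; apply/eqP; move: (c ^+ 2) (exprn_gt0 2 c0) (C5) => c' c'0 C'.
  by field; rewrite !gt_eqF.
have aL : 2 * #|L|%:R / a <= eta / 4.
  rewrite ler_pdivrMr // -ler_pdivrMl ?divr_gt0 //.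
  apply: (@le_trans _ _ (8 * #|L|%:R / eta)); last by rewrite lerDr.
  by rewrite le_eqVlt; apply/orP; left; apply/eqP; field; rewrite gt_eqF.
pose D := ((b * b + b) * #|L|)%N.
(* For [x l = 0] there is no exponential decay, but then the first factor vanishes. *)
have /choice[Cs hCs] l : exists C, 0 < C /\ forall n : R, 1 <= n ->
    (x l != 0)%:R * (n ^+ D * expR (- (K `^ (- x l) * n `^ (x l / b0)))) <= C / n.
  have [xl|xl] := eqVneq (x l) 0.
    by exists 1; split=> // n n1; rewrite mul0r divr_ge0 // (le_trans _ n1).
  have xb : 0 < x l / b0 by rewrite divr_gt0 // lt_def xl x0.
  have [C C0 hC] := @powR_expR_decay R D (K `^ (- x l)) (x l / b0) (powR_gt0 _ K0) xb.
  by exists C; split=> // n n1; rewrite mul1r hC.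
(* Twice [K], since each of the two rounds uses edge probability K |V|^(-1/b0). *)
exists (2 * K), (1 + K `^ b0 + 2 * #|{: L * U}|%:R ^+ 2 / c + 2 * r%:R * (\sum_l Cs l) / eta).
split; first by rewrite mulr_gt0.
move=> V G delta q vG hn d1 hk he q1 hq; set n : R := #|V|%:R in hn hq.
have C5n : 0 <= 2 * #|{: L * U}|%:R ^+ 2 / c :> R.
  by rewrite divr_ge0 ?mulr_ge0 ?exprn_ge0 // ltW.
have Cs0 : 0 <= \sum_l Cs l by apply: sumr_ge0 => l _; have [/ltW] := hCs l.
have Csn : 0 <= 2 * r%:R * (\sum_l Cs l) / eta.
  by rewrite divr_ge0 ?mulr_ge0 // ltW.
have Kb : 0 <= K `^ b0 by exact: powR_ge0.
have n1 : 1 <= n by apply: le_trans hn; rewrite -!addrA lerDl !addr_ge0.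
have nK : K `^ b0 <= n.
  by apply: le_trans hn; rewrite [1 + _]addrC -!addrA lerDl !addr_ge0.
have nc : 2 * #|{: L * U}|%:R ^+ 2 <= c * n.
  rewrite mulrC [leRHS]mulrC -ler_pdivrMr // mulrC; apply: le_trans hn.
  by rewrite addrAC lerDr !addr_ge0.
have n0 : 0 < n by exact: lt_le_trans n1.
have nC : r%:R * (\sum_l Cs l) / n <= eta / 2.
  rewrite ler_pdivrMr // -ler_pdivrMl ?divr_gt0 //; apply: (@le_trans _ _ (2 * r%:R * (\sum_l Cs l) / eta)).
    by rewrite le_eqVlt; apply/orP; left; apply/eqP; field; rewrite gt_eqF.
  by apply: le_trans hn; rewrite lerDr !addr_ge0.
pose q0 := K * n `^ (- b0^-1).
have q00 : 0 < q0 by rewrite mulr_gt0 ?powR_gt0.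
have q01 : q0 <= 1.
  rewrite /q0 powRN ler_pdivrMr ?powR_gt0 // mul1r.
  have -> : K = (K `^ b0) `^ b0^-1 by rewrite -powRrM mulfV ?gt_eqF // powRr1 // ltW.
  by apply: ge0_ler_powR; rewrite ?nnegrE ?invr_ge0 ?(ltW n0) ?(ltW b0_gt0).
have nE : n = (K / q0) `^ b0.
  rewrite /q0 invfM mulrA mulfV ?gt_eqF // mul1r powRN invrK -powRrM mulVf ?gt_eqF //.
  by rewrite powRr1 // ltW.
have V0 : (0 < #|V|)%N by rewrite -(ltr0n R).
have vV : v G = #|V| by rewrite /v vG cardsT.
have hhom : c * n ^+ #|{: L * U}| <= #|homs G (fun p : L * U => part p.1)|%:R.
  by have := @hsup V G delta; rewrite vV; apply => //; rewrite -vV.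
have one := round_one b0_gt0 x0 K1 q00 q01 V0 nE P0 hx c0 a1 hhom nc.
have q02 : q0 + q0 <= q by apply: le_trans hq; rewrite -mulrA mulrDl !mul1r.
have qge0 := ltW q00.
have q0i : 0 <= q0 <= 1 by rewrite qge0.
have two := Ex_two_rounds (enum (pairs [set: V])) qge0 qge0 q02 q1 (@arrows_incr R V U L G k r part B).
apply: le_trans two.
set ss := enum _ in one *.
apply: (@le_trans _ _ (Ex q0 ss (fun E1 => (1 - eta / 2) -
    (~~ rich G part (fun l => B l (i1 l)) x b0 K q0 c a E1)%:R))).
  rewrite ExB Ex_cst; apply: le_trans (lerB (lexx _) one).
  have : 16 * C5 / c ^+ 2 / K + 2 * #|L|%:R / a <= eta / 4 + eta / 4 by apply: lerD.
  have -> : 1 - eta = 1 - eta / 2 - (eta / 4 + eta / 4) by field.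
  by move=> h; rewrite lerD2l lerN2.
apply: ler_Ex => // E1.
have -> : Ex q0 ss (fun E2 => (arrows G part B (E1 :|: E2))%:R) =
    1 - Ex q0 ss (fun E2 => (~~ arrows G part B (E1 :|: E2))%:R) :> R.
  rewrite -[X in X - _](Ex_cst q0 ss) -ExB; apply: eq_Ex => E2.
  by case: arrows; rewrite ?subr0 ?subrr.
rewrite -addrA lerD2l -opprD lerN2.
case: (boolP (rich _ _ _ _ _ _ _ _ _ _)) => [rE|_]; last first.
  apply: (@le_trans _ _ 1); last by rewrite lerDr divr_ge0 // ltW.
  rewrite -[X in _ <= X](Ex_cst q0 ss); apply: ler_Ex => // E2; by case: arrows.
rewrite /= ?addr0 ?add0r; case/and3P: rE => r1 /forallP r2 /forallP r3.
have N0 : 0 < K `^ b0 by exact: powR_gt0.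
have kk : kappa0 <= kappa by rewrite lerDr.
have k1 : 1 <= kappa by rewrite lerDl.
apply: (le_trans (round_two P0 x0 hB r0 c10 C20 N0 q00 q01 cm0 hcm kk k1 hN r1 r2 r3)).
apply: le_trans nC; rewrite -/b -/n -exprM -exprD -exprM -/D mulrCA -mulrA.
apply: ler_wpM2l => //; rewrite big_distrr /= big_distrl /=; apply: ler_sum => l _.
have [_ /(_ n n1)] := hCs l; rewrite mulrCA.
have -> // : q0 `^ (- x l) = K `^ (- x l) * n `^ (x l / b0).
rewrite /q0 powRM ?powR_ge0 ?(ltW K0) // -powRrM; congr (_ * _ `^ _).
by rewrite mulrNN mulrC.
Qed.

End OneCore.

(** * The densities *)

Section Subgraphs.
Variables (R : realType) (T : finType).
Implicit Types (A I J : sgraph T) (W : {set T}).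

Lemma subgraph_refl A : subgraph A A.
Proof. by rewrite /subgraph !subxx. Qed.

Lemma subgraph_trans A I J : subgraph I J -> subgraph J A -> subgraph I A.
Proof.
move=> /andP[h1 h2] /andP[h3 h4].
by rewrite /subgraph (subset_trans h1 h3) (subset_trans h2 h4).
Qed.

Lemma induced_subgraph A W : subgraph (induced_sub A W) A.
Proof. by rewrite /subgraph /vset /eset /= !subsetIl. Qed.

Lemma vset_induced A W : W \subset vset A -> vset (induced_sub A W) = W.
Proof. by move=> /setIidPr; rewrite {2}/vset. Qed.

Lemma v_induced A W : W \subset vset A -> v (induced_sub A W) = #|W|.
Proof. by move=> WA; rewrite /v vset_induced. Qed.

Lemma e_induced A W : W \subset vset A -> e (induced_sub A W) = edges_in A W.
Proof. by move=> /setIidPr h; rewrite /e /edges_in /eset /= h. Qed.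

Lemma induced_vset A : induced_sub A (vset A) = A.
Proof.
apply: val_inj; rewrite /= setIid (setIidPl (eset_pairs A)).
by rewrite /vset /eset; case: (sgraph_val A).
Qed.

Lemma m1_ge0 A : 0 <= m1 R A.
Proof. exact: bigmax_ge_id. Qed.

Lemma m1_ub A J : subgraph J A -> (2 <= v J)%N -> (e J)%:R <= m1 R A * ((v J)%:R - 1).
Proof.
move=> JA J2; rewrite -ler_pdivrMr ?subr_gt0 ?(ltr_nat R 1) //.
apply: (@le_bigmax_cond _ _ _ 0 J (fun J => subgraph J A && (2 <= v J)%N)
  (fun J => (e J)%:R / ((v J)%:R - 1))); by rewrite JA.
Qed.

Lemma m1_edges_in A W : W \subset vset A -> W != set0 ->
  (edges_in A W)%:R <= m1 R A * (#|W|%:R - 1).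
Proof.
move=> WA; rewrite -card_gt0 => W0; have [W1|W2] := leqP #|W| 1.
  rewrite edges_in0 ?ltnS // mulr_ge0 ?m1_ge0 // subr_ge0 (ler_nat R 1) //.
have := @m1_ub A (induced_sub A W) (induced_subgraph A W).
by rewrite v_induced // e_induced //; apply.
Qed.

Lemma m1_subgraph A J : subgraph J A -> m1 R J <= m1 R A.
Proof.
move=> JA; apply/bigmax_leP; split=> [|I /andP[IJ I2]]; first exact: m1_ge0.
rewrite ler_pdivrMr ?subr_gt0 ?(ltr_nat R 1) //.
by apply: m1_ub I2; exact: subgraph_trans JA.
Qed.

Lemma m1_witness A b : 0 < b -> b <= m1 R A ->
  exists J, [/\ subgraph J A, (2 <= v J)%N & b * ((v J)%:R - 1) <= (e J)%:R].
Proof.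
move=> b0 /bigmax_geP[|[J /andP[JA J2]]]; first by rewrite leNgt b0.
by rewrite ler_pdivlMr ?subr_gt0 ?(ltr_nat R 1) // => h; exists J.
Qed.

Lemma m1a_ub (S : finType) (B : sgraph S) A J : subgraph J A -> (1 <= v J)%N ->
  m1 R B + (e J)%:R <= m1a R B A * (v J)%:R.
Proof.
move=> JA J1; rewrite -ler_pdivrMr ?ltr0n //.
apply: (@le_bigmax_cond _ _ _ 0 J (fun J => subgraph J A && (1 <= v J)%N)
  (fun J => (m1 R B + (e J)%:R) / (v J)%:R)); by rewrite JA.
Qed.

Lemma m1a_witness (S : finType) (B : sgraph S) A b : 0 < b -> b <= m1a R B A ->
  exists J, [/\ subgraph J A, (1 <= v J)%N & b * (v J)%:R <= m1 R B + (e J)%:R].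
Proof.
move=> b0 /bigmax_geP[|[J /andP[JA J1]]]; first by rewrite leNgt b0.
by rewrite ler_pdivlMr ?ltr0n // => h; exists J.
Qed.

Lemma m1a_ge0 (S : finType) (B : sgraph S) A : 0 <= m1a R B A.
Proof. exact: bigmax_ge_id. Qed.

Lemma m1a_ge_m1 (S : finType) (B : sgraph S) A : (0 < v A)%N -> m1 R B <= m1a R B A.
Proof.
case/card_gt0P => u uA; have sA : [set u] \subset vset A by rewrite sub1set.
have := @m1a_ub S B A (induced_sub A [set u]) (induced_subgraph A _).
by rewrite v_induced // cards1 e_induced // edges_in0 ?cards1 // addr0 mulr1; apply.
Qed.

(** This settles ties: when the two largest values of [m1] agree, [m1a] equals the common value, so
    [beta] is independent of the order chosen by the sorting. *)
Lemma m1a_diag (S : finType) (B : sgraph S) A : (0 < v A)%N -> m1 R B = m1 R A ->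
  m1a R B A = m1 R A.
Proof.
move=> A0 BA; apply/eqP; rewrite eq_le -{2}BA m1a_ge_m1 // andbT.
apply/bigmax_leP; split; first exact: m1_ge0.
move=> J /andP[JA J1]; rewrite ler_pdivrMr ?ltr0n // BA.
have [J2|J2] := leqP 2 (v J); first by have := m1_ub JA J2; lra.
have -> : v J = 1%N by apply/eqP; rewrite eqn_leq J1 -ltnS J2.
rewrite -edges_in_vset edges_in0 ?addr0 ?mulr1 //.
Qed.

End Subgraphs.

(** * The two densest members of a tuple *)

Section Beta.
Variables (R : realType) (r : nat) (S : 'I_r -> finType).
Implicit Types (A : forall j, sgraph (S j)).
Hypothesis r2 : (2 <= r)%N.

Definition top_two A (i1 i2 : 'I_r) : Prop :=
  [/\ i1 != i2, m1 R (A i2) <= m1 R (A i1) &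
      forall j, j != i1 -> m1 R (A j) <= m1 R (A i2)].

Lemma beta_top_two A : exists i1 i2, top_two A i1 i2 /\ beta R A = m1a R (A i2) (A i1).
Proof.
rewrite /beta; set le : rel 'I_r := (X in sort X _).
have le_tot : total le by move=> i j; exact: le_total.
have le_tr : transitive le by move=> i j k h1 h2; exact: le_trans h2 h1.
have szs : size (sort le (enum 'I_r)) = r by rewrite size_sort size_enum_ord.
have su : uniq (sort le (enum 'I_r)) by rewrite sort_uniq enum_uniq.
have smem j : j \in sort le (enum 'I_r) by rewrite mem_sort mem_enum.
have := sort_sorted le_tot (enum 'I_r).
case: (sort _ _) szs su smem => [|i1 [|i2 s]] /=; [by move=> E; case/idPn: r2; rewrite -E|by move=> E; case/idPn: r2; rewrite -E|].
move=> _ /andP[i1s _] smem /andP[h12 hs].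
exists i1, i2; split=> //; split=> //.
  by apply: contraNneq i1s => ->; rewrite inE eqxx.
move=> j ji1; have := smem j; rewrite !inE (negPf ji1) /= => /orP[/eqP -> //|js].
exact: (allP (order_path_min le_tr hs) _ js).
Qed.

Lemma beta_eq A i1 i2 : (forall j, 0 < v (A j))%N -> top_two A i1 i2 ->
  beta R A = m1a R (A i2) (A i1).
Proof.
move=> A0 [n12 le12 h]; have [i3 [i4 [[n34 le34 h'] ->]]] := beta_top_two A.
have [E13|n13] := eqVneq i1 i3.
  subst i3; have E : m1 R (A i4) = m1 R (A i2).
    by apply/eqP; rewrite eq_le h ?h' // eq_sym.
  by rewrite /m1a E.
have E1 : m1 R (A i3) = m1 R (A i1).
  apply/eqP; rewrite eq_le; apply/andP; split.
    by apply: le_trans le12; apply: h; rewrite eq_sym.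
  by apply: le_trans le34; exact: h'.
have E2 : m1 R (A i2) = m1 R (A i1).
  by apply/eqP; rewrite eq_le le12 -E1 h // eq_sym.
have E4 : m1 R (A i4) = m1 R (A i3).
  by apply/eqP; rewrite eq_le le34 E1 h'.
by rewrite !m1a_diag // E1.
Qed.

Lemma beta_le0 A : beta R A <= 0 -> (forall j, 0 < v (A j))%N -> forall j, e (A j) = 0%N.
Proof.
have [i1 [i2 [[n12 le12 h] ->]]] := beta_top_two A => b0 A0 j.
have := m1a_ub R (A i2) (subgraph_refl (A i1)) (A0 i1).
have -> : m1a R (A i2) (A i1) = 0 by apply/eqP; rewrite eq_le b0 m1a_ge0.
rewrite mul0r => h1; have m20 := m1_ge0 R (A i2).
have e0 : 0 <= (e (A i1))%:R :> R by [].
have [->|ji] := eqVneq j i1.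
  by apply/eqP; rewrite -(eqr_nat R) eq_le; apply/andP; split; lra.
have := h _ ji; have := m1_ge0 R (A j) => h2 h3.
have mj : m1 R (A j) = 0 by lra.
have := @m1_edges_in R _ (A j) (vset (A j)) (subxx _).
rewrite -card_gt0 mj mul0r edges_in_vset (ler_nat R _ 0) leqn0 => /(_ (A0 j)) /eqP //.
Qed.

(* Among tuples of members of the [F j] of least [m1], vary the member of [F i1]
   only: [i1] stays on top, so [beta] keeps comparing it with [i2]. *)
Lemma beta_families_patterns (F : forall j, {set sgraph (S j)}) (b0 : R) :
  0 < b0 ->
  (forall j, F j != set0) -> (forall j (B : sgraph (S j)), B \in F j -> (0 < v B)%N) ->
  (forall A, (forall j, A j \in F j) -> b0 <= beta R A) ->
  exists i1 i2 (x : R), [/\ i1 != i2, 0 <= x <= b0,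
    forall B : sgraph (S i1), B \in F i1 -> exists2 J, subgraph J B & sparse1 b0 x J &
    forall B : sgraph (S i2), B \in F i2 -> exists J, [/\ subgraph J B, (0 < v J)%N & 0 < x -> dense2 x J]].
Proof.
move=> b00 Fn Fv Fb.
have /fin_all_exists[As' Amin'] j : exists B : sgraph (S j), B \in F j /\
    forall B' : sgraph (S j), B' \in F j -> m1 R B <= m1 R B'.
  have /set0Pn[A0 A0F] := Fn j; exists [arg min_(A < A0 | A \in F j) m1 R A]%O.
  by case: arg_minP => // A AF h; split.
pose As (j : 'I_r) : sgraph (S j) := As' j.
have Amin (j : 'I_r) : As j \in F j /\ forall B' : sgraph (S j), B' \in F j -> m1 R (As j) <= m1 R B'.
  exact: Amin' j.
have AsF (j : 'I_r) : As j \in F j by have [] := Amin j.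
have As_le (j : 'I_r) (A : sgraph (S j)) : A \in F j -> m1 R (As j) <= m1 R A by have [_] := Amin j; apply.
have [i1 [i2 [[n12 le12 h] _]]] := beta_top_two As.
pose y := m1 R (As i2); have y0 : 0 <= y by exact: m1_ge0.
(* The exploration requires [x <= b0]. If [b0 <= y], a subgraph I with e(I) >= b0 (v(I) - 1) serves
   for the first type; otherwise one that witnesses [b0 <= m1a]. *)
exists i1, i2, (Num.min y b0); split=> //.
- by rewrite le_min y0 (ltW b00) ge_min lexx orbT.
- move=> A AF; have y_le : y <= m1 R A by apply: le_trans (As_le _ _ AF).
  pose A' : forall j : 'I_r, sgraph (S j) := @eqtype.dfwith _ (fun j : 'I_r => sgraph (S j)) As i1 A.
  have A'1 : A' i1 = A by rewrite /A' dfwith_in.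
  have A'n j : j != i1 -> A' j = As j by move=> ji; rewrite /A' dfwith_out // eq_sym.
  have A'F j : A' j \in F j.
    by have [->|ji] := eqVneq j i1; rewrite ?A'1 ?A'n.
  have bE : beta R A' = m1a R (As i2) A.
    rewrite (@beta_eq _ i1 i2); first by rewrite A'1 A'n // eq_sym.
      by move=> j; exact: Fv.
    split=> // [|j ji]; first by rewrite A'1 A'n // eq_sym.
    by rewrite !A'n // ?h // eq_sym.
  have := Fb _ A'F; rewrite bE => hb.
  pose theta (J : sgraph (S i1)) : R := b0 * (v J)%:R - (e J)%:R.
  have [I [IA I2 Ix]] : exists I, [/\ subgraph I A, (2 <= v I)%N & theta I <= Num.min y b0].
    have [yb|yb] := lerP b0 y.
      have [I [IA I2 hI]] := m1_witness b00 (le_trans yb y_le).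
      by exists I; split=> //; move: hI; rewrite /theta; lra.
    have [I [IA I1 hI]] := m1a_witness b00 hb.
    exists I; split=> //; last by move: hI; rewrite -/y /theta; lra.
    rewrite ltn_neqAle I1 andbT; apply: contraTneq hI => vI.
    rewrite -vI -edges_in_vset edges_in0 ?addr0 ?mulr1 -?ltNge //.
    by rewrite -/(v I) -vI.
  (* [theta] is the exponent of the expected number of copies. It is minimised over at least two
     vertices only; a single vertex has the value [b0], which is no smaller than the minimum. *)
  pose J := [arg min_(J < I | subgraph J A && (2 <= v J)%N) theta J]%O.
  have : [/\ subgraph J A, (2 <= v J)%N & forall J', subgraph J' A -> (2 <= v J')%N -> theta J <= theta J'].
    rewrite /J; case: arg_minP => [|J' /andP[h1 h2] h3]; first by rewrite IA.
    by split=> // J'' h4 h5; apply: h3; rewrite h4.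
  move: J => J [JA J2 Jmin]; have Jx := le_trans (Jmin _ IA I2) Ix.
  exists J => //; split=> // W WJ; rewrite -card_gt0 => W0.
  have [W1|W2] := leqP #|W| 1.
    rewrite edges_in0 ?ltnS // subr0; have -> : #|W| = 1%N by apply/eqP; rewrite eqn_leq W1.
    by rewrite mulr1; apply: le_trans Jx _; rewrite ge_min lexx orbT.
  have := Jmin (induced_sub J W) (subgraph_trans (induced_subgraph _ _) JA).
  by rewrite /theta v_induced // e_induced //; apply.
move=> A AF; have y_le : y <= m1 R A by exact: As_le.
have [x0|x0] := ltrP 0 (Num.min y b0); last first.
  by exists A; split; [exact: subgraph_refl|exact: Fv AF|by []].
have mA : 0 < m1 R A by apply: lt_le_trans y_le; move: x0; rewrite lt_min => /andP[].
have [J [JA J2 hJ]] := m1_witness mA (lexx _).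
exists J; split=> // [|_]; first exact: ltnW.
split=> //; exists (m1 R A); first by rewrite ge_min y_le.
split; first by apply/eqP; rewrite eq_le hJ m1_ub.
move=> W WJ W0; apply: (le_trans (m1_edges_in R WJ W0)).
by rewrite ler_wpM2r ?m1_subgraph // subr_ge0 (ler_nat R 1) card_gt0.
Qed.

End Beta.

(** * Patterns on a common vertex type *)

Section Relabel.
Variables (T U : finType) (f : T -> U).
Hypothesis fi : injective f.
Implicit Types (A : sgraph T) (I : {set T}).

Lemma relabel_subproof A : copyE A f \subset pairs (f @: vset A).
Proof. by apply: copyE_pairs => // x y _ _; exact: fi. Qed.

Definition relabel A : sgraph U := @SGraph U (f @: vset A, copyE A f) (relabel_subproof A).

Lemma v_relabel A : v (relabel A) = v A.
Proof. exact: card_imset. Qed.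

Lemma e_relabel A : e (relabel A) = e A.
Proof. by apply: card_copyE => x y _ _; exact: fi. Qed.

Lemma edges_in_relabel A I : edges_in (relabel A) (f @: I) = edges_in A I.
Proof.
rewrite /edges_in -(card_imset (mem (eset A :&: pairs I)) (f := fun x : {set T} => f @: x)); last first.
  exact: imset_inj.
apply: eq_card => y; rewrite !inE; apply/andP/imsetP => [[/imsetP[x xA ->]]|[x]].
  case/andP=> /subsetP xI x2; exists x => //; rewrite inE xA inE -(card_imset _ fi) x2 andbT.
  apply/subsetP => u ux; have /imsetP[w wI /fi ->] := xI _ (imset_f f ux) => //.
rewrite !inE => /and3P[xA xI x2] ->; split; first exact: imset_f.
by rewrite imsetS // card_imset.
Qed.

Lemma vset_relabel A (J : {set U}) : J \subset vset (relabel A) -> J != set0 ->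
  exists I, [/\ I \subset vset A, I != set0 & J = f @: I].
Proof.
move=> /subsetP JA J0; have E : J = f @: (vset A :&: f @^-1: J).
  apply/setP => u; apply/idP/imsetP => [uJ|[w]]; last by rewrite !inE => /andP[_ ?] ->.
  by have /imsetP[w wA uE] := JA _ uJ; exists w; rewrite // !inE wA -uE.
exists (vset A :&: f @^-1: J); split=> //; first exact: subsetIl.
by apply: contraNneq J0 => h; rewrite E h imset0.
Qed.

Lemma injP_relabel (V : finType) A (g : U -> V) :
  injP (relabel A) g = injP A (fun t => g (f t)).
Proof.
apply/injPP/injPP => H.
  by move=> x y xA yA E; apply: fi; apply: H => //; exact: imset_f.
by move=> _ _ /imsetP[x xA ->] /imsetP[y yA ->] E; rewrite (H x y).
Qed.

Lemma copyE_relabel (V : finType) A (g : U -> V) :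
  copyE (relabel A) g = copyE A (fun t => g (f t)).
Proof.
rewrite /copyE /relabel {1}/eset /= /copyE -imset_comp; apply: eq_imset => x /=.
by rewrite -imset_comp.
Qed.

Lemma sparse1_relabel (R : realType) (b0 x : R) A : sparse1 b0 x A -> sparse1 b0 x (relabel A).
Proof.
case=> h1 h2 h3; split; rewrite ?v_relabel ?e_relabel // => J JA J0.
have [I [IA I0 ->]] := vset_relabel JA J0.
by rewrite card_imset // edges_in_relabel; exact: h3.
Qed.

Lemma dense2_relabel (R : realType) (x : R) A : dense2 x A -> dense2 x (relabel A).
Proof.
case=> h1 [y xy [h2 h3]]; split; first by rewrite v_relabel.
exists y => //; rewrite v_relabel e_relabel; split=> // J JA J0.
have [I [IA I0 ->]] := vset_relabel JA J0.
by rewrite card_imset // edges_in_relabel; exact: h3.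
Qed.

End Relabel.

Lemma is_copyE (S T : finType) (H : sgraph S) (G : sgraph T) (f : S -> T) :
  is_copy H G f = [&& injP H f, f @: vset H \subset vset G & copyE H f \subset eset G].
Proof.
rewrite /is_copy; congr [&& _, _ & _]; apply/forall_inP/subsetP => h.
  by move=> y /imsetP[x xH ->]; exact: h.
by move=> x xH; apply: h; exact: imset_f.
Qed.

(** * Certificates *)

Lemma seq_min (R : realDomainType) (s : seq R) x : x \in s ->
  exists2 m, m \in s & forall y, y \in s -> m <= y.
Proof.
elim: s x => // a [|b s] IH x _.
  by exists a; rewrite ?inE // => y; rewrite inE => /eqP ->.
have [m ms hm] := IH b (mem_head _ _); have [am|ma] := lerP a m.
  exists a; first exact: mem_head.
  by move=> y; rewrite inE => /orP[/eqP ->//|ys]; apply: le_trans am (hm _ ys).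
exists m; first by rewrite inE ms orbT.
by move=> y; rewrite inE => /orP[/eqP ->|]; [exact: ltW|exact: hm].
Qed.

Lemma inf_attained (R : realType) (X : classical_sets.set R) (s : seq R) :
  (forall y, X y -> y \in s) -> (exists y, X y) ->
  X (inf X) /\ forall y, X y -> inf X <= y.
Proof.
move=> Xs [x Xx]; pose s' := [seq y <- s | `[< X y >]].
have s'P y : X y -> y \in s' by move=> Xy; rewrite mem_filter Xs // andbT; apply/asboolP.
have [m ms hm] := seq_min (s'P _ Xx).
have Xm : X m by move: ms; rewrite mem_filter => /andP[/asboolP].
have E : inf X = m.
  apply/eqP; rewrite eq_le; apply/andP; split.
    by apply: ge_inf => //; exists m => y /s'P/hm.
  by apply: lb_le_inf; [exists m|move=> y /s'P/hm].
by rewrite E; split=> // y /s'P/hm.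
Qed.

Lemma sup_attained (R : realType) (X : classical_sets.set R) (s : seq R) :
  (forall y, X y -> y \in s) -> (exists y, X y) ->
  X (sup X) /\ forall y, X y -> y <= sup X.
Proof.
move=> Xs [x Xx]; pose Y : classical_sets.set R := fun y => X (- y).
have [||h1 h2] := @inf_attained R Y [seq - y | y <- s].
- by move=> y /Xs ys; rewrite -[y]opprK map_f.
- by exists (- x); rewrite /Y opprK.
have E : sup X = - inf Y.
  apply/eqP; rewrite eq_le; apply/andP; split.
    apply: ge_sup; first by exists x.
    by move=> y Xy; rewrite lerNr; apply: h2; rewrite /Y opprK.
  apply: ub_le_sup => //; exists (- inf Y) => y Xy.
  by rewrite lerNr; apply: h2; rewrite /Y opprK.
by rewrite E; split=> // y Xy; rewrite lerNr; apply: h2; rewrite /Y opprK.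
Qed.

Section Certificates.
Variables (R : realType) (r : nat) (S : 'I_r -> finType) (k : nat).
Variable H : forall j : 'I_r, sgraph (S j).
Hypothesis k0 : (0 < k)%N.
Hypothesis H0 : forall j, (0 < v (H j))%N.
Let i0 := Ordinal k0.

(** A finite list with all values of [beta]; through it every [inf] and [sup] in [beta_crit] is
    attained. *)
Definition beta_values : seq R :=
  codom (fun a : {dffun forall j : 'I_r, sgraph (S j)} => beta R (fun j => a j)).

Lemma beta_values_mem (A : forall j : 'I_r, sgraph (S j)) : beta R A \in beta_values.
Proof.
apply/codomP; exists [ffun j => A j]; congr beta; apply: functional_extensionality_dep => j.
by rewrite ffunE.
Qed.

Lemma beta_families_attained (F : forall j : 'I_r, {set sgraph (S j)}) :
  (forall j, F j != set0) ->
  (exists A, (forall j, A j \in F j) /\ beta_families R F = beta R A) /\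
  forall A, (forall j, A j \in F j) -> beta_families R F <= beta R A.
Proof.
move=> Fn; have [||h1 h2] := @inf_attained R (fun b => exists A : forall j, sgraph (S j),
    (forall j, A j \in F j) /\ b = beta R A) beta_values.
- by move=> y [A [_ ->]]; exact: beta_values_mem.
- have Fx j : exists A, A \in F j by exact/set0Pn.
  by exists (beta R (fun j => xchoose (Fx j))), (fun j => xchoose (Fx j)); split=> // j; exact: xchooseP.
by split=> // A AF; apply: h2; exists A.
Qed.

Lemma certificate_mem (T : finType) (J : sgraph T) (F : 'I_k -> {set sgraph T}) i :
  (0 < v J)%N -> certificate J F -> J \in F i.
Proof.
move=> J0 [h1 h2]; pose V := [ffun j : 'I_k => if j == i then vset J else set0].
have : [ffun j => induced_sub J (V j)] \in Part J k.
  apply/imsetP; exists V => //; rewrite inE; apply/andP; split.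
    rewrite (bigD1 i) //= ffunE eqxx big1 ?setU0 // => j ji.
    by rewrite ffunE (negPf ji).
  apply/forallP => j; apply/forallP => j'; apply/implyP => jj; rewrite !ffunE.
  case: eqVneq => [E|_]; last by rewrite -setI_eq0 set0I.
  by rewrite -E eq_sym (negPf jj) -setI_eq0 setI0.
case/h2 => j; rewrite !ffunE; case: eqVneq => [->|_]; first by rewrite induced_vset.
by move/h1 => [_]; rewrite v_induced ?sub0set // cards0.
Qed.

Lemma certificate_all (T : finType) (J : sgraph T) : (0 < v J)%N ->
  certificate J (fun _ : 'I_k => [set A | subgraph A J && (0 < v A)%N]).
Proof.
case/card_gt0P => u uJ; split=> [i A|P /imsetP[V]]; first by rewrite inE => /andP.
rewrite inE => /andP[/eqP VJ _] ->; have : u \in \bigcup_i V i by rewrite VJ.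
case/bigcupP => i _ ui; exists i; rewrite ffunE inE induced_subgraph /=.
by apply/card_gt0P; exists u; rewrite inE /= uJ ui.
Qed.

Notation families := (forall j : 'I_r, 'I_k -> {set sgraph (S j)}).

Lemma range_attained (F : families) : (forall j, certificate (H j) (F j)) ->
  (exists i, inf (range (fun i : 'I_k => beta_families R (fun j => F j i))) =
     beta_families R (fun j => F j i)) /\
  forall i, inf (range (fun i : 'I_k => beta_families R (fun j => F j i))) <=
     beta_families R (fun j => F j i).
Proof.
move=> Fc; set X := range _.
have [||[i _ h1] h2] := @inf_attained R X [seq beta_families R (fun j => F j i) | i : 'I_k].
- by move=> y [i _ <-]; exact: codom_f.
- by exists (beta_families R (fun j => F j i0)), i0.
by split=> [|j]; [exists i|apply: h2; exists j].
Qed.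

Let certs_n0 (F : families) i : (forall j, certificate (H j) (F j)) -> forall j, F j i != set0.
Proof.
move=> Fc j; apply/set0Pn; exists (H j); exact: certificate_mem.
Qed.

Let crit_attained : let X := fun b => exists F : families,
    (forall j, certificate (H j) (F j)) /\
    b = inf (range (fun i : 'I_k => beta_families R (fun j => F j i))) in
  X (beta_crit R H k) /\ forall y, X y -> y <= beta_crit R H k.
Proof.
apply: (@sup_attained R _ beta_values).
  move=> y [F [Fc ->]]; have [[i ->] _] := range_attained Fc.
  have [[A [_ ->]] _] := beta_families_attained (certs_n0 i Fc); exact: beta_values_mem.
by eexists; exists (fun j i => [set A | subgraph A (H j) && (0 < v A)%N]); split=> // j;
  exact: certificate_all.
Qed.

Lemma beta_crit_cert : exists F : families, (forall j, certificate (H j) (F j)) /\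
  forall i A, (forall j, A j \in F j i) -> beta_crit R H k <= beta R A.
Proof.
have [[F [Fc E]] _] := crit_attained; exists F; split=> // i A AF.
have [_ h] := range_attained Fc; have [_ h'] := beta_families_attained (certs_n0 i Fc).
by rewrite E; apply: le_trans (h i) (h' _ AF).
Qed.

Lemma beta_crit_le (F : families) : (forall j, certificate (H j) (F j)) ->
  exists i A, (forall j, A j \in F j i) /\ beta R A <= beta_crit R H k.
Proof.
move=> Fc; have [_ h] := crit_attained; have [[i E] _] := range_attained Fc.
have [[A [AF E']] _] := beta_families_attained (certs_n0 i Fc).
by exists i, A; split=> //; rewrite -E' -E; apply: h; exists F.
Qed.

(** * From certificates to monochromatic copies *)

Section Transfer.
Variables (T : finType) (G : sgraph T) (cc : T -> 'I_r) (Y : 'I_k -> {set T}).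

Definition mono_in (W : {set T}) j (Z : finType) (A : sgraph Z) : Prop :=
  exists f : Z -> T, [/\ is_copy A G f, f @: vset A \subset W &
    forall u, u \in vset A -> cc (f u) = j].

Hypothesis cross : forall i i' y z, i != i' -> y \in Y i -> z \in Y i' -> adj G y z.

(** Complete adjacency between the classes does two things: it supplies the edges between the
    pieces, and it keeps their images disjoint, as no vertex is adjacent to itself. *)
Lemma mono_glue j (V : {ffun 'I_k -> {set S j}}) :
  \bigcup_i V i = vset (H j) ->
  (forall i, (0 < v (induced_sub (H j) (V i)))%N ->
     mono_in (Y i) j (induced_sub (H j) (V i))) ->
  mono_in [set: T] j (H j).
Proof.
move=> VH hm; have VsH i : V i \subset vset (H j) by rewrite -VH; exact: bigcup_sup.
have /card_gt0P[u0 u0H] := H0 j.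
have [i1 _ ui1] : exists2 i, true & u0 \in V i.
  by move: u0H; rewrite -VH => /bigcupP[i _ ui]; exists i.
have [|f0 _] := hm i1.
  by rewrite v_induced //; apply/card_gt0P; exists u0.
have /fin_all_exists[f hf] i : exists f : S j -> T, [/\ is_copy (induced_sub (H j) (V i)) G f,
    f @: V i \subset Y i & forall u, u \in V i -> cc (f u) = j].
  have [v0|v0] := posnP #|V i|; last first.
    by have := hm i; rewrite v_induced // => /(_ v0)[f []]; rewrite vset_induced // => h1 h2 h3; exists f.
  have Vi0 : V i = set0 by apply/eqP; rewrite -cards_eq0 v0.
  exists (fun=> f0 u0); split.
  - rewrite is_copyE vset_induced // Vi0 imset0 sub0set /=; apply/andP; split.
      by apply/injPP => x y; rewrite vset_induced ?sub0set // inE.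
    apply/subsetP => y /imsetP[x /edge_sub[]]; rewrite vset_induced ?sub0set // subset0.
    by move=> /eqP ->; rewrite cards0.
  - by rewrite Vi0 imset0 sub0set.
  - by move=> u; rewrite Vi0 inE.
pose p u := odflt i0 [pick i | u \in V i].
have pP u : u \in vset (H j) -> u \in V (p u).
  rewrite -VH => /bigcupP[i _ ui]; rewrite /p; case: pickP => //= /(_ i).
  by rewrite ui.
pose F u := f (p u) u.
have FY u : u \in vset (H j) -> F u \in Y (p u).
  by move=> uH; have [_ /subsetP h _] := hf (p u); apply/h/imset_f/pP.
have cr x y : x \in vset (H j) -> y \in vset (H j) -> p x != p y -> adj G (F x) (F y).
  by move=> xH yH pxy; apply: cross pxy (FY _ xH) (FY _ yH).
have cp i := let: And3 h _ _ := hf i in h.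
exists F; split; last 2 first.
- exact: subsetT.
- by move=> u uH; have [_ _ h] := hf (p u); apply/h/pP.
rewrite is_copyE; apply/and3P; split.
- apply/injPP => x y xH yH E; have [pxy|pxy] := eqVneq (p x) (p y).
    have := cp (p x); rewrite is_copyE => /and3P[/injPP fi _ _].
    by apply: fi; rewrite ?vset_induced //; [exact: pP|rewrite pxy pP|move: E; rewrite /F -pxy].
  by have := adj_neq (cr _ _ xH yH pxy); rewrite E eqxx.
- apply/subsetP => y /imsetP[u uH ->]; have := cp (p u).
  rewrite is_copyE vset_induced // => /and3P[_ /subsetP h _]; apply: h; apply: imset_f; exact: pP.
apply/subsetP => y /imsetP[x xe ->]; have [xH x2] := edge_sub xe.
have /cards2P[a [b [ab xE]]] : #|x| == 2%N by rewrite x2.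
have aH : a \in vset (H j) by apply: (subsetP xH); rewrite xE !inE eqxx.
have bH : b \in vset (H j) by apply: (subsetP xH); rewrite xE !inE eqxx orbT.
have [pab|pab] := eqVneq (p a) (p b); last first.
  by rewrite xE imsetU1 imset_set1; exact: cr.
have -> : F @: x = f (p a) @: x by rewrite xE !imsetU1 !imset_set1 /F -pab.
have := cp (p a); rewrite is_copyE => /and3P[_ _ /subsetP]; apply; apply: imset_f.
rewrite inE /= xe inE x2 eqxx andbT subsetI xH /= xE subUset !sub1set pP //=.
by rewrite pab pP.
Qed.

(** If no [H j] is monochromatic, then the avoided subgraphs form certificates: a partition with all
    non-empty parts realised would be glued to a copy of [H j]. A tuple of these families with
    [beta] at most [beta_crit] contradicts the hypothesis. *)
Lemma transfer :
  (forall i (A : forall j, sgraph (S j)), (forall j, (0 < v (A j))%N) ->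
     (forall j, subgraph (A j) (H j)) -> beta R A <= beta_crit R H k ->
     exists j, mono_in (Y i) j (A j)) ->
  exists j, mono_in [set: T] j (H j).
Proof.
move=> good; apply: contrapT => no.
pose F (j : 'I_r) i := [set A | [&& subgraph A (H j), (0 < v A)%N & ~~ `[< mono_in (Y i) j A >]]].
have [j|i [A [AF Ab]]] := @beta_crit_le F.
  split=> [i A|P /imsetP[V]]; first by rewrite inE => /and3P[].
  rewrite inE => /andP[/eqP VH _ ->]; apply: contrapT => none; apply: no; exists j.
  apply: (mono_glue VH) => i v0; apply: contrapT => nm; apply: none; exists i.
  by rewrite ffunE inE induced_subgraph v0; apply/asboolPn.
have [j|j|//|j] := good i A.
- by have := AF j; rewrite inE => /and3P[].
- by have := AF j; rewrite inE => /and3P[].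
by have := AF j; rewrite inE => /and3P[_ _ /asboolPn].
Qed.

End Transfer.
End Certificates.

(** * The deterministic case *)

Lemma density_edges (R : realType) (d : R) (k : nat) : (2 <= k)%N -> 0 < d <= 1 ->
  (k%:R - 2) / (k%:R - 1) < d ->
  exists kap n1 : R, 0 < kap /\ forall (T : finType) (G : sgraph T),
    n1 <= (v G)%:R -> d <= density R G ->
    exists delta : R, [/\ delta <= 1, kap <= 1 - (k%:R - 1) * (1 - delta) &
      delta * (v G)%:R ^+ 2 <= 2 * (e G)%:R].
Proof.
move=> k2 /andP[d0 d1] hk; have k1 : 0 < k%:R - 1 :> R by rewrite subr_gt0 (ltr_nat R 1).
(* Half of the slack that d > (k-2)/(k-1) provides; the other half absorbs the difference between
   v(v-1) and v^2 in the definition of density. *)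
pose kap := (1 - (k%:R - 1) * (1 - d)) / 2.
have kap0 : 0 < kap.
  by rewrite divr_gt0 //; move: hk; rewrite ltr_pdivrMr // => hk; move: hk; lra.
exists kap, (2 + (k%:R - 1) / kap); split=> // T G hn hd.
have n2 : 2 <= (v G)%:R :> R.
  by apply: le_trans hn; rewrite lerDl divr_ge0 // ltW.
have n0 : 0 < (v G)%:R :> R by exact: lt_le_trans n2.
exists (d - d / (v G)%:R); split.
- by rewrite lerBlDr (le_trans d1) // lerDl divr_ge0 // ltW.
- have : (k%:R - 1) * (d / (v G)%:R) <= kap.
    rewrite mulrA ler_pdivrMr //; apply: (@le_trans _ _ (k%:R - 1)).
      by rewrite ler_piMr // ltW.
    rewrite mulrC -ler_pdivrMr //; apply: le_trans hn; by rewrite lerDr.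
  by rewrite /kap; lra.
have c0 : 0 < 'C(v G, 2)%:R :> R by rewrite ltr0n bin_gt0 -(ler_nat R).
move: hd; rewrite /density ler_pdivlMr // => hd.
have cE : 2 * 'C(v G, 2)%:R = (v G)%:R * ((v G)%:R - 1) :> R.
  have vg0 : (0 < v G)%N by rewrite -(ltr0n R).
  rewrite -natrM mul_bin_left bin1 natrM mulrC; congr (_ * _).
  by rewrite subn1 -[in RHS](prednK vg0) -natr1 addrK.
apply: (@le_trans _ _ (2 * (d * 'C(v G, 2)%:R))); last by rewrite ler_pM2l.
rewrite [leRHS]mulrCA cE le_eqVlt; apply/orP; left; apply/eqP; field.
by rewrite gt_eqF.
Qed.

Lemma ramseyP (r : nat) (S : 'I_r -> finType) (H : forall j, sgraph (S j)) (T : finType)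
    (G : sgraph T) :
  reflect (forall cc : {ffun T -> 'I_r}, exists j, mono_in G cc [set: T] j (H j)) (ramsey H G).
Proof.
apply: (iffP forallP) => h cc.
  have /existsP[j /existsP[f /andP[fc /forall_inP hc]]] := h cc.
  by exists j, f; split=> // u /hc/eqP.
have [j [f [fc _ hc]]] := h cc; apply/existsP; exists j; apply/existsP; exists [ffun u => f u].
have -> : ([ffun u => f u] : {ffun S j -> T}) = f :> (S j -> T).
  by apply: functional_extensionality_dep => u; rewrite ffunE.
by rewrite fc; apply/forall_inP => u /hc ->.
Qed.

Section ZeroCase.
Variables (R : realType) (r : nat) (S : 'I_r -> finType) (H : forall j, sgraph (S j)).
Variables (d : R) (k : nat).
Hypotheses (r2 : (2 <= r)%N) (H0 : forall j, (0 < v (H j))%N) (k2 : (2 <= k)%N).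
Hypotheses (d01 : 0 < d <= 1) (hdk : (k%:R - 2) / (k%:R - 1) < d).

Lemma edgeless_mono (T : finType) (G : sgraph T) (cc : T -> 'I_r) (Y : {set T})
    (A : forall j, sgraph (S j)) :
  Y \subset vset G -> (forall j, e (A j) = 0%N) -> (r * (\sum_j #|S j|) <= #|Y|)%N ->
  exists j, mono_in G cc Y j (A j).
Proof.
move=> YG eA hY; set b := (\sum_j _)%N in hY.
have r0 : (0 < r)%N by exact: ltnW.
pose D j := [set y in Y | cc y == j].
have [j hj] : exists j, (b <= #|D j|)%N.
  apply/existsP; apply: contraTT hY => /existsPn hD; rewrite -ltnNge.
  have -> : #|Y| = (\sum_j #|D j|)%N.
    rewrite -sum1_card (partition_big cc predT) //=; apply: eq_bigr => j _.
    by rewrite -sum1_card; apply: eq_bigl => y; rewrite inE.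
  rewrite -[X in (_ < X * _)%N](card_ord r) -sum_nat_const.
  apply: (@leq_trans (\sum_(j < r) (b - 1)).+1).
    rewrite ltnS; apply: leq_sum => j _; have := hD j; rewrite -ltnNge; case: (b) => // b'.
    by rewrite ltnS subn1.
  have b0 : (0 < b)%N by have := hD (Ordinal r0); rewrite -ltnNge; case: (b).
  by rewrite !sum_nat_const card_ord; move: r0 b0; clear; nia.
have Sb : (#|S j| <= b)%N by rewrite /b (bigD1 j) //= leq_addr.
have [S0|S0] := posnP #|S j|.
  have hS (s : S j) : False by have := card0_eq S0 s; rewrite inE.
  exists j, (fun s => False_rect _ (hS s)); split=> [||u]; try by case: (hS u).
    rewrite is_copyE; apply/and3P; split.
    - by apply/injPP => x; case: (hS x).
    - by apply/subsetP => y /imsetP[x]; case: (hS x).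
    by apply/subsetP => y /imsetP[x /edge_sub[_ x2]]; have := max_card (mem x); rewrite x2 S0.
  by apply/subsetP => y /imsetP[x]; case: (hS x).
have /card_gt0P[t0 _] : (0 < #|D j|)%N by apply: leq_trans hj; apply: leq_trans Sb.
pose f (s : S j) := nth t0 (enum (D j)) (enum_rank s).
have fr (s : S j) : (enum_rank s < size (enum (D j)))%N.
  by rewrite -cardE; apply: leq_trans (ltn_ord _) (leq_trans Sb hj).
have fD s : f s \in D j by rewrite -mem_enum mem_nth.
have fi : injective f.
  move=> s s' /eqP; rewrite nth_uniq ?enum_uniq // => /eqP E.
  by apply: enum_rank_inj; apply: val_inj.
have fY (W : {set S j}) : f @: W \subset Y.
  by apply/subsetP => y /imsetP[s _ ->]; have := fD s; rewrite inE => /andP[].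
exists j, f; split=> // [|u _]; last by have := fD u; rewrite inE => /andP[_ /eqP].
rewrite is_copyE; apply/and3P; split.
- by apply/injPP => x y _ _; exact: fi.
- exact: subset_trans (fY _) YG.
have /eqP := eA j; rewrite cards_eq0 => /eqP A0.
by apply/subsetP => y /imsetP[x]; rewrite A0 inE.
Qed.

(** Tuples with [beta] equal to 0 are edgeless, so in each class of a complete multipartite subgraph
    with [Q] vertices per class the pigeonhole principle alone yields a monochromatic member. *)
Lemma ramsey_of_beta_crit0 : beta_crit R H k = 0 ->
  exists n0 : nat, forall (T : finType) (G : sgraph T),
    (n0 <= v G)%N -> d <= density R G -> ramsey H G.
Proof.
move=> b00; have [kap [n1 [kap0 hd]]] := density_edges k2 d01 hdk.
have k0 : (0 < k)%N by exact: ltnW.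
pose Q := (r * \sum_j #|S j|)%N.
have [c c0 hc] := hom_supersat (fun p : 'I_k * 'I_Q => p.1) k2 kap0.
set m := #|{: 'I_k * 'I_Q}| in hc.
exists (1 + Num.truncn n1 + Num.truncn (m%:R ^+ 2 / c)).+1 => T G hn dG.
have lt_n (x : R) : (Num.truncn x < v G)%N -> x < (v G)%:R.
  by move=> h; apply: lt_le_trans (truncnS_gt _) _; rewrite ler_nat.
have hn1 : n1 <= (v G)%:R by apply/ltW/lt_n; move: hn; clear; lia.
have hn2 : m%:R ^+ 2 / c < (v G)%:R.
  by apply: lt_n; move: hn; clear; lia.
have vg : (0 < v G)%N by move: hn; clear; lia.
have [delta [h1 h2 h3]] := hd _ _ hn1 dG.
have := hc _ G delta vg h1 h2 h3; rewrite -/m => hh.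
have [f fh fi] : exists2 f, f \in homs G (fun p : 'I_k * 'I_Q => p.1) & injectiveb f.
  apply/exists_inP; apply: contraTT hh => /exists_inPn ni; rewrite -ltNge.
  have : (#|homs G (fun p : 'I_k * 'I_Q => p.1)| <= m ^ 2 * v G ^ (m - 1))%N.
    apply: leq_trans (card_noninj _ _); apply/subset_leq_card/subsetP => f fh.
    rewrite inE ni // andbT; apply/forallP => l.
    by have /homsP[h _] := fh; exact: h.
  rewrite -(ler_nat R) natrM !natrX => h; apply: (le_lt_trans h).
  case: (posnP m) => [m0|m0].
    by rewrite m0 expr0n mul0r expr0 mulr1.
  have -> : (v G)%:R ^+ m = (v G)%:R * (v G)%:R ^+ (m - 1) :> R.
    by rewrite -exprS subn1 prednK.
  rewrite mulrA ltr_pM2r ?exprn_gt0 ?ltr0n //.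
  by rewrite mulrC -ltr_pdivrMr.
have [fV fadj] := homsP _ _ _ fh; move/injectiveP: fi => fi.
apply/ramseyP => cc; pose Y i := [set f (i, q) | q : 'I_Q].
have := @transfer R r S k H k0 H0 T G cc Y; apply.
  move=> i i' y z ii /imsetP[q _ ->] /imsetP[q' _ ->]; exact: fadj.
move=> i A A0 AH; rewrite b00 => bA; apply: edgeless_mono.
- by apply/subsetP => y /imsetP[q _ ->]; exact: fV.
- exact: (beta_le0 r2 bA A0).
by rewrite card_imset ?card_ord // => q q' /fi[].
Qed.

End ZeroCase.

(** * The 1-statement *)

Lemma tagged_inj (r : nat) (S : 'I_r -> finType) (j : 'I_r) :
  injective (fun s : S j => Tagged S s).
Proof. by move=> s s' /eqP; rewrite eq_Tagged => /eqP. Qed.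

Section OneStatement.
Variables (R : realType) (r : nat) (S : 'I_r -> finType) (H : forall j, sgraph (S j)).
Variables (d : R) (k : nat).
Hypotheses (r2 : (2 <= r)%N) (H0 : forall j, (0 < v (H j))%N) (k2 : (2 <= k)%N).
Hypotheses (d01 : 0 < d <= 1) (hdk : (k%:R - 2) / (k%:R - 1) < d).
Let b0 := beta_crit R H k.
Hypothesis b0_gt0 : 0 < b0.

Notation tuple := {dffun forall j : 'I_r, sgraph (S j)}.

Definition sparse_tuple (a : tuple) : bool :=
  [forall j, subgraph (a j) (H j) && (0 < v (a j))%N] && (beta R (fun j => a j) <= b0).

(** A coordinate for each class and each sparse tuple: which tuple the certificates will single out,
    and in which class, depends on the colouring, so all of them must be served at once. *)
Let L : finType := {l : 'I_k * tuple | sparse_tuple l.2}.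
Let U : finType := {j : 'I_r & S j}.
Let part (l : L) : 'I_k := (val l).1.
Let B (l : L) (j : 'I_r) : sgraph U := relabel (@tagged_inj r S j) ((val l).2 j).

Let LP (l : L) j : subgraph ((val l).2 j) (H j) /\ (0 < v ((val l).2 j))%N.
Proof. by have /andP[/forallP/(_ j)/andP] := valP l. Qed.

Lemma arrows_ramsey (V : finType) (G : sgraph V) (E : {set {set V}}) :
  vset G = [set: V] -> arrows G part B E -> ramsey H (gunion G (graph_of E)).
Proof.
move=> vG /forallP ar; apply/ramseyP => cc; have /existsP[Y /andP[/forallP cr /forallP sp]] := ar cc.
pose Z i := \bigcup_(l | part l == i) Y l.
have k0 : (0 < k)%N by exact: ltnW.
have := @transfer R r S k H k0 H0 V (gunion G (graph_of E)) cc Z; apply.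
  move=> i i' y z ii /bigcupP[l /eqP li yl] /bigcupP[l' /eqP li' zl].
  have := forallP (cr l) l'; rewrite li li' ii /= => /forall_inP/(_ y yl)/forall_inP/(_ z zl).
  by rewrite /adj /eset /= inE => ->.
move=> i A A0 AH bA; pose a : tuple := [ffun j => A j].
have ga : sparse_tuple a.
  apply/andP; split; first by apply/forallP => j; rewrite ffunE AH A0.
  have -> // : (fun j => a j) = A.
  by apply: functional_extensionality_dep => j; rewrite ffunE.
pose l : L := exist _ (i, a) ga.
have /existsP[j /existsP[g /and4P[gi gE gY /forall_inP gc]]] := sp l.
have BE : B l j = relabel (@tagged_inj r S j) (A j) by rewrite /B /= ffunE.
rewrite BE injP_relabel in gi; rewrite BE copyE_relabel in gE.
rewrite BE -imset_comp in gY.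
exists j, (fun s => g (Tagged S s)); split.
- rewrite is_copyE gi /=; apply/andP; split.
    by apply/subsetP => y _; rewrite inE vG inE.
  apply/subsetP => y yc; rewrite inE; apply/orP; right; rewrite inE (subsetP gE) //=.
  by apply: (subsetP (copyE_pairs _ (subsetT _))) yc; exact/injPP.
- by apply: subset_trans gY _; apply: (bigcup_sup l); rewrite /part /=.
- by move=> u uA; apply/eqP/gc; rewrite BE; exact: imset_f.
Qed.

Lemma one_statement (eta : R) : 0 < eta -> exists K n0 : R, 0 < K /\
  forall (V : finType) (G : sgraph V) (q : R), vset G = [set: V] -> n0 <= #|V|%:R ->
    d <= density R G -> q <= 1 -> K * #|V|%:R `^ (- b0^-1) <= q ->
    1 - eta <= Ex q (enum (pairs [set: V])) (fun E => (ramsey H (gunion G (graph_of E)))%:R).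
Proof.
move=> eta0; have [kap [n1 [kap0 hd]]] := density_edges k2 d01 hdk.
have /choice[i1 /choice[i2 hi]] (l : L) : exists i1 i2, top_two R (fun j => (val l).2 j) i1 i2 /\
   beta R (fun j => (val l).2 j) = m1a R ((val l).2 i2) ((val l).2 i1).
  exact: beta_top_two.
pose x (l : L) := m1 R ((val l).2 (i2 l)).
have bl (l : L) : m1a R ((val l).2 (i2 l)) ((val l).2 (i1 l)) <= b0.
  by have [_ <-] := hi l; have /andP[] := valP l.
have [|||||K [n0 [K0 HK]]] := @one_core R U L k r part B i1 x b0 kap k2 _ b0_gt0 kap0 _ _ _ _ eta eta0.
- exact: ltnW.
- by move=> l; rewrite v_relabel; have [] := LP l (i1 l).
- by move=> l; exact: m1_ge0.
- move=> l J JB J0; have [I [IA I0 ->]] := @vset_relabel _ _ _ (@tagged_inj r S (i1 l)) ((val l).2 (i1 l)) J JB J0.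
  rewrite /B edges_in_relabel (card_imset _ (@tagged_inj r S (i1 l))) addrC.
  have I1 : (0 < #|I|)%N by rewrite card_gt0.
  have := m1a_ub R ((val l).2 (i2 l)) (induced_subgraph ((val l).2 (i1 l)) I).
  rewrite v_induced // e_induced // => /(_ I1) h; apply: (le_trans h).
  by apply: ler_wpM2r.
- move=> l j J ji JB J0; have [I [IA I0 ->]] := @vset_relabel _ _ _ (@tagged_inj r S j) ((val l).2 j) J JB J0.
  rewrite /B edges_in_relabel (card_imset _ (@tagged_inj r S j)).
  apply: (le_trans (m1_edges_in R IA I0)); apply: ler_wpM2r.
    by rewrite subr_ge0 (ler_nat R 1) card_gt0.
  by have [[_ _ h] _] := hi l; exact: h.
exists K, (Num.max n0 n1); split=> // V G q vG; rewrite ge_max => /andP[hn0 hn1] dG q1 hq.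
have vV : v G = #|V| by rewrite /v vG cardsT.
rewrite -vV in hn1; have [delta [h1 h2 h3]] := hd _ _ hn1 dG.
apply: (le_trans (HK V G delta q vG hn0 h1 h2 h3 q1 hq)); apply: ler_Ex => [|E].
  rewrite q1 andbT; apply: le_trans hq; rewrite mulr_ge0 ?powR_ge0 //; exact: ltW.
by apply: ler_bool; exact: arrows_ramsey.
Qed.

End OneStatement.

(** * The 0-statement *)

Lemma typ_relabel (T U V : finType) (h : T -> U) (hi : injective h) (Js : {set sgraph U})
    (J : sgraph T) (E : {set {set V}}) (f : T -> V) :
  relabel hi J \in Js -> injP J f -> copyE J f \subset E -> (0 < v J)%N ->
  typ Js E (f @: vset J).
Proof.
move=> JJ fi fE /card_gt0P[u0 _].
pose g := [ffun u => if [pick t | h t == u] is Some t then f t else f u0].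
have gh : (fun t => g (h t)) = f.
  apply: functional_extensionality_dep => t; rewrite ffunE; case: pickP => [t' /eqP/hi -> //|/(_ t)].
  by rewrite eqxx.
apply/existsP; exists (relabel hi J); rewrite JJ; apply/existsP; exists g.
by rewrite injP_relabel copyE_relabel gh fi fE -imset_comp -gh /=.
Qed.

(** * The extremal graph *)

Section Multipartite.
Variables (V : finType) (k : nat) (cls : V -> 'I_k).

Definition multi_edges : {set {set V}} :=
  [set x in pairs [set: V] | ~~ [exists i, x \subset cls @^-1: [set i]]].

Lemma multi_subproof : multi_edges \subset pairs [set: V].
Proof. by apply/subsetP => x; rewrite inE => /andP[]. Qed.

Definition multipartite : sgraph V := @SGraph V ([set: V], multi_edges) multi_subproof.

Lemma adj_multi x y : adj multipartite x y -> cls x != cls y.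
Proof.
rewrite /adj inE => /andP[_]; apply: contraNneq => E; apply/existsP; exists (cls x).
by apply/subsetP => z; rewrite !inE => /orP[] /eqP -> //; rewrite E.
Qed.

(** By k M (M - 1) <= M (k M - 1), at most a fraction 1/k of all pairs lies inside the classes. *)
Lemma density_multi (R : realType) M : (2 <= k)%N -> (0 < M)%N -> #|V| = (k * M)%N ->
  (forall i, #|cls @^-1: [set i]| <= M)%N ->
  (k%:R - 1) / k%:R <= density R multipartite.
Proof.
move=> k2 M0 cV hcls; have k0 : (0 < k)%N by exact: ltnW.
have cp (W : {set V}) : #|pairs W| = 'C(#|W|, 2).
  exact: cards_draws.
have vE : v multipartite = (k * M)%N by rewrite /v cardsT.
have h1 : ('C(k * M, 2) <= e multipartite + k * 'C(M, 2))%N.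
  rewrite -cV -cardsT -cp -(cardsID multi_edges (pairs [set: V])); apply: leq_add.
    by apply/subset_leq_card/subsetIr.
  apply: (@leq_trans #|\bigcup_i pairs (cls @^-1: [set i])|).
    apply/subset_leq_card/subsetP => x /setDP[xp]; rewrite inE xp negbK => /existsP[i xi].
    apply/bigcupP; exists i => //; rewrite inE xi /=.
    by move: xp; rewrite inE => /andP[].
  apply: (@leq_trans (\sum_(i < k) #|pairs (cls @^-1: [set i])|)).
    apply: (big_rec2 (fun (A : {set {set V}}) n => #|A| <= n)%N); first by rewrite cards0.
    by move=> i A n _ h; apply: leq_trans (leq_card_setU _ _) _; rewrite leq_add2l.
  rewrite -[X in (_ <= X * _)%N](card_ord k) -sum_nat_const; apply: leq_sum => i _.
  by rewrite cp leq_bin2l.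
have cE (n : nat) : (0 < n)%N -> 2 * 'C(n, 2)%:R = n%:R * (n%:R - 1) :> R.
  move=> n0; rewrite -natrM mul_bin_left bin1 natrM mulrC; congr (_ * _).
  by rewrite subn1 -[in RHS](prednK n0) -natr1 addrK.
have n2 : (2 <= k * M)%N by apply: leq_trans k2 _; rewrite leq_pmulr.
have c0 : 0 < 'C(k * M, 2)%:R :> R by rewrite ltr0n bin_gt0.
rewrite /density vE ler_pdivlMr //.
have kR : 0 < k%:R :> R by rewrite ltr0n.
have h2 : 'C(k * M, 2)%:R <= (e multipartite)%:R + k%:R * 'C(M, 2)%:R :> R.
  by rewrite -natrM -natrD ler_nat.
have h3 : k%:R * 'C(M, 2)%:R <= 'C(k * M, 2)%:R / k%:R :> R.
  rewrite ler_pdivlMr // -(ler_pM2l (ltr0Sn R 1)) cE ?muln_gt0 ?k0 //.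
  have -> : 2 * (k%:R * 'C(M, 2)%:R * k%:R) = k%:R * k%:R * (2 * 'C(M, 2)%:R) :> R by ring.
  rewrite cE // natrM.
  have M1 : 1 <= M%:R :> R by rewrite (ler_nat R 1).
  have k1 : 1 <= k%:R :> R by rewrite (ler_nat R 1).
  have -> : k%:R * M%:R * (k%:R * M%:R - 1) = k%:R * M%:R * (k%:R * (M%:R - 1)) +
    k%:R * M%:R * (k%:R - 1) :> R by ring.
  have -> : k%:R * k%:R * (M%:R * (M%:R - 1)) = k%:R * M%:R * (k%:R * (M%:R - 1)) :> R by ring.
  by rewrite lerDl !mulr_ge0 // subr_ge0.
have -> : (k%:R - 1) / k%:R * 'C(k * M, 2)%:R = 'C(k * M, 2)%:R - 'C(k * M, 2)%:R / k%:R :> R.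
  by field; rewrite gt_eqF.
by move: h2 h3; move: ('C(k * M, 2)%:R) (_ / _) => z1 z2; lra.
Qed.

End Multipartite.

Section ZeroStatement.
Variables (R : realType) (r : nat) (S : 'I_r -> finType) (H : forall j, sgraph (S j)).
Variables (k : nat).
Hypotheses (r2 : (2 <= r)%N) (H0 : forall j, (0 < v (H j))%N) (k2 : (2 <= k)%N).
Let b0 := beta_crit R H k.
Hypothesis b0_gt0 : 0 < b0.
Let U : finType := {j : 'I_r & S j}.
Let lift j (J : sgraph (S j)) : sgraph U := relabel (@tagged_inj r S j) J.

Section Colouring.
Variables (F : forall j : 'I_r, 'I_k -> {set sgraph (S j)}) (i1 i2 : 'I_k -> 'I_r).
Variables (J1 J2 : 'I_k -> {set sgraph U}).
Hypothesis Fc : forall j, certificate (H j) (F j).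
Hypothesis n12 : forall i, i1 i != i2 i.
Hypothesis h1 : forall i (A : sgraph (S (i1 i))), A \in F (i1 i) i ->
  exists J, [/\ subgraph J A, (0 < v J)%N & lift J \in J1 i].
Hypothesis h2 : forall i (A : sgraph (S (i2 i))), A \in F (i2 i) i ->
  exists J, [/\ subgraph J A, (0 < v J)%N & lift J \in J2 i].

(** A monochromatic copy of [H j] is cut by the classes, and one piece belongs to its family
    [F j i]. Edges of [G] run between classes, so this piece uses edges of [E] only. As class [i]
    has just the colours [i1 i] and [i2 i], the piece contains a typed copy, which has a vertex of
    the other colour. *)
Lemma not_ramsey (V : finType) (cls : V -> 'I_k) (G : sgraph V) (E : {set {set V}}) :
  (forall x y, adj G x y -> cls x != cls y) -> (forall i, splits (J1 i) (J2 i) E) ->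
  ~~ ramsey H (gunion G (graph_of E)).
Proof.
move=> Gc sp; apply/negP => /ramseyP hr.
have /fin_all_exists[c hc] i : exists c : {ffun V -> bool},
   (forall X, typ (J1 i) E X -> exists2 z, z \in X & ~~ c z) /\
   (forall X, typ (J2 i) E X -> exists2 z, z \in X & c z) by apply/splitsP.
pose cc : {ffun V -> 'I_r} := [ffun y => if c (cls y) y then i1 (cls y) else i2 (cls y)].
have [j [f [fc _ mono]]] := hr cc.
move: fc; rewrite is_copyE => /and3P[/injPP fi _ /subsetP fE].
pose W := [ffun i => [set u in vset (H j) | cls (f u) == i]].
have WH i : W i \subset vset (H j) by apply/subsetP => u; rewrite ffunE inE => /andP[].
have : [ffun i => induced_sub (H j) (W i)] \in Part (H j) k.
  apply/imsetP; exists W => //; rewrite inE; apply/andP; split.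
    rewrite eqEsubset; apply/andP; split; first by apply/bigcupsP => i _.
    by apply/subsetP => u uH; apply/bigcupP; exists (cls (f u)); rewrite ?ffunE ?inE ?uH /=.
  apply/forallP => i; apply/forallP => i'; apply/implyP => ii; rewrite !ffunE -setI_eq0.
  apply/eqP/setP => u; rewrite !inE; apply/negP => /andP[/andP[_ /eqP ui] /andP[_ /eqP ui']].
  by rewrite -ui -ui' eqxx in ii.
have [_ Fj] := Fc j; case/Fj => i; rewrite ffunE => AF.
have [/(_ _ _ AF)[_ /card_gt0P[u0 u0W]] _] := Fc j; rewrite vset_induced // in u0W.
have WP u : u \in W i -> u \in vset (H j) /\ cls (f u) = i.
  by rewrite ffunE inE => /andP[? /eqP].
have copyJ (J : sgraph (S j)) : subgraph J (induced_sub (H j) (W i)) ->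
    [/\ vset J \subset W i, injP J f & copyE J f \subset E].
  move=> /andP[JW JE]; rewrite vset_induced // in JW; split=> //.
    apply/injPP => x y /(subsetP JW)/WP[xH _] /(subsetP JW)/WP[yH _]; exact: fi.
  apply/subsetP => y /imsetP[x xJ yE]; have [xJv x2] := edge_sub xJ.
  have := subsetP JE _ xJ; rewrite inE => /andP[xH _].
  have := fE (f @: x) (imset_f _ xH); rewrite -yE inE => /orP[yG|]; last by rewrite inE => /andP[].
  have /cards2P[a [b [_ xE]]] : #|x| == 2%N by rewrite x2.
  have [_ ai] : a \in vset (H j) /\ cls (f a) = i.
    by apply/WP/(subsetP JW)/(subsetP xJv); rewrite xE !inE eqxx.
  have [_ bi] : b \in vset (H j) /\ cls (f b) = i.
    by apply/WP/(subsetP JW)/(subsetP xJv); rewrite xE !inE eqxx orbT.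
  have := Gc (f a) (f b); rewrite ai bi eqxx /adj.
  by rewrite yE xE imsetU1 imset_set1 in yG; rewrite yG => /(_ isT).
have col u : u \in W i -> (if c i (f u) then i1 i else i2 i) = j.
  by move=> /WP[uH ui]; have := mono u uH; rewrite ffunE ui.
have := col _ u0W; have [hc1 hc2] := hc i; case: (c i (f u0)) => jE; subst j.
  have [J [JA J0 JJ]] := h1 AF; have [JW Ji JE] := copyJ _ JA.
  have [z /imsetP[u uJ ->] nz] := hc1 _ (typ_relabel JJ Ji JE J0).
  have := col _ (subsetP JW _ uJ); rewrite (negPf nz) => /eqP.
  by rewrite eq_sym (negPf (n12 i)).
have [J [JA J0 JJ]] := h2 AF; have [JW Ji JE] := copyJ _ JA.
have [z /imsetP[u uJ ->] nz] := hc2 _ (typ_relabel JJ Ji JE J0).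
have := col _ (subsetP JW _ uJ); rewrite nz => /eqP.
by rewrite (negPf (n12 i)).
Qed.

End Colouring.

Lemma zero_statement : exists K eps0 : R, [/\ 0 < K, 0 < eps0 &
  forall (V : finType) (cls : V -> 'I_k) (G : sgraph V) (eps q : R),
    (forall x y, adj G x y -> cls x != cls y) ->
    (0 < #|V|)%N -> 0 < eps <= eps0 -> 0 <= q <= 1 ->
    q <= eps * #|V|%:R `^ (- b0^-1) ->
    Ex q (enum (pairs [set: V])) (fun E => (ramsey H (gunion G (graph_of E)))%:R) <= K * eps].
Proof.
have k0 : (0 < k)%N by exact: ltnW.
have [F [Fc Fb]] := @beta_crit_cert R r S k H k0 H0.
have /choice[i1 /choice[i2 /choice[x hx]]] (i : 'I_k) : exists (i1 i2 : 'I_r) (x : R),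
   [/\ i1 != i2, 0 <= x <= b0,
    forall B : sgraph (S i1), B \in F i1 i -> exists2 J, subgraph J B & sparse1 b0 x J &
    forall B : sgraph (S i2), B \in F i2 i ->
      exists J, [/\ subgraph J B, (0 < v J)%N & 0 < x -> dense2 x J]].
  apply: (@beta_families_patterns R r S r2 (fun j => F j i) b0 b0_gt0).
  - by move=> j; apply/set0Pn; exists (H j); exact: certificate_mem.
  - by move=> j B BF; have [/(_ _ _ BF)[]] := Fc j.
  - by move=> A AF; exact: Fb AF.
pose J1 i : {set sgraph U} := [set P | `[< exists J : sgraph (S (i1 i)), sparse1 b0 (x i) J /\ P = lift J >]].
pose J2 i : {set sgraph U} := [set P | `[< exists J : sgraph (S (i2 i)),
   [/\ (0 < v J)%N, 0 < x i -> dense2 (x i) J & P = lift J] >]].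
have /choice[K /choice[eps0 hK]] (i : 'I_k) : exists K eps0 : R, [/\ 0 < K, 0 < eps0 &
    forall (V : finType) (eps q : R), (0 < #|V|)%N -> 0 < eps <= eps0 -> 0 <= q <= 1 ->
    q <= eps * #|V|%:R `^ (- b0^-1) ->
    Ex q (enum (pairs [set: V])) (fun E => (~~ splits (J1 i) (J2 i) E)%:R) <= K * eps].
  have [_ x01 _ _] := hx i; apply: (zero_core (x := x i)) => //.
  - move=> P; rewrite inE => /asboolP[J [hJ ->]]; exact: sparse1_relabel.
  - move=> x0 P; rewrite inE => /asboolP[J [_ hJ ->]]; apply: dense2_relabel; exact: hJ.
  - by move=> P; rewrite inE => /asboolP[J [J0 _ ->]]; rewrite v_relabel.
have [im him] : exists im, forall i, eps0 im <= eps0 i.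
  case: (arg_minP eps0 (erefl : predT (Ordinal k0))) => im _ h.
  by exists im => i; exact: h.
exists (1 + \sum_i K i), (eps0 im); split; last 1 first.
- move=> V cls G eps q Gc V0 /andP[eps_gt0 eps_le] q01 hq.
  apply: (@le_trans _ _ (Ex q (enum (pairs [set: V])) (fun E => \sum_i (~~ splits (J1 i) (J2 i) E)%:R))).
    apply: ler_Ex => // E; case: (boolP [exists i, ~~ splits (J1 i) (J2 i) E]) => [/existsP[i ni]|/existsPn all].
      apply: (@le_trans _ _ 1); first by case: ramsey.
      by rewrite (bigD1 i) //= ni lerDl sumr_ge0.
    rewrite (_ : ramsey _ _ = false) ?sumr_ge0 //; apply/negbTE.
    apply: (@not_ramsey F i1 i2 J1 J2 Fc _ _ _ V cls) => //.
    + by move=> i; have [] := hx i.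
    + move=> i A AF; have [_ _ h _] := hx i; have [J JA sJ] := h _ AF; exists J; split=> //.
        by case: sJ => h2 _ _; exact: ltnW.
      by rewrite inE; apply/asboolP; exists J.
    + move=> i A AF; have [_ _ _ h] := hx i; have [J [JA J0 dJ]] := h _ AF; exists J; split=> //.
      by rewrite inE; apply/asboolP; exists J.
    + by move=> i; have := all i; rewrite negbK.
  rewrite Ex_sum; apply: (@le_trans _ _ (\sum_i K i * eps)); last first.
    by rewrite -big_distrl /= ler_pM2r // lerDr.
  apply: ler_sum => i _; have [_ _ h] := hK i; apply: h => //.
  by rewrite eps_gt0 (le_trans eps_le).
- by rewrite ltr_pwDl // sumr_ge0 // => i _; have [/ltW] := hK i.
- by have [] := hK im.
Qed.

End ZeroStatement.

(** * The threshold *)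

Definition residue (k n : nat) (k0 : (0 < k)%N) (x : 'I_n) : 'I_k :=
  Ordinal (ltn_pmod x k0).

Lemma card_residue (k M : nat) (k0 : (0 < k)%N) (i : 'I_k) :
  (#|[set x : 'I_(k * M) | residue k0 x == i]| <= M)%N.
Proof.
have qM (x : 'I_(k * M)) : (x %/ k < M)%N by rewrite ltn_divLR // [X in (_ < X)%N]mulnC.
rewrite -[X in (_ <= X)%N]card_ord.
rewrite -(card_in_imset (f := fun x => Ordinal (qM x))) ?max_card //.
move=> x y; rewrite !inE => /eqP xi /eqP yi [E].
apply: val_inj; rewrite /= (divn_eq x k) (divn_eq y k) E; congr (_ + _)%N.
by move: xi yi => /(congr1 val) /= -> /(congr1 val) /= ->.
Qed.

Lemma perturbed_probE (R : realType) (r : nat) (S : 'I_r -> finType)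
    (H : forall j, sgraph (S j)) (n : nat) (G : sgraph 'I_n) (q : R) :
  perturbed_prob H G q =
  Ex q (enum (pairs [set: 'I_n])) (fun E => (ramsey H (gunion G (graph_of E)))%:R).
Proof. exact: gnp_probE. Qed.

Lemma perturbed_prob_itv (R : realType) (r : nat) (S : 'I_r -> finType)
    (H : forall j, sgraph (S j)) (n : nat) (G : sgraph 'I_n) (q : R) :
  0 <= q <= 1 -> 0 <= perturbed_prob H G q <= 1.
Proof.
move=> q01; rewrite perturbed_probE Ex_ge0 //=.
rewrite -[X in _ <= X](Ex_cst q (enum (pairs [set: 'I_n]))).
by apply: ler_Ex => // E; case: ramsey.
Qed.

Theorem theorem1p18 (R : realType) (r : nat) (S : 'I_r -> finType)
    (H : forall j : 'I_r, sgraph (S j)) (d : R) (k : nat)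
    (hr : (2 <= r)%N)
    (hH : forall j : 'I_r, (1 <= v (H j))%N)
    (hd : 0 < d < 1)
    (hk : (2 <= k)%N)
    (hdk : (k%:R - 2) / (k%:R - 1) < d <= (k%:R - 1) / k%:R) :
  (0 < beta_crit R H k ->
     is_threshold H d (fun n : nat => n%:R `^ (- 1 / beta_crit R H k))) /\
  (beta_crit R H k = 0 ->
     exists n0 : nat, forall (T : finType) (G : sgraph T),
       (n0 <= v G)%N -> d <= density R G -> ramsey H G).
Proof.
have d01 : 0 < d <= 1 by move: hd => /andP[-> /ltW].
have /andP[hd1 hd2] := hdk; have k0 : (0 < k)%N by exact: ltnW.
split=> [b0|]; last exact: (ramsey_of_beta_crit0 hr hH hk d01 hd1).
set b := beta_crit R H k in b0 *; set p := fun n : nat => _.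
have pE n : p n = n%:R `^ (- b^-1) by rewrite /p mulN1r.
have p0 n : 0 <= p n by exact: powR_ge0.
split.
(* At [n = 0] the power is 0, as 0 raised to a non-zero exponent is 0. *)
- move=> n; rewrite p0 pE /=; case: n => [|n].
    by rewrite powR0 // oppr_eq0 invr_eq0 gt_eqF.
  rewrite powRN invf_le1 ?powR_gt0 //.
  have n1 : 1 <= n.+1%:R :> R by rewrite (ler_nat R 1).
  have bi0 : 0 <= b^-1 by rewrite invr_ge0 ltW.
  by have := ler_powR n1 bi0; rewrite powRr0.
(* Multiples of [k], so that the residue classes are equal in size and the density reaches
   (k-1)/k. *)
- pose ns m := (k * m.+1)%N; pose cls m := @residue k (ns m) k0.
  exists ns, (fun m => multipartite (cls m)); split=> //.
  + by move=> m; rewrite muln_gt0 k0.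
  + by move=> l m lm; rewrite ltn_pmul2l.
  + move=> m; apply: le_trans hd2 _; apply: (@density_multi _ _ _ R m.+1) => //.
      by rewrite card_ord.
    by move=> i; apply: leq_trans (card_residue m.+1 k0 i); apply/subset_leq_card/subsetP => x; rewrite !inE.
  move=> q q01 /eqoP qp; have [K [eps0 [K0 e0 HK]]] := zero_statement hr hH hk b0.
  apply/cvgrPdist_le => eta eta0; rewrite /=.
  (* Eventually q <= eps p, and the failure bound [K * eps] is then at most [eta]. *)
  pose eps := Num.min eps0 (eta / K).
  have eps_gt0 : 0 < eps by rewrite lt_min e0 divr_gt0.
  have [N _ HN] := qp _ eps_gt0; exists N => // m Nm.
  have /andP[P0 P1] := perturbed_prob_itv H (multipartite (cls m)) (q01 (ns m)).
  rewrite sub0r normrN ger0_norm //.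
  have Nn : (N <= ns m)%N by apply: leq_trans Nm _; apply: leq_trans (leqnSn m) _; rewrite leq_pmull.
  have := HN _ Nn; rewrite /= !ger0_norm ?p0 //; last by have /andP[] := q01 (ns m).
  rewrite pE => hq; rewrite perturbed_probE.
  have V0 : (0 < #|'I_(ns m)|)%N by rewrite card_ord muln_gt0 k0.
  have e1 : 0 < eps <= eps0 by rewrite eps_gt0 ge_min lexx.
  rewrite -[in X in _ <= _ * X `^ _ ](card_ord (ns m)) in hq.
  apply: le_trans (HK _ (cls m) _ eps _ _ V0 e1 (q01 _) hq) _.
    by move=> x y; exact: adj_multi.
  by rewrite mulrC -ler_pdivlMr // ge_min lexx orbT.
move=> q q01 /eqoP pq G Gv Gd; apply/cvgrPdist_le => eta eta0; rewrite /=.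
have [K [n0 [K0 HK]]] := one_statement hr hH hk d01 hd1 b0 eta0.
have Ki : 0 < K^-1 by rewrite invr_gt0.
have [N _ HN] := pq _ Ki.
(* The 2 is there because the density of [G n] is only prescribed from two vertices on. *)
exists (maxn (maxn N 2) (Num.truncn n0).+1) => // n /=.
rewrite !geq_max => /andP[/andP[Nn n2] nn0].
have /andP[P0 P1] := perturbed_prob_itv H (G n) (q01 n).
rewrite ger0_norm ?subr_ge0 // lerBlDr addrC -lerBlDr perturbed_probE.
have /andP[q0 q1] := q01 n.
apply: HK => //.
- by rewrite card_ord; apply/ltW/(lt_le_trans (truncnS_gt _)); rewrite ler_nat.
- exact: Gd.
have := HN _ Nn; rewrite /= !ger0_norm ?p0 // pE => h.
by rewrite card_ord mulrC -ler_pdivlMr // mulrC.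
Qed.
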